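(* Let $S$ be a nonnegative symmetric linear relation in a complex Hilbert space $\mathcal H$, with Friedrichs extension $S_{\rm F}$ and Kreĭn extension $S_{\rm K}$. Then: (1) for arbitrary nonnegative selfadjoint extensions $\widetilde S_1$ and $\widetilde S_2$ of $S$, their arithmetic mean $\tfrac12(\widetilde S_1\dot+\widetilde S_2)$, their harmonic mean $h(\widetilde S_1,\widetilde S_2)$, and the nonnegative selfadjoint linear relation $c_0(\widetilde S_1,\widetilde S_2)=\mathfrak C\big(\tfrac12(\mathfrak C(\widetilde S_1)+\mathfrak C(\widetilde S_2))\big)$ are nonnegative selfadjoint extensions of $S$; (2) let $Q_\mu=\mathfrak C(S_{\rm F})$, $Q_M=\mathfrak C(S_{\rm K})$, $\mathfrak N_0=\overline{\operatorname{ran}}(Q_M-Q_\mu)$; if $\widetilde Z_1$ and $\widetilde Z_2$ are the parameters of $\mathfrak C(\widetilde S_1)$ and $\mathfrak C(\widetilde S_2)$, i.e. the selfadjoint contractions in $\mathfrak N_0$ with $$\mathfrak C(\widetilde S_k)=\tfrac12(Q_\mu+Q_M)+\tfrac12(Q_M-Q_\mu)^{1/2}\widetilde Z_k(Q_M-Q_\mu)^{1/2},\quad k=1,2,$$ then the corresponding parameters for $\mathfrak C\big(\tfrac12(\widetilde S_1\dot+\widetilde S_2)\big)$, $\mathfrak C\big(h(\widetilde S_1,\widetilde S_2)\big)$ and $\mathfrak C\big(c_0(\widetilde S_1,\widetilde S_2)\big)$ are the operators $$h(I_{\mathfrak N_0}+\widetilde Z_1,I_{\mathfrak N_0}+\widetilde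 Z_2)-I_{\mathfrak N_0},\qquad I_{\mathfrak N_0}-h(I_{\mathfrak N_0}-\widetilde Z_1,I_{\mathfrak N_0}-\widetilde Z_2),\qquad \tfrac12(\widetilde Z_1+\widetilde Z_2),$$ respectively; (3) for an arbitrary nonnegative selfadjoint extension $\widetilde S$ of $S$, $$\tfrac12(S_{\rm F}\dot+\widetilde S)=S_{\rm F},\qquad h(S_{\rm K},\widetilde S)=S_{\rm K};$$ (4) if $\widetilde S_1$ and $\widetilde S_2$ are extremal extensions of $S$, then $\tfrac12(\widetilde S_1\dot+\widetilde S_2)$ and $h(\widetilde S_1,\widetilde S_2)$ are extremal extensions of $S$ as well; moreover, for an arbitrary extremal extension $\widetilde S$ of $S$, $$\tfrac12(S_{\rm K}\dot+\widetilde S)=\widetilde S,\qquad h(S_{\rm F},\widetilde S)=\widetilde S.$$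
   Context: A linear relation (l.r.) in $\mathcal H$ is a closed linear subspace $A=\{\{f,f'\}\}$ of $\mathcal H\oplus\mathcal H$ (bounded operators are identified with their graphs); $\operatorname{mul}A=\{f':\{0,f'\}\in A\}$; $A^{-1}=\{\{f',f\}:\{f,f'\}\in A\}$; $\lambda A=\{\{f,\lambda f'\}\}$. $A$ is symmetric if $A\subseteq A^*$, selfadjoint if $A=A^*$, where $A^*:=\{\{g,g'\}:(f',g)=(f,g')\ \forall\{f,f'\}\in A\}$; nonnegative if $(f',f)\ge0$ for all $\{f,f'\}\in A$. A nonnegative selfadjoint l.r. decomposes as $A=\mathrm{Graph}(A_o)\oplus(\{0\}\oplus\operatorname{mul}A)$ with $A_o$ a nonnegative selfadjoint operator in $\mathcal H\ominus\operatorname{mul}A$. The closed form of $A$ is $A[\varphi]=\|A_o^{1/2}\varphi\|^2$, $\varphi\in\mathcal D[A]=\operatorname{dom}A_o^{1/2}$; this gives a bijection between nonnegative selfadjoint l.r. and closed nonnegative (not necessarily densely defined) forms. The order $A_1\ge A_2$ means $\mathcal D[A_1]\subseteq\mathcal D[A_2]$ and $A_1[\varphi]\ge A_2[\varphi]$ for all $\varphi\in\mathcal D[A_1]$. The form sum $A\dot+B$ is the nonnegative selfadjoint l.r. associated with the closed form $A[\varphi]+B[\varphi]$, $\varphi\in\mathcal D[A]\cap\mathcal D[B]$. The harmonic mean is $h(A,B):=\big(\tfrac12(A^{-1}\dot+B^{-1})\big)^{-1}$ (for bounded nonnegative operators, this is the usual bounded harmonic mean). Cayley transform: for a nonnegative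 selfadjoint l.r. $A$, $\mathfrak C(A)=-I+2(I+A)^{-1}$, a selfadjoint contraction; for a selfadjoint contraction $T$, $\mathfrak C(T)=\{\{(I+T)f,(I-T)f\}:f\in\mathcal H\}$; these maps are mutually inverse. Let $S$ be a nonnegative symmetric l.r. Its Friedrichs extension $S_{\rm F}$ is the nonnegative selfadjoint l.r. associated with the closure of the form $\mathfrak s[f,g]=(f',g)$, $\{f,f'\},\{g,g'\}\in S$; its Kreĭn extension is $S_{\rm K}=((S^{-1})_{\rm F})^{-1}$. They are the maximal and minimal nonnegative selfadjoint extensions of $S$. A nonnegative selfadjoint extension $\widetilde S$ of $S$ is called extremal if $\inf\{(f'-g',f-g):\{g,g'\}\in S\}=0$ for all $\{f,f'\}\in\widetilde S$. By Kreĭn's theory, $\widetilde S$ is a nonnegative selfadjoint extension of $S$ if and only if $\mathfrak C(\widetilde S)=\tfrac12(Q_\mu+Q_M)+\tfrac12(Q_M-Q_\mu)^{1/2}\widetilde Z(Q_M-Q_\mu)^{1/2}$ for a (then unique) selfadjoint contraction $\widetilde Z$ in $\mathfrak N_0$, called the parameter of $\mathfrak C(\widetilde S)$. *)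

(* Defs.v *)
From HB Require Import structures.
From mathcomp Require Import all_boot all_order all_algebra.
From mathcomp Require Import all_classical all_reals all_analysis.
From mathcomp Require Import complex.

Set Implicit Arguments.
Unset Strict Implicit.
Unset Printing Implicit Defensive.

Import Order.TTheory GRing.Theory Num.Theory.
Import numFieldNormedType.Exports.

Local Open Scope classical_set_scope.
Local Open Scope ring_scope.
Local Open Scope complex_scope.

(* The Hilbert space is a complete normed space [H] over [R[i]] together with
   an inner product [dot], linear in its first argument, such that
   [dot x x = `|x| ^+ 2] (this identity is a hypothesis of the theorem).
   Linear relations, in particular bounded operators, are sets of pairs.

   The argument [K] of several definitions is a closed subspace of [H] in the
   role of the ambient Hilbert space: [K] is [setT] for relations in [H], and
   a smaller subspace for the operators acting in [H (-) mul A] or in [N_0]. *)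
Section LinearRelations.
Context {R : realType} {H : completeNormedModType R[i]}.
Context (dot : {dot H for (@Num.conj R[i])}).

Implicit Types (A B S T Z : set (H * H)) (K L : set H).

Definition linear_relation_in K A : Prop :=
  [/\ A `<=` K `*` K, submod_closed (mem A) & closed A].

Definition mulpart A : set H := [set f' | A (0, f')].

Definition idrel K : set (H * H) := [set (f, f) | f in K].

Definition scalerel (c : R[i]) A : set (H * H) := [set (f.1, c *: f.2) | f in A].

(* The sum of operators, not the sum of subspaces of [H * H]. *)
Definition addrel A B : set (H * H) :=
  [set f | exists g h, [/\ A (f.1, g), B (f.1, h) & f.2 = g + h]].

Definition diffrel A B : set (H * H) := addrel A (scalerel (-1) B).

Definition ominus K L : set H :=
  [set x | K x /\ forall y, L y -> dot x y = 0].

Definition adjoint_in K A : set (H * H) :=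
  [set g | [/\ K g.1, K g.2 & forall f, A f -> dot f.2 g.1 = dot f.1 g.2]].

Definition selfadjoint_in K A : Prop :=
  linear_relation_in K A /\ A = adjoint_in K A.

(* In [R[i]], [0 <= z] includes that [z] is real. *)
Definition nonnegative A : Prop := forall f, A f -> 0 <= dot f.2 f.1.

Definition symmetric_relation A : Prop := A `<=` adjoint_in setT A.

Definition nonneg_selfadjoint_in K A : Prop :=
  selfadjoint_in K A /\ nonnegative A.

(* [get] selects the square root, which exists and is unique when [A] is a
   nonnegative selfadjoint operator in [K]; otherwise the value is irrelevant.
   The same applies to [rel_of_form] and closed nonnegative forms in [K]. *)
Definition sqrt_in K A : set (H * H) :=
  get [set B | [/\ nonneg_selfadjoint_in K B, mulpart B = [set 0]
                 & (B \; B)%relation = A]].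

Definition op_part K A : set (H * H) :=
  A `&` (ominus K (mulpart A) `*` ominus K (mulpart A)).

(* A quadratic form is given by its graph, the set of the pairs
   [(phi, t[phi])] with [phi] in the domain of [t]. *)
Definition form_of K A : set (H * R[i]) :=
  [set (f.1, `|f.2| ^+ 2) | f in sqrt_in (ominus K (mulpart A)) (op_part K A)].

Definition rel_of_form K (t : set (H * R[i])) : set (H * H) :=
  get [set A | nonneg_selfadjoint_in K A /\ form_of K A = t].

Definition addform (s t : set (H * R[i])) : set (H * R[i]) :=
  [set p | exists a b, [/\ s (p.1, a), t (p.1, b) & p.2 = a + b]].

(* [phi] is in the domain of the closure of [t] when it is the limit of a
   sequence [u] in the domain of [t] such that [t[u n - u m]] tends to [0];
   the value at [phi] is then the limit of [t[u n]]. *)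
Definition form_closure (t : set (H * R[i])) : set (H * R[i]) :=
  [set p | exists (u : nat -> H) (a : nat -> R[i]^o),
    [/\ forall n, t (u n, a n), u n @[n --> \oo] --> p.1,
        a n @[n --> \oo] --> (p.2 : R[i]^o)
      & forall e : R[i], 0 < e -> exists N, forall m n, (N <= m)%N -> (N <= n)%N ->
          exists2 c, t (u m - u n, c) & c < e]].

Definition form_sum K A B : set (H * H) :=
  rel_of_form K (addform (form_of K A) (form_of K B)).

Definition arith_mean_rel K A B : set (H * H) :=
  scalerel 2^-1 (form_sum K A B).

Definition harm_mean_rel K A B : set (H * H) :=
  ((scalerel 2^-1%R (form_sum K (A^-1)%relation (B^-1)%relation))^-1)%relation.

Definition cayley A : set (H * H) :=
  addrel (scalerel (-1) (idrel setT))
         (scalerel 2 ((addrel (idrel setT) A)^-1)%relation).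

Definition cayley_contraction T : set (H * H) :=
  [set (f.1 + f.2, f.1 - f.2) | f in T].

Lemma cayley_contractionE T : cayley_contraction T = cayley T.
Proof.
rewrite /cayley_contraction /cayley.
apply/seteqP; split=> [_ [[f g] Tfg <-]|[x y]] /=.
  exists (- (f + g)), (2 *: f); split=> /=.
  - by exists (f + g, f + g); rewrite /= ?scaleN1r//; exists (f + g).
  - exists (f + g, f) => //=; exists f, g; split=> //; by exists f.
  - by rewrite scaler_nat mulr2n opprD addrACA addNr add0r addrC.
move=> [g [h [[_ [u _ <-] /= [ux <-]] []]]].
move=> [p z] /= [a [b [[c _ [/= cz <-]] /= Azb /= pE]]] [px <-] ->.
exists (z, b) => //=; congr pair; first by rewrite -px pE cz.
by rewrite ux -px pE cz scaler_nat mulr2n scaleN1r opprD addrACA addNr add0r addrC.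
Qed.

Definition cayley_mean_rel A B : set (H * H) :=
  cayley_contraction (scalerel 2^-1 (addrel (cayley A) (cayley B))).

(* The quadratic form [f |-> (f', f)], for [{f, f'}] in [S]. *)
Definition form_of_symmetric S : set (H * R[i]) :=
  [set (f.1, dot f.2 f.1) | f in S].

Definition friedrichs S : set (H * H) :=
  rel_of_form setT (form_closure (form_of_symmetric S)).

Definition krein S : set (H * H) := ((friedrichs (S^-1)%relation)^-1)%relation.

Definition nonneg_sa_extension S A : Prop :=
  nonneg_selfadjoint_in setT A /\ S `<=` A.

(* For a nonnegative extension [A] of [S] the set of which the infimum is
   taken consists of nonnegative reals and is not empty. *)
Definition extremal_extension S A : Prop :=
  nonneg_sa_extension S A /\
  forall f, A f ->
    inf [set complex.Re (dot (f.2 - g.2) (f.1 - g.1)) | g in S] = 0.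

Definition Q_mu S : set (H * H) := cayley (friedrichs S).

Definition Q_M S : set (H * H) := cayley (krein S).

Definition N_0 S : set H := closure (diffrel (Q_M S) (Q_mu S)).`2.

Definition selfadjoint_contraction_in K T : Prop :=
  [/\ selfadjoint_in K T, T.`1 = K & forall f, T f -> `|f.2| <= `|f.1|].

(* [Z] is the parameter of the selfadjoint contraction [T]. *)
Definition is_parameter S T Z : Prop :=
  let D := sqrt_in setT (diffrel (Q_M S) (Q_mu S)) in
  selfadjoint_contraction_in (N_0 S) Z /\
  T = addrel (scalerel 2^-1 (addrel (Q_mu S) (Q_M S)))
             (scalerel 2^-1 (D \; (Z \; D))%relation).

End LinearRelations.

(* Main.v *)
(** All Hilbert space computations use the real inner product
    [Re (x, y)], and the existence results (projections, resolvents, Riesz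
    representatives, the Friedrichs extension, parallel sums) come from one
    source: a maximizing sequence of [2 l m - p m m] is Cauchy for [p].

    The arithmetic mean [M] of two extensions is determined by its form, so that
    [{y, y'}] belongs to [M] once it is the limit of suitable pairs in both
    relations. Taking these pairs in [S] itself, where all extensions agree,
    gives the identities for [S_F]. An extension is extremal if and only if its
    form is a restriction of the form of [S_K], which is
    [phi |-> sup 2 Re (g', phi) - (g', g)] over [{g, g'}] in [S]; averages of
    such restrictions are again such restrictions.

    For the parameters, [C(A) = 2 (I + A)^-1 - I], and with
    [X_F = (I + S_F)^-1] and [D^2 = Q_M - Q_mu] one has
    [(I + S_k)^-1 = X_F + D (I + Z_k) D / 4]. The resolvent of the arithmetic
    mean is the harmonic mean of the two resolvents. Since [ran (I + S)] lies in
    the kernel of [D] and is dense for the seminorm [(X_F f, f)], the vectors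
    almost attaining the infimum that defines [h (I + Z_1, I + Z_2)] lift through
    [D] with any prescribed [X_F]-part, so the harmonic mean is
    [X_F + D h (I + Z_1, I + Z_2) D / 4]. Statements on harmonic means
    follow by passing to [S^-1], which exchanges [S_F] and [S_K] and negates
    Cayley transforms and parameters. *)
Require Import Defs.
From HB Require Import structures.
From mathcomp Require Import all_boot all_order all_algebra.
From mathcomp Require Import all_classical all_reals all_analysis.
From mathcomp Require Import complex ring lra.
Set Implicit Arguments.
Unset Strict Implicit.
Unset Printing Implicit Defensive.
Import Order.TTheory GRing.Theory Num.Theory.
Import numFieldNormedType.Exports.
Local Open Scope classical_set_scope.
Local Open Scope ring_scope.
Local Open Scope complex_scope.

(** * Real sequences that vanish, as seen from above *)

Section VanishingSequences.
Context {R : realType}.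
Implicit Types (a b : nat -> R) (q : nat -> nat -> R).

(** Square roots, relations of forms and the Friedrichs extension are chosen by [get], so nothing is
    known about them until existence is shown, together with the fact that a relation and its form
    determine each other. Spectral theory is replaced by bounded operators: a nonnegative
    selfadjoint relation is traded for its resolvent [X], with [0 <= X <= I], and the only
    functional calculus is a square root obtained by iteration, with its commutation property.
    Selfadjointness is used as [ran (I + A) = K]; an inclusion between two such relations is an
    equality, so the identities between means and extensions need one inclusion only. The main
    obstacle is that infima need not be attained: the sum of [I + Z_1] and [I + Z_2] may fail to be
    invertible, and [D] has only dense range in [N_0]. The second components of approximating pairs
    may thus diverge in each relation separately. The criterion for membership in a mean therefore
    asks only that first components converge, that the pairs are Cauchy in the form seminorms, and
    that the averaged second components converge when tested on the common form domain. *)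

Definition vanishes a := forall e : R, 0 < e ->
  exists N, forall n, (N <= n)%N -> a n < e.

Definition vanishes2 q := forall e : R, 0 < e ->
  exists N, forall m n, (N <= m)%N -> (N <= n)%N -> q m n < e.

(** As [vanishes] bounds from above only, comparison needs no sign condition; for nonnegative
    sequences it is convergence to [0]. *)
Lemma vanishes_le a b : (forall n, b n <= a n) -> vanishes a -> vanishes b.
Proof.
move=> ba va e e0; have [N HN] := va e e0.
by exists N => n Nn; apply: le_lt_trans (ba n) (HN n Nn).
Qed.

Lemma vanishesD a b : vanishes a -> vanishes b -> vanishes (fun n => a n + b n).
Proof.
move=> va vb e e0; have e20 : 0 < e / 2 by lra.
have [N HN] := va _ e20; have [M HM] := vb _ e20.
exists (maxn N M) => n; rewrite geq_max => /andP[Nn Mn].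
by have := HN n Nn; have := HM n Mn; lra.
Qed.

Lemma vanishesZ c a : 0 <= c -> vanishes a -> vanishes (fun n => c * a n).
Proof.
(* Dividing by [c + 1] instead of [c] covers [c = 0]. *)
move=> c0 va e e0; have [|N HN] := va (e / (c + 1)).
  by rewrite divr_gt0//; lra.
exists N => n Nn; have := HN n Nn; rewrite ltr_pdivlMr; last lra.
have [a0|/ltW a0 _] := leP 0 (a n); first nra.
by apply: le_lt_trans e0; rewrite mulr_ge0_le0.
Qed.

Lemma vanishes_sqr c a b : 0 <= c -> (forall n, b n ^+ 2 <= c * a n) ->
  vanishes a -> vanishes b.
Proof.
move=> c0 ba va e e0.
have [|N HN] := vanishesZ c0 va (e := e ^+ 2); first exact: exprn_gt0.
exists N => n Nn; have := HN n Nn; have := ba n => *.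
by rewrite ltNge; apply/negP => ?; nra.
Qed.

Lemma vanishes2_le q q' : (forall m n, q' m n <= q m n) -> vanishes2 q -> vanishes2 q'.
Proof.
move=> ba va e e0; have [N HN] := va e e0.
by exists N => m n Nm Nn; apply: le_lt_trans (ba m n) (HN m n Nm Nn).
Qed.

Lemma vanishes2D q q' : vanishes2 q -> vanishes2 q' ->
  vanishes2 (fun m n => q m n + q' m n).
Proof.
move=> va vb e e0; have e20 : 0 < e / 2 by lra.
have [N HN] := va _ e20; have [M HM] := vb _ e20.
exists (maxn N M) => m n; rewrite !geq_max => /andP[Nm Mm] /andP[Nn Mn].
by have := HN m n Nm Nn; have := HM m n Mm Mn; lra.
Qed.

Lemma vanishes2Z c q : 0 <= c -> vanishes2 q -> vanishes2 (fun m n => c * q m n).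
Proof.
move=> c0 va e e0; have [|N HN] := va (e / (c + 1)).
  by rewrite divr_gt0//; lra.
exists N => m n Nm Nn; have := HN m n Nm Nn; rewrite ltr_pdivlMr; last lra.
have [a0|/ltW a0 _] := leP 0 (q m n); first nra.
by apply: le_lt_trans e0; rewrite mulr_ge0_le0.
Qed.

Lemma vanishes_vanishes2 a :
  vanishes a -> vanishes2 (fun m n => a m + a n).
Proof.
move=> va e e0; have [|N HN] := va (e / 2); first lra.
by exists N => m n Nm Nn; have := HN m Nm; have := HN n Nn; lra.
Qed.

Lemma vanishes_harmonic : vanishes (@harmonic R).
Proof.
move=> e e0; exists (Num.truncn e^-1).+1 => n Nn.
rewrite /harmonic invf_plt ?posrE//.
apply: lt_trans (truncnS_gt _) _.
by rewrite ltr_nat ltnS.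
Qed.

Lemma vanishes_cst c : vanishes (fun=> c) -> c <= 0.
Proof.
move=> vc; rewrite leNgt; apply/negP => c0.
by have [N /(_ N (leqnn N))] := vc c c0; rewrite ltxx.
Qed.

Lemma eq_vanishes a b : a =1 b -> vanishes a -> vanishes b.
Proof. by move=> ab; apply: vanishes_le => n; rewrite ab. Qed.

End VanishingSequences.

(** * Nonnegative real forms and approximate Riesz representation *)

Section PositiveForms.
Context {R : realType} {U : lmodType R[i]}.
Implicit Types (M : set U) (p : U -> U -> R) (l : U -> R).

Definition csub M := M 0 /\ forall a x y, M x -> M y -> M (a *: x + y).

Lemma csubD M x y : csub M -> M x -> M y -> M (x + y).
Proof. by move=> [_ Ml] Mx My; rewrite -[x]scale1r; apply: Ml. Qed.

Lemma csubZ M a x : csub M -> M x -> M (a *: x).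
Proof. by move=> [M0 Ml] Mx; rewrite -[_ *: _]addr0; apply: Ml. Qed.

Lemma csubN M x : csub M -> M x -> M (- x).
Proof. by move=> Ms Mx; rewrite -scaleN1r; apply: csubZ. Qed.

Lemma csubB M x y : csub M -> M x -> M y -> M (x - y).
Proof. by move=> Ms Mx My; apply: csubD => //; apply: csubN. Qed.

Lemma csubP M : submod_closed (mem M) <-> csub M.
Proof.
split=> -[M0 Ml]; split.
- by move: M0; rewrite -topredE/= inE.
- move=> a x y Mx My; have := Ml a x y.
  by rewrite -!topredE/= !inE; apply.
- by rewrite -topredE/= inE.
- move=> a x y; rewrite -!topredE/= !inE; exact: Ml.
Qed.

Definition rlinear l :=
  (forall x y, l (x + y) = l x + l y) /\ (forall (r : R) x, l (r%:C *: x) = r * l x).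

Lemma rlinearN l x : rlinear l -> l (- x) = - l x.
Proof.
move=> [_ lZ]; have := lZ (-1) x.
by rewrite rmorphN rmorph1 scaleN1r mulN1r.
Qed.

Lemma rlinearB l x y : rlinear l -> l (x - y) = l x - l y.
Proof. by move=> ll; rewrite ll.1 rlinearN. Qed.

(** Linearity is asked everywhere, but symmetry and positivity only on [M]: forms such as [relform]
    are symmetric only along a symmetric relation. *)
Record psd_on M p : Prop := PsdOn {
  psdl : forall z, rlinear (p ^~ z);
  psdr : forall z, rlinear (p z);
  psdC : forall x y, M x -> M y -> p x y = p y x;
  psd_ge0 : forall x, M x -> 0 <= p x x }.

Lemma psdDl M p x y z : psd_on M p -> p (x + y) z = p x z + p y z.
Proof. by move=> pp; rewrite (psdl pp z).1. Qed.

Lemma psdDr M p x y z : psd_on M p -> p z (x + y) = p z x + p z y.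
Proof. by move=> pp; rewrite (psdr pp z).1. Qed.

Lemma psdBl M p x y z : psd_on M p -> p (x - y) z = p x z - p y z.
Proof. by move=> pp; rewrite (rlinearB _ _ (psdl pp z)). Qed.

Lemma psdNl M p x z : psd_on M p -> p (- x) z = - p x z.
Proof. by move=> pp; rewrite (rlinearN _ (psdl pp z)). Qed.

Lemma psdNr M p x z : psd_on M p -> p z (- x) = - p z x.
Proof. by move=> pp; rewrite (rlinearN _ (psdr pp z)). Qed.

Lemma psdZl M p r x z : psd_on M p -> p (r%:C *: x) z = r * p x z.
Proof. by move=> pp; rewrite (psdl pp z).2. Qed.

Lemma psdZr M p r x z : psd_on M p -> p z (r%:C *: x) = r * p z x.
Proof. by move=> pp; rewrite (psdr pp z).2. Qed.

(* Discriminant argument, allowing for a vanishing leading coefficient. *)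
Lemma discr_le (b c e : R) : 0 <= c ->
  (forall t : R, 2 * t * b - t ^+ 2 * c <= e) -> b ^+ 2 <= e * c.
Proof.
move=> c0 Ht; have [c_eq0|c_neq0] := eqVneq c 0.
  have [->|b0] := eqVneq b 0; first by rewrite c_eq0 expr0n mulr0.
  have := Ht ((e + 1) / (2 * b)); rewrite c_eq0 mulr0 subr0.
  suff -> : 2 * ((e + 1) / (2 * b)) * b = e + 1 by lra.
  by field.
have cp : 0 < c by rewrite lt_neqAle eq_sym c_neq0.
have := Ht (b / c).
suff -> : 2 * (b / c) * b - (b / c) ^+ 2 * c = b ^+ 2 / c by rewrite ler_pdivrMr.
by field.
Qed.

Lemma psd_CS M p x y : csub M -> psd_on M p -> M x -> M y ->
  p x y ^+ 2 <= p x x * p y y.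
Proof.
move=> Ms pp Mx My; apply: discr_le; first exact: (psd_ge0 pp).
move=> t; have Mtx : M (x - t%:C *: y) by apply: csubB => //; apply: csubZ.
have := psd_ge0 pp Mtx.
rewrite !(psdDl _ _ _ pp, psdDr _ _ _ pp, psdNl _ _ pp, psdNr _ _ pp, psdZl _ _ _ pp, psdZr _ _ _ pp).
by rewrite (psdC pp My Mx); lra.
Qed.

Lemma psd_triangle M p x y : csub M -> psd_on M p -> M x -> M y ->
  p (x + y) (x + y) <= 2 * p x x + 2 * p y y.
Proof.
move=> Ms pp Mx My; have := psd_ge0 pp (csubB Ms Mx My).
rewrite !(psdNl _ _ pp, psdNr _ _ pp, psdDl _ _ _ pp, psdDr _ _ _ pp).
lra.
Qed.

(* A maximizing sequence of [2 l m - p m m] is Cauchy by the parallelogram law,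
   and the second inequality is its approximate Euler-Lagrange equation. *)
Lemma almost_riesz M p l c : csub M -> psd_on M p -> rlinear l ->
  (forall m, M m -> 2 * l m - p m m <= c) ->
  exists m : nat -> U,
  [/\ forall n, M (m n),
      forall n k, p (m n - m k) (m n - m k) <= 2 * (harmonic n + harmonic k)
    & forall n w, M w -> (l w - p (m n) w) ^+ 2 <= harmonic n * p w w].
Proof.
move=> Ms pp ll bnd.
pose V := [set 2 * l m - p m m | m in M].
have supV : has_sup V.
  split; first by exists (2 * l 0 - p 0 0); exists 0 => //; exact: Ms.1.
  by exists c => _ [m Mm <-]; exact: bnd.
have /choice[m Hm] : forall n : nat, exists m, M m /\
    sup V - harmonic n < 2 * l m - p m m.
  move=> n; have [|_ [m Mm <-] Hm] := sup_adherent (eps := harmonic n) _ supV.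
    exact: harmonic_gt0.
  by exists m.
have EL n w : M w -> (l w - p (m n) w) ^+ 2 <= harmonic n * p w w.
  move=> Mw; have [Mm Hmn] := Hm n.
  apply: discr_le => [|t]; first exact: (psd_ge0 pp).
  have : 2 * l (m n + t%:C *: w) - p (m n + t%:C *: w) (m n + t%:C *: w) <= sup V.
    apply: sup_upper_bound => //; exists (m n + t%:C *: w) => //.
    by apply: csubD => //; exact: csubZ.
  rewrite !(psdDl _ _ _ pp, psdDr _ _ _ pp, psdZl _ _ _ pp, psdZr _ _ _ pp).
  rewrite ll.1 ll.2 (psdC pp Mw Mm); lra.
exists m; split=> // [n|n k]; first by have [] := Hm n.
have [[Mn _] [Mk _]] := (Hm n, Hm k).
(* Both Euler-Lagrange inequalities are tested with the difference [w] itself; subtracting them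
   bounds [p w w ^+ 2] by a small multiple of [p w w]. *)
have Mw := csubB Ms Mn Mk; set w := m n - m k.
have e1 := EL n w Mw; have e2 := EL k w Mw.
have Pw : p w w = p (m n) w - p (m k) w by rewrite (psdBl _ _ _ pp).
have P0 : 0 <= p w w := psd_ge0 pp Mw.
have : p w w ^+ 2 <= 2 * (harmonic n + harmonic k) * p w w.
  set u := l w - p (m n) w in e1; set v := l w - p (m k) w in e2.
  have {1}-> : p w w = v - u by rewrite Pw /u /v; ring.
  by have := sqr_ge0 (u + v); nra.
rewrite expr2; have [->|P1] := eqVneq (p w w) 0.
  by move=> _; rewrite mulr_ge0// addr_ge0// harmonic_ge0.
by rewrite ler_pM2r// lt_neqAle eq_sym P1.
Qed.

End PositiveForms.

(** * The real inner product *)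

Section RealInnerProduct.
Context {R : realType} {H : completeNormedModType R[i]}.
Context (dot : {dot H for (@Num.conj R[i])}).

Definition rdot (x y : H) : R := complex.Re (dot x y).
Notation "''[' x , y ]" := (rdot x y).
Notation "''[' x ]" := (rdot x x).

Lemma rdotDl x y z : '[x + y, z] = '[x, z] + '[y, z].
Proof. by rewrite /rdot linearDl raddfD. Qed.

Lemma rdotDr x y z : '[z, x + y] = '[z, x] + '[z, y].
Proof. by rewrite /rdot linearDr raddfD. Qed.

Lemma rdotNl x z : '[- x, z] = - '[x, z].
Proof. by rewrite /rdot linearNl raddfN. Qed.

Lemma rdotNr x z : '[z, - x] = - '[z, x].
Proof. by rewrite /rdot linearNr raddfN. Qed.

Lemma dotC_conj x y : dot x y = (dot y x)^*.
Proof. by rewrite (hermC dot x y) expr0 mul1r. Qed.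

Lemma rdotC x y : '[x, y] = '[y, x].
Proof.
by rewrite /rdot (dotC_conj x y); case: (dot y x).
Qed.

Lemma rdotZl (r : R) x z : '[r%:C *: x, z] = r * '[x, z].
Proof. by rewrite /rdot linearZl_LR/=; case: (dot x z) => a b /=; rewrite mul0r subr0. Qed.

Lemma rdotZr (r : R) x z : '[z, r%:C *: x] = r * '[z, x].
Proof. by rewrite rdotC rdotZl rdotC. Qed.

Lemma rdot0l z : '[0, z] = 0.
Proof. by rewrite -[0](subrr z) rdotDl rdotNl subrr. Qed.

Lemma rdot0r z : '[z, 0] = 0.
Proof. by rewrite rdotC rdot0l. Qed.

Lemma rdot_i x y : '['i *: x, 'i *: y] = '[x, y].
Proof.
rewrite /rdot linearZl_LR/= linearZr_LR/= mulrA.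
by rewrite -normCK normc_def/= expr0n expr1n add0r sqrtr1 expr1n mul1r.
Qed.

Lemma rdot_iC x y : '['i *: x, y] = - '[x, 'i *: y].
Proof. by rewrite -[LHS]rdot_i scalerA -expr2 sqr_i scaleN1r rdotNl. Qed.

(** [dot] is conjugate linear in its second argument, so pairing with ['i *: y] gives the imaginary
    part; real identities on a complex subspace thus carry over to [dot]. *)
Lemma dotE x y : dot x y = '[x, y] +i* '[x, 'i *: y].
Proof.
have -> : '[x, 'i *: y] = - '['i *: x, y] by rewrite rdot_iC opprK.
rewrite /rdot linearZl_LR/=; case: (dot x y) => a b /=.
by rewrite mul0r mul1r sub0r opprK.
Qed.

Lemma dot_eq x y z w :
  '[x, y] = '[z, w] -> '[x, 'i *: y] = '[z, 'i *: w] -> dot x y = dot z w.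
Proof. by move=> e1 e2; rewrite !dotE e1 e2. Qed.

Lemma rdot_ge0 x : 0 <= '[x].
Proof. by have := dnorm_ge0 dot x; rewrite lecE => /andP[]. Qed.

Lemma rdot_eq0 x : '[x] = 0 -> x = 0.
Proof.
move=> x0; apply/eqP; rewrite -(dnorm_eq0 dot) eq_complex/=.
have := dnorm_ge0 dot x; rewrite lecE/= => /andP[/eqP-> _].
by rewrite eqxx andbT; apply/eqP.
Qed.

Lemma dot_self x : dot x x = '[x]%:C.
Proof.
by have := dnorm_ge0 dot x; rewrite dotE lecE/= => /andP[/eqP->].
Qed.

Lemma psd_rdot (M : set H) : psd_on M rdot.
Proof.
split=> [z|z|x y _ _|x _]; [split=> *..| |].
- exact: rdotDl. - exact: rdotZl. - exact: rdotDr. - exact: rdotZr.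
- exact: rdotC. - exact: rdot_ge0.
Qed.

Lemma csubT : csub [set: H].
Proof. by []. Qed.

Lemma rdot_CS x y : '[x, y] ^+ 2 <= '[x] * '[y].
Proof. exact: psd_CS csubT (psd_rdot _) _ _. Qed.

Lemma rdot_triangle x y : '[x + y] <= 2 * '[x] + 2 * '[y].
Proof. exact: psd_triangle csubT (psd_rdot _) _ _. Qed.

Lemma rdot_inj x y : (forall z, '[x, z] = '[y, z]) -> x = y.
Proof.
move=> xy; apply/eqP; rewrite -subr_eq0; apply/eqP/rdot_eq0.
by rewrite rdotDl rdotNl xy subrr.
Qed.

Lemma rdot_subC x y : '[x - y] = '[y - x].
Proof. by rewrite -opprB rdotNl rdotNr opprK. Qed.

Definition rdotE := (rdotDl, rdotDr, rdotNl, rdotNr, rdotZl, rdotZr).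

End RealInnerProduct.

(** * Topology in terms of the inner product *)

Section HilbertTopology.
Context {R : realType} {H : completeNormedModType R[i]}.
Context (dot : {dot H for (@Num.conj R[i])}).
Context (dot_norm : forall x : H, dot x x = `|x| ^+ 2).
Notation "''[' x , y ]" := (rdot dot x y).
Notation "''[' x ]" := (rdot dot x x).

Definition cvgto (u : nat -> H) x := vanishes (fun n => '[u n - x]).

Definition cauchyseq (u : nat -> H) := vanishes2 (fun m n => '[u m - u n]).

Lemma norm_rdot (x : H) : `|x| = (Num.sqrt '[x])%:C.
Proof.
apply/eqP; rewrite -(@eqrXn2 _ 2)//; last by rewrite lecR sqrtr_ge0.
by rewrite -dot_norm dot_self -rmorphXn/= sqr_sqrtr// rdot_ge0.
Qed.

Lemma norm_lt (x : H) (e : R) : 0 < e -> (`|x| < e%:C) = ('[x] < e ^+ 2).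
Proof.
move=> e0; rewrite norm_rdot ltcR.
by rewrite -{1}(ger0_norm (ltW e0)) -sqrtr_sqr ltr_sqrt// exprn_gt0.
Qed.

Lemma norm_le (x y : H) : (`|x| <= `|y|) = ('[x] <= '[y]).
Proof. by rewrite !norm_rdot lecR ler_sqrt// rdot_ge0. Qed.

Lemma gt0_complexE (e : R[i]) : 0 < e -> e = (complex.Re e)%:C /\ 0 < complex.Re e.
Proof. by case: e => a b; rewrite ltcE/= => /andP[/eqP->]. Qed.

Lemma nbhs_rdot (x : H) (A : set H) :
  nbhs x A <-> exists2 e : R, 0 < e & forall y, '[y - x] < e -> A y.
Proof.
split.
  move=> /nbhs_ballP[e /= /gt0_complexE[-> e0] eA].
  exists (complex.Re e ^+ 2); first exact: exprn_gt0.
  by move=> y; rewrite -norm_lt// => yx; apply: eA; rewrite -ball_normE/= distrC.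
move=> [e e0 eA]; apply/nbhs_ballP; exists (Num.sqrt e)%:C => /=.
  by rewrite ltcR sqrtr_gt0.
move=> y; rewrite -ball_normE/= distrC norm_lt ?sqrtr_gt0// sqr_sqrtr; last exact: ltW.
exact: eA.
Qed.

Lemma cvgtoP (u : nat -> H) x : u n @[n --> \oo] --> x <-> cvgto u x.
Proof.
split=> [ux e e0|ux A /nbhs_rdot[e e0 eA]].
  have /ux[N _ HN] : nbhs x [set y | '[y - x] < e] by apply/nbhs_rdot; exists e.
  by exists N => n Nn; exact: HN.
by have [N HN] := ux e e0; exists N => // n /= Nn; apply/eA/HN.
Qed.

Lemma cauchyseq_cvg (u : nat -> H) : cauchyseq u -> exists x, cvgto u x.
Proof.
move=> uc; suff /cauchy_cvg : cauchy (u n @[n --> \oo]).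
  by move=> /cvgtoP ?; exists (lim (u n @[n --> \oo])).
apply: cauchy_exP => e /= /gt0_complexE[-> e0].
have [|N HN] := uc (complex.Re e ^+ 2); first exact: exprn_gt0.
exists (u N); exists N => // n Nn; rewrite -ball_normE/= norm_lt//.
exact: HN.
Qed.

Lemma closureP (A : set H) x :
  closure A x <-> forall e : R, 0 < e -> exists2 y, A y & '[y - x] < e.
Proof.
split=> [Ax e e0|Ax B /nbhs_rdot[e e0 eB]].
  have [|y [Ay yx]] := Ax [set y | '[y - x] < e]; first by apply/nbhs_rdot; exists e.
  by exists y.
by have [y Ay yx] := Ax e e0; exists y; split=> //; exact: eB.
Qed.

Lemma closedP (A : set H) : closed A <->
  forall x, (forall e : R, 0 < e -> exists2 y, A y & '[y - x] < e) -> A x.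
Proof.
split=> [cA x /closureP/cA//|HA x /closureP/HA//].
Qed.

Lemma closed_pairP (A : set (H * H)) : closed A <->
  forall x, (forall e : R, 0 < e ->
    exists y, [/\ A y, '[y.1 - x.1] < e & '[y.2 - x.2] < e]) -> A x.
Proof.
split=> [cA x Ax|HA x Ax].
  apply: cA => B [[B1 B2]/= [/nbhs_rdot[e e0 eB1] /nbhs_rdot[e' e'0 eB2]] B12].
  have [|y [Ay y1 y2]] := Ax (Num.min e e'); first by rewrite lt_min e0.
  exists y; split=> //; apply: B12; split=> /=.
    by apply: eB1; rewrite (lt_le_trans y1)// ge_min lexx.
  by apply: eB2; rewrite (lt_le_trans y2)// ge_min lexx orbT.
apply: HA => e e0.
have [|y [Ay [y1 y2]]] := Ax ([set y | '[y - x.1] < e] `*` [set y | '[y - x.2] < e]).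
  exists ([set y | '[y - x.1] < e], [set y | '[y - x.2] < e]) => //=.
  by split; apply/nbhs_rdot; exists e.
by exists y.
Qed.

End HilbertTopology.

(** * Strong convergence and limits of inner products *)

Section Convergence.
Context {R : realType} {H : completeNormedModType R[i]}.
Context (dot : {dot H for (@Num.conj R[i])}).
Notation "''[' x , y ]" := (rdot dot x y).
Notation "''[' x ]" := (rdot dot x x).
Notation cvgto := (cvgto dot).
Notation cauchyseq := (cauchyseq dot).
Implicit Types (u v : nat -> H).

Lemma cvgrP (a : nat -> R) (c : R) :
  a n @[n --> \oo] --> c <-> vanishes (fun n => `|a n - c|).
Proof.
split=> [/cvgrPdist_lt ac e e0|ac].
  by have [N _ HN] := ac e e0; exists N => n Nn; rewrite distrC; exact: HN.
apply/cvgrPdist_lt => e e0; have [N HN] := ac e e0.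
by exists N => // n /= Nn; rewrite distrC; exact: HN.
Qed.

Lemma cvg0P (a : nat -> R) : (forall n, 0 <= a n) ->
  a n @[n --> \oo] --> (0 : R) <-> vanishes a.
Proof.
by move=> a0; rewrite cvgrP; split; apply: eq_vanishes => n; rewrite subr0 ger0_norm.
Qed.

Lemma rdotZ a (x : H) : '[a *: x] = (complex.Re a ^+ 2 + complex.Im a ^+ 2) * '[x].
Proof.
rewrite /rdot dnormZ -add_Re2_Im2.
by case: (dot x x) => p q /=; rewrite mul0r subr0.
Qed.

Lemma cvgto_cst x : cvgto (fun=> x) x.
Proof. by move=> e e0; exists 0%N => n _; rewrite subrr rdot0l. Qed.

Lemma cvgtoD u v x y : cvgto u x -> cvgto v y -> cvgto (fun n => u n + v n) (x + y).
Proof.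
move=> ux vy.
have := vanishesD (vanishesZ (ler0n _ 2) ux) (vanishesZ (ler0n _ 2) vy).
by apply: vanishes_le => n; rewrite opprD addrACA rdot_triangle.
Qed.

Lemma cvgtoZ a u x : cvgto u x -> cvgto (fun n => a *: u n) (a *: x).
Proof.
move=> /(vanishesZ (addr_ge0 (sqr_ge0 (complex.Re a)) (sqr_ge0 (complex.Im a)))).
by apply: vanishes_le => n; rewrite -scalerBr rdotZ.
Qed.

Lemma cvgtoN u x : cvgto u x -> cvgto (fun n => - u n) (- x).
Proof.
by apply: vanishes_le => n; rewrite -opprD (rdotNl dot) (rdotNr dot) opprK.
Qed.

Lemma cvgtoB u v x y : cvgto u x -> cvgto v y -> cvgto (fun n => u n - v n) (x - y).
Proof. by move=> ux vy; apply: cvgtoD => //; exact: cvgtoN. Qed.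

Lemma cvgto_unique u x y : cvgto u x -> cvgto u y -> x = y.
Proof.
move=> ux uy; apply/eqP; rewrite -subr_eq0; apply/eqP/(rdot_eq0 (dot := dot)).
apply: le_anti; rewrite rdot_ge0 andbT; apply: vanishes_cst.
have := cvgtoB uy ux; apply: vanishes_le => n.
by rewrite subrr sub0r opprB.
Qed.

Lemma cvgto_cauchy u x : cvgto u x -> cauchyseq u.
Proof.
move=> ux; apply: vanishes2_le (vanishes_vanishes2 (vanishesZ (ler0n _ 2) ux)) => m n.
have -> : u m - u n = (u m - x) + (x - u n) by rewrite addrA subrK.
by rewrite (le_trans (rdot_triangle _ _ _))// (rdot_subC _ x).
Qed.

Lemma eq_cvgto u v x : u =1 v -> cvgto u x -> cvgto v x.
Proof. by move=> uv; apply: vanishes_le => n; rewrite uv. Qed.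

Lemma rdot_amgm (x y : H) : `|'[x, y]| <= 2^-1 * ('[x] + '[y]).
Proof.
have := rdot_ge0 dot (x + y); have := rdot_ge0 dot (x - y).
rewrite !rdotE (rdotC _ y x) => *.
by rewrite ler_norml; apply/andP; split; lra.
Qed.

Lemma rdot_cvg u v x y : cvgto u x -> cvgto v y ->
  '[u n, v n] @[n --> \oo] --> '[x, y].
Proof.
have half u' x' z : cvgto u' x' -> vanishes (fun n => `|'[u' n - x', z]|).
  move=> ux; apply: (vanishes_sqr (c := '[z]) _ _ ux) => [|n]; first exact: rdot_ge0.
  by rewrite real_normK ?num_real// mulrC rdot_CS.
move=> ux vy; apply/cvgrP.
have h2 : 0 <= 2^-1 :> R by lra.
have := vanishesD (vanishesZ h2 (vanishesD ux vy)) (vanishesD (half _ _ y ux) (half _ _ x vy)).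
apply: vanishes_le => n.
have -> : '[u n, v n] - '[x, y] =
    '[u n - x, v n - y] + ('[u n - x, y] + '[v n - y, x]).
  by rewrite !rdotE (rdotC _ x y) (rdotC _ x (v n)) (rdotC _ y x); ring.
rewrite (le_trans (ler_normD _ _))// lerD ?rdot_amgm//.
exact: ler_normD.
Qed.

Lemma rdot_cvgl u x y : cvgto u x -> '[u n, y] @[n --> \oo] --> '[x, y].
Proof. by move=> ux; apply: rdot_cvg => //; exact: cvgto_cst. Qed.

Lemma rdot_cvgr u x y : cvgto u x -> '[y, u n] @[n --> \oo] --> '[y, x].
Proof. by move=> ux; apply: rdot_cvg => //; exact: cvgto_cst. Qed.

Lemma rcvg_le (a b : nat -> R) (c d : R) : (forall n, a n <= b n) ->
  a n @[n --> \oo] --> c -> b n @[n --> \oo] --> d -> c <= d.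
Proof. by move=> ab ac bd; apply: (ler_cvg_to ac bd); near=> n. Unshelve. all: by end_near. Qed.

Lemma rcvg_eq (a b : nat -> R) (c d : R) : (forall n, a n = b n) ->
  a n @[n --> \oo] --> c -> b n @[n --> \oo] --> d -> c = d.
Proof.
move=> ab ac bd; apply/le_anti; rewrite (rcvg_le _ ac bd) ?(rcvg_le _ bd ac)// => n;
  by rewrite ab.
Qed.

Lemma rcvg_ext (a b : nat -> R) (c : R) : (forall n, a n = b n) ->
  a n @[n --> \oo] --> c -> b n @[n --> \oo] --> c.
Proof.
by move=> ab /cvgrP ac; apply/cvgrP; apply: eq_vanishes ac => n; rewrite ab.
Qed.

Lemma rcvg_unique (a : nat -> R) (c d : R) :
  a n @[n --> \oo] --> c -> a n @[n --> \oo] --> d -> c = d.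
Proof. exact: rcvg_eq. Qed.

(** Turns the approximate Euler-Lagrange inequality of [almost_riesz] into an exact equation in the
    limit. *)
Lemma rcvg_sqr0 (a : nat -> R) (b : R) c : 0 <= c ->
  (forall n, (b - a n) ^+ 2 <= harmonic n * c) -> a n @[n --> \oo] --> b.
Proof.
move=> c0 ab; apply/cvgrP.
apply: (vanishes_sqr (c := c) _ _ vanishes_harmonic) => // n.
by rewrite real_normK ?num_real// -sqrrN opprB mulrC.
Qed.

End Convergence.

(** * Closed subspaces and orthogonal projections *)

Section ClosedSubspaces.
Context {R : realType} {H : completeNormedModType R[i]}.
Context (dot : {dot H for (@Num.conj R[i])}).
Context (dot_norm : forall x : H, dot x x = `|x| ^+ 2).
Notation "''[' x , y ]" := (rdot dot x y).
Notation "''[' x ]" := (rdot dot x x).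
Implicit Types (K : set H) (A : set (H * H)).

Lemma closed_seqP K : closed K <->
  forall u x, (forall n, K (u n)) -> cvgto dot u x -> K x.
Proof.
rewrite (closedP dot_norm); split=> HK.
  move=> u x Ku ux; apply: HK => e /ux[N HN]; exists (u N) => //; exact: HN.
move=> x Kx; have /choice[u Hu] : forall n, exists y, K y /\ '[y - x] < harmonic n.
  by move=> n; have [y] := Kx _ (harmonic_gt0 n); exists y.
apply: (HK u) => [n|]; first by have [] := Hu n.
by apply: vanishes_le (vanishes_harmonic (R := R)) => n; have [_ /ltW] := Hu n.
Qed.

Lemma closed_pair_seqP A : closed A <->
  forall u v x y, (forall n, A (u n, v n)) -> cvgto dot u x -> cvgto dot v y -> A (x, y).
Proof.
rewrite (closed_pairP dot_norm); split=> HA.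
  move=> u v x y Auv ux vy; apply: HA => e e0; have [N HN] := ux e e0.
  have [M HM] := vy e e0; exists (u (maxn N M), v (maxn N M)).
  by split=> //=; [apply: HN; rewrite leq_maxl|apply: HM; rewrite leq_maxr].
move=> [x y] Axy; have /choice[w Hw] : forall n, exists z,
    [/\ A z, '[z.1 - x] < harmonic n & '[z.2 - y] < harmonic n].
  by move=> n; exact: Axy (harmonic_gt0 n).
apply: (HA (fun n => (w n).1) (fun n => (w n).2)) => [n||].
- by rewrite -surjective_pairing; have [] := Hw n.
- by apply: vanishes_le (vanishes_harmonic (R := R)) => n; have [_ /ltW] := Hw n.
- by apply: vanishes_le (vanishes_harmonic (R := R)) => n; have [_ _ /ltW] := Hw n.
Qed.

Lemma csub_closure K : csub K -> csub (closure K).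
Proof.
move=> Ks; split; first exact/subset_closure/Ks.1.
have seq x : closure K x -> exists2 u, (forall n, K (u n)) & cvgto dot u x.
  move=> /(closureP dot_norm) Kx.
  have /choice[u Hu] : forall n, exists y, K y /\ '[y - x] < harmonic n.
    by move=> n; have [y] := Kx _ (harmonic_gt0 n); exists y.
  exists u => [n|]; first by have [] := Hu n.
  by apply: vanishes_le (vanishes_harmonic (R := R)) => n; have [_ /ltW] := Hu n.
move=> a x y /seq[u Ku ux] /seq[v Kv vy].
apply: (closed_seqP _).1 (@closed_closure _ K) _ _ _ (cvgtoD (cvgtoZ a ux) vy).
by move=> n; apply/subset_closure/Ks.2.
Qed.

Definition cspace K := csub K /\ closed K.

Lemma cspaceT : cspace setT.
Proof. by split => //; exact: closedT. Qed.

Lemma projection K h : cspace K -> exists2 k, K k & forall w, K w -> '[h - k, w] = 0.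
Proof.
move=> [Ks Kc].
have [m [Km mC EL]] : exists m : nat -> H, [/\ forall n, K (m n),
    forall n k, '[m n - m k] <= 2 * (harmonic n + harmonic k)
  & forall n w, K w -> ('[h, w] - '[m n, w]) ^+ 2 <= harmonic n * '[w]].
  apply: (almost_riesz (c := '[h]) Ks (psd_rdot dot K) (psdr (psd_rdot dot K) h)).
  move=> m _; have := rdot_ge0 dot (h - m).
  by rewrite !rdotE (rdotC _ m h); lra.
have [|k mk] := cauchyseq_cvg dot_norm (u := m).
  apply: vanishes2_le (vanishes2Z (ler0n _ 2) (vanishes_vanishes2 (vanishes_harmonic (R := R)))).
  exact: mC.
exists k => [|w Kw]; first exact: (closed_seqP _).1 Kc _ _ Km mk.
rewrite !rdotE; apply/eqP; rewrite subr_eq0; apply/eqP.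
apply: (rcvg_unique _ (rdot_cvgl mk)).
by apply: (rcvg_sqr0 (rdot_ge0 dot w)) => n; exact: EL.
Qed.

End ClosedSubspaces.

(* Checks a vector identity by pairing it with an arbitrary vector. *)
Ltac vring d := apply: (rdot_inj (dot := d)) => ?; rewrite !rdotE; first [ring | lra].

(** * Nonnegative relations with [ran (I + A) = K] *)

Section SelfadjointRelations.
Context {R : realType} {H : completeNormedModType R[i]}.
Context (dot : {dot H for (@Num.conj R[i])}).
Notation "''[' x , y ]" := (rdot dot x y).
Notation "''[' x ]" := (rdot dot x x).
Implicit Types (K : set H) (A B : set (H * H)).

Lemma adjointP K A g : csub A -> adjoint_in dot K A g <->
  [/\ K g.1, K g.2 & forall f, A f -> '[f.2, g.1] = '[f.1, g.2]].
Proof.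
move=> As; split=> -[K1 K2 Ag]; split=> // f Af; first by rewrite /rdot Ag.
apply: dot_eq; first exact: Ag.
have := Ag _ (csubZ 'i As Af); rewrite /= !rdot_iC => /oppr_inj ->.
done.
Qed.

Lemma closed_adjoint (dot_norm : forall x : H, dot x x = `|x| ^+ 2) K A :
  cspace K -> csub A -> closed (adjoint_in dot K A).
Proof.
move=> [Ks Kc] As; apply/(closed_pair_seqP dot_norm) => u v x y Auv ux vy.
apply/adjointP => //; split=> [||f Af].
- by apply: (closed_seqP dot_norm _).1 Kc _ _ _ ux => n; have [] := Auv n.
- by apply: (closed_seqP dot_norm _).1 Kc _ _ _ vy => n; have [] := Auv n.
- apply: (rcvg_eq _ (rdot_cvgr ux) (rdot_cvgr vy)) => n /=.
  by have /adjointP[]// := Auv n => _ _ ->.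
Qed.

(* Nonnegative selfadjoint relations, with the range condition [nsa_onto] in the
   place of the equality of [A] and its adjoint. *)
Record nsa K A : Prop := Nsa {
  nsa_sub : csub A;
  nsa_K : forall f, A f -> K f.1 /\ K f.2;
  nsa_sym : forall f g, A f -> A g -> '[f.2, g.1] = '[f.1, g.2];
  nsa_ge0 : forall f, A f -> 0 <= '[f.2, f.1];
  nsa_onto : forall h, K h -> exists x, A (x, h - x) }.

(** Solve for [x] with [{x, g.1 + g.2 - x}] in [A]; then [g.1 - x] is orthogonal to [ran (I + A)],
    which is all of [K], so [g.1 = x]. *)
Lemma nsa_adjoint K A g : csub K -> nsa K A -> K g.1 -> K g.2 ->
  (forall f, A f -> '[f.2, g.1] = '[f.1, g.2]) -> A g.
Proof.
move=> Ks nA K1 K2 Ag; have [x Ax] := nsa_onto nA (csubD Ks K1 K2).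
have [Kx _] := nsa_K nA Ax.
suff xE : g.1 = x.
  by rewrite [g]surjective_pairing; move: Ax; rewrite -xE addrC addKr.
apply/eqP; rewrite -subr_eq0; apply/eqP/(rdot_eq0 (dot := dot)).
have [z Az] := nsa_onto nA (csubB Ks K1 Kx).
have e1 := Ag _ Az; have e2 := nsa_sym nA Az Ax; move: e1 e2 => /=.
by rewrite !rdotE; lra.
Qed.

(** Selfadjoint relations are maximal symmetric; this reduces equalities of relations to
    inclusions. *)
Lemma nsa_max K A B : csub K -> nsa K A -> nsa K B -> A `<=` B -> A = B.
Proof.
move=> Ks nA nB AB; apply/seteqP; split=> // g Bg.
have [K1 K2] := nsa_K nB Bg.
apply: (nsa_adjoint Ks nA K1 K2) => f Af; exact: (nsa_sym nB (AB _ Af) Bg).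
Qed.

Lemma nsa_resolvent_inj K A x y h : csub K -> nsa K A ->
  A (x, h - x) -> A (y, h - y) -> x = y.
Proof.
move=> Ks nA Ax Ay; apply/eqP; rewrite -subr_eq0; apply/eqP/(rdot_eq0 (dot := dot)).
apply: le_anti; rewrite rdot_ge0 andbT.
have := nsa_ge0 nA (csubB (nsa_sub nA) Ax Ay) => /=.
have -> : h - x - (h - y) = y - x by vring dot.
by rewrite !rdotE; lra.
Qed.

Lemma nsa_inv K A : csub K -> nsa K A -> nsa K (A^-1)%relation.
Proof.
move=> Ks nA; split=> /=.
- by split=> [|a f g]; [exact: (nsa_sub nA).1|exact: (nsa_sub nA).2].
- by move=> f /(nsa_K nA)[].
- by move=> f g Af Ag; rewrite rdotC (rdotC dot f.1); have /= := nsa_sym nA Ag Af.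
- by move=> f Af; rewrite rdotC; exact: (nsa_ge0 nA Af).
- move=> h Kh; have [x Ax] := nsa_onto nA Kh; exists (h - x).
  by rewrite opprB addrC subrK.
Qed.

End SelfadjointRelations.

(** * Equivalence of selfadjointness with the range condition *)

Section SelfadjointOnto.
Context {R : realType} {H : completeNormedModType R[i]}.
Context (dot : {dot H for (@Num.conj R[i])}).
Context (dot_norm : forall x : H, dot x x = `|x| ^+ 2).
Notation "''[' x , y ]" := (rdot dot x y).
Notation "''[' x ]" := (rdot dot x x).
Implicit Types (K : set H) (A B : set (H * H)).

Lemma selfadjoint_inI K A : cspace K -> csub A ->
  A = adjoint_in dot K A -> selfadjoint_in dot K A.
Proof.
move=> Kc As AE; split=> //; split.
- by rewrite AE => g [K1 K2 _].
- exact/csubP.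
- by rewrite AE; exact: closed_adjoint.
Qed.

Lemma nonneg_rdot A : csub A ->
  (forall f g, A f -> A g -> '[f.2, g.1] = '[f.1, g.2]) ->
  nonnegative dot A <-> forall f, A f -> 0 <= '[f.2, f.1].
Proof.
move=> As sA; split=> A0 f Af; first by have := A0 f Af; rewrite lecE => /andP[].
rewrite dotE lecE/= (A0 f Af) andbT; apply/eqP.
have := sA _ _ Af (csubZ 'i As Af); rewrite /= -[RHS]opprK -rdot_iC (rdotC _ _ f.2).
lra.
Qed.

Lemma selfadjoint_rdot K A f g : selfadjoint_in dot K A -> A f -> A g ->
  '[f.2, g.1] = '[f.1, g.2].
Proof.
by move=> [_ AE] Af; rewrite {1}AE => -[_ _ /(_ f Af)]; rewrite /rdot => ->.
Qed.

(** The main point is that selfadjointness gives [ran (I + A) = K]. Nonnegativity yields ['[f.1] +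
    '[f.2] <= '[f.1 + f.2]], so a maximizing sequence converges inside the closed [A]. The residual
    [d] is orthogonal to [ran (I + A)], hence [{d, - d}] is in the adjoint, which is [A], and
    nonnegativity forces [d = 0]. *)
Lemma nsaP K A : cspace K -> nonneg_selfadjoint_in dot K A <-> nsa dot K A.
Proof.
move=> [Ks Kc]; split; last first.
  move=> nA; have [As AK sA A0 _] := nA.
  split; last exact/nonneg_rdot.
  apply: selfadjoint_inI => //; apply/seteqP; split=> g.
    by move=> Ag; have [K1 K2] := AK _ Ag; apply/adjointP => //; split=> // f Af; exact: sA.
  by move=> /adjointP-/(_ As)[K1 K2 Ag]; exact: nsa_adjoint Ks nA K1 K2 Ag.
move=> [sa A0]; have [[AK /csubP As Ac] AE] := sa.
have sA f g (Af : A f) (Ag : A g) := selfadjoint_rdot sa Af Ag.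
move/(nonneg_rdot As sA) in A0.
have AK' f : A f -> K f.1 /\ K f.2 by move=> /AK.
split=> // h Kh.
pose p (a b : H * H) := '[a.1 + a.2, b.1 + b.2].
have pp : psd_on A p.
  split=> [z|z|x y _ _|x _]; [split=> [x y|r x]..| |]; rewrite /p/=.
  - by rewrite !rdotE; ring.
  - by rewrite !rdotE; ring.
  - by rewrite !rdotE; ring.
  - by rewrite !rdotE; ring.
  - exact: rdotC.
  - exact: rdot_ge0.
have ll : rlinear (fun b : H * H => '[h, b.1 + b.2]).
  by split=> [x y|r x]/=; rewrite !rdotE; ring.
have [|m [Am mC EL]] := almost_riesz (c := '[h]) As pp ll.
  move=> m _; have := rdot_ge0 dot (h - (m.1 + m.2)).
  by rewrite /p !rdotE !(rdotC _ _ h); lra.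
have mC2 : vanishes2 (fun n k => p (m n - m k) (m n - m k)).
  apply: vanishes2_le mC _.
  exact: vanishes2Z (ler0n _ 2) (vanishes_vanishes2 (vanishes_harmonic (R := R))).
have dE n k : '[(m n).1 - (m k).1] + '[(m n).2 - (m k).2] <= p (m n - m k) (m n - m k).
  have := A0 _ (csubB As (Am n) (Am k)); rewrite /p/=.
  move: ((m n).1 - _) ((m n).2 - _) => a b.
  by rewrite !rdotE (rdotC _ a b); lra.
have [|x mx] := cauchyseq_cvg dot_norm (u := fun n => (m n).1).
  apply: vanishes2_le mC2 => n k; apply: le_trans (dE n k).
  by rewrite lerDl rdot_ge0.
have [|y my] := cauchyseq_cvg dot_norm (u := fun n => (m n).2).
  apply: vanishes2_le mC2 => n k; apply: le_trans (dE n k).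
  by rewrite lerDr rdot_ge0.
have Axy : A (x, y).
  apply: (closed_pair_seqP dot_norm _).1 Ac _ _ _ _ _ mx my => n.
  by rewrite -surjective_pairing.
have [/= Kx Ky] := AK' _ Axy.
have orth w : A w -> '[h - (x + y), w.1 + w.2] = 0.
  move=> Aw; rewrite rdotDl rdotNl; apply/eqP; rewrite subr_eq0; apply/eqP.
  apply: (rcvg_unique _ (rdot_cvgl (cvgtoD mx my))).
  by apply: (rcvg_sqr0 (rdot_ge0 dot (w.1 + w.2))) => n; exact: EL.
have [d dh] : exists d, d = h - (x + y) by eexists.
rewrite -dh in orth.
have Kd : K d by rewrite dh; apply: csubB => //; exact: csubD.
have Ad : A (d, - d).
  rewrite AE; apply/adjointP => //; split=> //=; first exact: csubN.
  by move=> f Af; have := orth f Af; rewrite !rdotE !(rdotC _ d); lra.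
exists x; suff -> : h - x = y by [].
have d0 : d = 0.
  apply: (rdot_eq0 (dot := dot)); apply: le_anti; rewrite rdot_ge0 andbT.
  by have /= := A0 _ Ad; rewrite !rdotE; lra.
by rewrite -[h](subrK (x + y)) -dh d0 add0r addrC addKr.
Qed.

End SelfadjointOnto.

(** * Closed forms and their relations *)

Section ClosedForms.
Context {R : realType} {H : completeNormedModType R[i]}.
Context (dot : {dot H for (@Num.conj R[i])}).
Notation "''[' x , y ]" := (rdot dot x y).
Notation "''[' x ]" := (rdot dot x x).

(* A closed form, presented by a space [cfU] that need not be its domain: the
   domain is the image under [cfpi] of [cfE], and the form is transported
   from [cftau]. Thus sums of forms can be presented without choosing, for
   every vector of the domain, its images under the square roots. *)
Record cform := CForm {
  cfU : lmodType R[i];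
  cfpi : cfU -> H;
  cftau : cfU -> cfU -> R;
  cfE : set cfU;
  cf_sub : csub cfE;
  cf_pi : forall a x y, cfpi (a *: x + y) = a *: cfpi x + cfpi y;
  cf_psd : psd_on cfE cftau;
  cf_i : forall x y, cftau ('i *: x) ('i *: y) = cftau x y;
  cf_complete : forall u : nat -> cfU, (forall n, cfE (u n)) ->
    vanishes2 (fun m n => cftau (u m - u n) (u m - u n)) ->
    cauchyseq dot (cfpi \o u) ->
    exists x, [/\ cfE x, cvgto dot (cfpi \o u) (cfpi x)
      & vanishes (fun n => cftau (u n - x) (u n - x))];
  cf_fun : forall u, cfE u -> cfpi u = 0 -> cftau u u = 0 }.

Arguments cfpi {c}.
Arguments cftau {c}.
Arguments cfE {c}.

Implicit Types (a b : cform) (K : set H).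

(** The first representation theorem is built in: [f'] is an image of [cfpi u] under the relation
    when it represents the functional [cftau u]. *)
Definition cfrep K a (u : cfU a) (f' : H) :=
  [/\ cfE u, K f' & forall w, cfE w -> cftau u w = '[f', cfpi w]].

Definition cfrel K a : set (H * H) :=
  [set f | exists2 u : cfU a, cfrep K u f.2 & cfpi u = f.1].

Definition cfgraph a : set (H * R[i]) := [set (cfpi u, (cftau u u)%:C) | u in @cfE a].

Definition cfdom_in K a := forall u, @cfE a u -> K (cfpi u).

Lemma cfpiD a (x y : cfU a) : cfpi (x + y) = cfpi x + cfpi y.
Proof. by have := cf_pi 1 x y; rewrite !scale1r. Qed.

Lemma cfpi0 a : cfpi (0 : cfU a) = 0.
Proof. by have := cf_pi (-1) (0 : cfU a) 0; rewrite scaler0 addr0 scaleN1r addNr. Qed.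

Lemma cfpiZ a c (x : cfU a) : cfpi (c *: x) = c *: cfpi x.
Proof. by have := cf_pi c x 0; rewrite !addr0 cfpi0 addr0. Qed.

Lemma cfpiB a (x y : cfU a) : cfpi (x - y) = cfpi x - cfpi y.
Proof. by rewrite -scaleN1r cfpiD cfpiZ scaleN1r. Qed.

(** A real subspace stable under ['i] is complex; this lets the real-valued [cftau] produce complex
    relations. *)
Lemma csub_ri (U : lmodType R[i]) (M : set U) : M 0 ->
  (forall x y, M x -> M y -> M (x + y)) -> (forall (r : R) x, M x -> M (r%:C *: x)) ->
  (forall x, M x -> M ('i *: x)) -> csub M.
Proof.
move=> M0 MD MZ Mi; split=> // c x y Mx My; apply: (MD) => //.
rewrite (complexE c) scalerDl (mulrC 'i) -scalerA; apply: MD; apply: MZ => //.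
exact: Mi.
Qed.

Lemma cftau_iC a (u w : cfU a) : cftau ('i *: u) w = - cftau u ('i *: w).
Proof.
have {1}-> : w = 'i *: (- ('i *: w)).
  by rewrite scalerN scalerA -expr2 sqr_i scaleN1r opprK.
by rewrite cf_i (psdNr _ _ (cf_psd a)).
Qed.

Lemma cfrep0 K a : csub K -> cfrep K (0 : cfU a) 0.
Proof.
move=> Ks; split; [exact: (cf_sub a).1|exact: Ks.1|move=> w _].
by rewrite rdot0l -[0](subrr w) (psdDl _ _ _ (cf_psd a)) (psdNl _ _ (cf_psd a)) subrr.
Qed.

Lemma cfrepD K a u v f g : csub K ->
  @cfrep K a u f -> @cfrep K a v g -> cfrep K (u + v) (f + g).
Proof.
move=> Ks [Eu Kf uf] [Ev Kg vg]; split; [exact: csubD (cf_sub a) _ _|exact: csubD|].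
by move=> w Ew; rewrite (psdDl _ _ _ (cf_psd a)) uf// vg// rdotDl.
Qed.

Lemma cfrepZ K a (r : R) u f : csub K -> @cfrep K a u f -> cfrep K (r%:C *: u) (r%:C *: f).
Proof.
move=> Ks [Eu Kf uf]; split; [exact: csubZ (cf_sub a) _|exact: csubZ|].
by move=> w Ew; rewrite (psdZl _ _ _ (cf_psd a)) uf// rdotZl.
Qed.

Lemma cfrepB K a u v f g : csub K ->
  @cfrep K a u f -> @cfrep K a v g -> cfrep K (u - v) (f - g).
Proof.
move=> Ks ru rv; apply: cfrepD => //.
by have := cfrepZ (-1) Ks rv; rewrite rmorphN rmorph1 !scaleN1r.
Qed.

Lemma cfrep_i K a u f : csub K -> @cfrep K a u f -> cfrep K ('i *: u) ('i *: f).
Proof.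
move=> Ks [Eu Kf uf]; split; [exact: csubZ (cf_sub a) _|exact: csubZ|].
move=> w Ew; rewrite cftau_iC uf; last exact: csubZ (cf_sub a) _.
by rewrite rdot_iC cfpiZ.
Qed.

Lemma csub_cfrel K a : csub K -> csub (cfrel K a).
Proof.
move=> Ks; apply: csub_ri => /=.
- by exists 0; [exact: cfrep0|exact: cfpi0].
- move=> f g [u uf uE] [v vg vE]; exists (u + v); last by rewrite cfpiD uE vE.
  exact: cfrepD.
- move=> r f [u uf uE]; exists (r%:C *: u); last by rewrite cfpiZ uE.
  exact: cfrepZ.
- move=> f [u uf uE]; exists ('i *: u); last by rewrite cfpiZ uE.
  exact: cfrep_i.
Qed.

Definition cftau1 a (x y : cfU a) := cftau x y + '[cfpi x, cfpi y].

Lemma cftau1_psd a : psd_on (@cfE a) (@cftau1 a).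
Proof.
have pa := cf_psd a; rewrite /cftau1.
split=> [z|z|x y Ex Ey|x Ex]; [split=> [x y|r x]..| |].
- by rewrite (psdDl _ _ _ pa) cfpiD rdotDl; ring.
- by rewrite (psdZl _ _ _ pa) cfpiZ rdotZl; ring.
- by rewrite (psdDr _ _ _ pa) cfpiD rdotDr; ring.
- by rewrite (psdZr _ _ _ pa) cfpiZ rdotZr; ring.
- by rewrite (psdC pa)// rdotC.
- by rewrite addr_ge0 ?rdot_ge0// (psd_ge0 pa).
Qed.

Lemma cftau_cvg a (u : nat -> cfU a) x w : (forall n, cfE (u n)) -> cfE x -> cfE w ->
  vanishes (fun n => cftau (u n - x) (u n - x)) ->
  cftau (u n) w @[n --> \oo] --> cftau x w.
Proof.
move=> Eu Ex Ew ux; apply/cvgrP.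
have pa := cf_psd a; have Es := cf_sub a.
apply: (vanishes_sqr (c := cftau w w) _ _ ux); first exact: (psd_ge0 pa).
move=> n; rewrite real_normK ?num_real// mulrC.
have -> : cftau (u n) w - cftau x w = cftau (u n - x) w.
  by rewrite (psdDl _ _ _ pa) (psdNl _ _ pa).
exact: psd_CS Es pa (csubB Es (Eu n) Ex) Ew.
Qed.

Lemma cftau_cvg2 a (u : nat -> cfU a) x : (forall n, cfE (u n)) -> cfE x ->
  vanishes (fun n => cftau (u n - x) (u n - x)) ->
  cftau (u n) (u n) @[n --> \oo] --> cftau x x.
Proof.
move=> Eu Ex ux.
have pa := cf_psd a; have Es := cf_sub a.
have c1 := cftau_cvg Eu Ex Ex ux.
have c2 : cftau (u n - x) (u n - x) @[n --> \oo] --> (0 : R).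
  by apply: (cvg0P _).2 ux => n; exact: (psd_ge0 pa (csubB Es (Eu n) Ex)).
have -> : cftau x x = 0 + (cftau x x + cftau x x) - cftau x x by ring.
apply: rcvg_ext (cvgB (cvgD c2 (cvgD c1 c1)) (cvg_cst (cftau x x))) => n; rewrite ?fctE /=.
rewrite !(psdDl _ _ _ pa, psdDr _ _ _ pa, psdNl _ _ pa, psdNr _ _ pa).
by rewrite (psdC pa Ex (Eu n)); ring.
Qed.

Lemma cf_complete1 a (u : nat -> cfU a) : (forall n, cfE (u n)) ->
  (forall n k, cftau1 (u n - u k) (u n - u k) <= 2 * (harmonic n + harmonic k)) ->
  exists x, [/\ cfE x, cvgto dot (cfpi \o u) (cfpi x)
      & vanishes (fun n => cftau (u n - x) (u n - x))].
Proof.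
move=> Eu uC; have pa := cf_psd a; have Es := cf_sub a.
have uC2 : vanishes2 (fun n k => cftau1 (u n - u k) (u n - u k)).
  apply: vanishes2_le uC _.
  exact: vanishes2Z (ler0n _ 2) (vanishes_vanishes2 (vanishes_harmonic (R := R))).
apply: cf_complete => //; apply: vanishes2_le uC2 => m n.
  by rewrite lerDl rdot_ge0.
by rewrite /cftau1 cfpiB lerDr (psd_ge0 pa)//; exact: csubB.
Qed.

Lemma cftau1_cvg a (u : nat -> cfU a) x w : (forall n, cfE (u n)) -> cfE x -> cfE w ->
  cvgto dot (cfpi \o u) (cfpi x) ->
  vanishes (fun n => cftau (u n - x) (u n - x)) ->
  cftau1 (u n) w @[n --> \oo] --> cftau1 x w.
Proof.
move=> Eu Ex Ew ux tux.
exact: rcvg_ext (cvgD (cftau_cvg Eu Ex Ew tux) (rdot_cvgl (y := cfpi w) ux)).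
Qed.

(* Riesz representation of [w |-> (h, w)] in the form domain. *)
Lemma cfrel_onto K a h : csub K -> cfdom_in K a -> K h ->
  exists x, cfrel K a (x, h - x).
Proof.
move=> Ks aK Kh; have pa := cf_psd a; have Es := cf_sub a.
have ll : rlinear (fun w : cfU a => '[h, cfpi w]).
  by split=> [x y|r x]; rewrite ?cfpiD ?cfpiZ !rdotE.
have [|m [Em mC EL]] := almost_riesz (c := '[h]) Es (cftau1_psd a) ll.
  move=> m Em; have := rdot_ge0 dot (h - cfpi m); have := psd_ge0 pa Em.
  by rewrite /cftau1 !rdotE (rdotC _ _ h); lra.
have [x [Ex mx tx]] := cf_complete1 Em mC.
exists (cfpi x); exists x => //; split=> //=; first by apply: csubB => //; exact: aK.
move=> w Ew; suff : '[h, cfpi w] = cftau1 x w by rewrite /cftau1 !rdotE; lra.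
apply: (rcvg_unique _ (cftau1_cvg Em Ex Ew mx tx)).
by apply: (rcvg_sqr0 (psd_ge0 (cftau1_psd a) Ew)) => n; exact: EL.
Qed.

Lemma nsa_cfrel K a : csub K -> cfdom_in K a -> nsa dot K (cfrel K a).
Proof.
move=> Ks aK; have pa := cf_psd a; split.
- exact: csub_cfrel.
- by move=> f [u [Eu Kf _] <-]; split=> //; exact: aK.
- move=> f g [u [Eu _ uf] <-] [v [Ev _ vg] <-].
  by rewrite -uf// (psdC pa)// vg// rdotC.
- by move=> f [u [Eu _ uf] <-]; rewrite -uf// (psd_ge0 pa).
- by move=> h; exact: cfrel_onto.
Qed.

(** The domain of the relation is a core of the form. If [u - x] is orthogonal to it for [cftau1],
    then [cfpi (u - x)] is orthogonal to [ran (I + A) = K] and vanishes, and [cf_fun] makes the form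
    vanish there too. *)
Lemma cf_core K a u : csub K -> cfdom_in K a -> cfE u ->
  exists (v : nat -> cfU a) (f : nat -> H), [/\ forall n, cfrep K (v n) (f n),
    cvgto dot (cfpi \o v) (cfpi u) & vanishes (fun n => cftau (v n - u) (v n - u))].
Proof.
move=> Ks aK Eu; have pa := cf_psd a; have Es := cf_sub a; have p1 := cftau1_psd a.
pose M := [set v | exists f, @cfrep K a v f].
have MP v f : cfrep K v f -> M v by exists f.
have ME : M `<=` @cfE a by move=> v [f []].
have Ms : csub M.
  apply: csub_ri.
  - by exists 0; exact: cfrep0.
  - by move=> x y [f xf] [g yg]; exists (f + g); exact: cfrepD.
  - by move=> r x [f xf]; exists (r%:C *: f); exact: cfrepZ.
  - by move=> x [f xf]; exists ('i *: f); exact: cfrep_i.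
have pM : psd_on M (@cftau1 a).
  have [pl pr pC p0] := p1; split=> // [x y /ME Ex /ME Ey|x /ME]; [exact: pC|exact: p0].
have [|m [Mm mC EL]] := almost_riesz (c := cftau1 u u) Ms pM (psdr p1 u).
  move=> m /ME Em; have := psd_ge0 p1 (csubB Es Eu Em).
  rewrite !(psdDl _ _ _ p1, psdDr _ _ _ p1, psdNl _ _ p1, psdNr _ _ p1).
  by rewrite (psdC p1 Em Eu); lra.
have Em n := ME _ (Mm n).
have [x [Ex mx tx]] := cf_complete1 Em mC.
have Exu := csubB Es Eu Ex.
have orth w : M w -> cftau1 (u - x) w = 0.
  move=> Mw; have Ew := ME _ Mw; rewrite (psdDl _ _ _ p1) (psdNl _ _ p1).
  apply/eqP; rewrite subr_eq0; apply/eqP.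
  apply: (rcvg_unique _ (cftau1_cvg Em Ex Ew mx tx)).
  by apply: (rcvg_sqr0 (psd_ge0 p1 Ew)) => n; exact: EL.
have pi0 : cfpi (u - x) = 0.
  have [y [w [Ew Kw wy] wE]] := cfrel_onto Ks aK (aK _ Exu).
  have Mw : M w by exists (cfpi (u - x) - y).
  have := orth w Mw; rewrite /cftau1 (psdC pa)// wy//= wE rdotDl rdotNl.
  by rewrite (rdotC _ _ y) subrK => /rdot_eq0.
have tau0 := cf_fun Exu pi0.
have [f Hf] := choice Mm.
exists m, f; split=> //.
  have -> : cfpi u = cfpi x by apply/eqP; rewrite -subr_eq0 -cfpiB pi0.
  by [].
have := vanishesZ (ler0n _ 2) tx; apply: vanishes_le => n.
have -> : m n - u = (m n - x) - (u - x) by rewrite opprB addrA subrK.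
have := psd_triangle Es pa (csubB Es (Em n) Ex) (csubN Es Exu).
by rewrite (psdNl _ _ pa) (psdNr _ _ pa) opprK tau0 mulr0 addr0.
Qed.

(** On pairs of the smaller relation both forms equal [(f', f)]. A core sequence for [a] is
    therefore Cauchy for [b] as well, and completeness of [b] provides the limit with the same
    value. *)
Lemma cfgraph_mono K a b : csub K -> cfdom_in K a -> cfdom_in K b ->
  cfrel K a `<=` cfrel K b -> cfgraph a `<=` cfgraph b.
Proof.
move=> Ks aK bK ab _ [u Eu <-].
have pa := cf_psd a; have pb := cf_psd b.
have [v [f [vf vu tvu]]] := cf_core Ks aK Eu.
have Ev n : cfE (v n) by have [] := vf n.
have /choice[v' Hv'] : forall n, exists v', cfrep K v' (f n) /\ @cfpi b v' = cfpi (v n).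
  by move=> n; have [|w wf wE] := ab (cfpi (v n), f n); [exists (v n)|exists w].
have tauE n k : cftau (v' n - v' k) (v' n - v' k) = cftau (v n - v k) (v n - v k).
  have [_ _ e1] := (cfrepB Ks (vf n) (vf k)).
  have [E1 _ e2] := (cfrepB Ks (Hv' n).1 (Hv' k).1).
  rewrite e1; last by apply: csubB => //; exact: cf_sub.
  by rewrite e2// !cfpiB (Hv' n).2 (Hv' k).2.
have tauE1 n : cftau (v' n) (v' n) = cftau (v n) (v n).
  have [_ _ e1] := vf n; have [[E' _ e2] piE] := Hv' n.
  by rewrite e1// e2// piE.
have piE : cfpi \o v' = cfpi \o v by apply/funext => n /=; rewrite (Hv' n).2.
have Ev' n : cfE (v' n) by have [[]] := Hv' n.
have [||x [Ex vx tvx]] := cf_complete Ev'.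
- have := vanishes_vanishes2 (vanishesZ (ler0n _ 2) tvu).
  apply: vanishes2_le => n k; rewrite tauE.
  have -> : v n - v k = (v n - u) - (v k - u) by rewrite opprB addrA subrK.
  have := psd_triangle (cf_sub a) pa (csubB (cf_sub a) (Ev n) Eu)
    (csubN (cf_sub a) (csubB (cf_sub a) (Ev k) Eu)).
  by rewrite (psdNl _ _ pa) (psdNr _ _ pa) !opprK.
- by rewrite piE; exact: cvgto_cauchy vu.
exists x => //; congr pair; first by apply: cvgto_unique vx _; rewrite piE.
congr (_%:C).
apply: (rcvg_eq _ (cftau_cvg2 Ev' Ex tvx) (cftau_cvg2 Ev Eu tvu)) => n.
exact: tauE1.
Qed.

(* By this minimum property the relation depends on the graph of the form only,
   and not on its presentation. *)
Lemma cfrelE K a f : cfrel K a f <-> K f.2 /\ exists2 c, cfgraph a (f.1, c) &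
  forall phi d, cfgraph a (phi, d) ->
    complex.Re c - 2 * '[f.2, f.1] <= complex.Re d - 2 * '[f.2, phi].
Proof.
have pa := cf_psd a; split.
  move=> [u [Eu Kf uf] uE]; split=> //; exists (cftau u u)%:C; first by exists u; rewrite ?uE.
  move=> _ _ [w Ew [<- <-]] /=; rewrite -uE -!uf//.
  have := psd_ge0 pa (csubB (cf_sub a) Ew Eu).
  rewrite !(psdDl _ _ _ pa, psdDr _ _ _ pa, psdNl _ _ pa, psdNr _ _ pa).
  by rewrite (psdC pa Ew Eu); lra.
move=> [Kf [_ [u Eu [uE <-]]] /= Hu]; exists u => //; split=> // w Ew.
apply/eqP; rewrite eq_sym -subr_eq0 -sqrf_eq0; apply/eqP/le_anti.
rewrite sqr_ge0 andbT -[X in _ <= X](mul0r (cftau w w)).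
apply: discr_le => [|t]; first exact: (psd_ge0 pa).
have Ew' : cfE (u + t%:C *: w).
  by apply: csubD (cf_sub a) Eu _; exact: csubZ (cf_sub a) Ew.
have /= := Hu _ _ (ex_intro2 _ _ _ Ew' erefl).
rewrite -uE cfpiD cfpiZ !rdotE.
rewrite !(psdDl _ _ _ pa, psdDr _ _ _ pa, psdZl _ _ _ pa, psdZr _ _ _ pa)/=.
by rewrite (psdC pa Ew Eu); lra.
Qed.

End ClosedForms.

Arguments cfpi {R H dot c}.
Arguments cftau {R H dot c}.
Arguments cfE {R H dot c}.

(** * Bounded operators and square roots *)

Section BoundedSelfadjoint.
Context {R : realType} {H : completeNormedModType R[i]}.
Context (dot : {dot H for (@Num.conj R[i])}).
Context (dot_norm : forall x : H, dot x x = `|x| ^+ 2).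
Notation "''[' x , y ]" := (rdot dot x y).
Notation "''[' x ]" := (rdot dot x x).
Implicit Types (S T X Y B : H -> H).

Definition clin T := forall a x y, T (a *: x + y) = a *: T x + T y.

Definition contr T := forall x, '[T x] <= '[x].

Definition commutes S T := forall x, S (T x) = T (S x).

Record bsa T : Prop := Bsa {
  bsa_lin : clin T;
  bsa_sym : forall x y, '[T x, y] = '[x, T y] }.

Lemma clinD T x y : clin T -> T (x + y) = T x + T y.
Proof. by move=> Tl; have := Tl 1 x y; rewrite !scale1r. Qed.

Lemma clin0 T : clin T -> T 0 = 0.
Proof. by move=> Tl; have := Tl (-1) 0 0; rewrite scaler0 addr0 scaleN1r addNr. Qed.

Lemma clinZ T a x : clin T -> T (a *: x) = a *: T x.
Proof. by move=> Tl; have := Tl a x 0; rewrite !addr0 clin0// addr0. Qed.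

Lemma clinN T x : clin T -> T (- x) = - T x.
Proof. by move=> Tl; rewrite -scaleN1r clinZ// scaleN1r. Qed.

Lemma clinB T x y : clin T -> T (x - y) = T x - T y.
Proof. by move=> Tl; rewrite clinD// clinN. Qed.

Lemma clinE T : clin T -> (forall x y, T (x + y) = T x + T y) *
  (forall x, T (- x) = - T x) * (forall a x, T (a *: x) = a *: T x) * (T 0 = 0).
Proof.
move=> Tl; do !split; [move=> *; exact: clinD|move=> *; exact: clinN|
  move=> *; exact: clinZ|exact: clin0].
Qed.

Lemma contr_cvgto B u x : clin B -> contr B -> cvgto dot u x ->
  cvgto dot (fun n => B (u n)) (B x).
Proof. by move=> Bl Bc; apply: vanishes_le => n; rewrite -clinB. Qed.

Lemma bsa_psd M T : bsa T -> (forall x, 0 <= '[T x, x]) -> psd_on M (fun x y => '[T x, y]).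
Proof.
move=> [Tl Ts] T0; split=> [z|z|x y _ _|//]; [split=> [x y|r x]..|].
- by rewrite clinD// rdotDl.
- by rewrite clinZ// rdotZl.
- exact: rdotDr.
- exact: rdotZr.
- by rewrite Ts rdotC.
Qed.

Lemma bsa_CS T x y : bsa T -> (forall z, 0 <= '[T z, z]) ->
  '[T x, y] ^+ 2 <= '[T x, x] * '[T y, y].
Proof. by move=> bT T0; apply: psd_CS csubT (bsa_psd setT bT T0) _ _. Qed.

(** Cauchy-Schwarz for the form of [T], applied to [x] and [T x]. *)
Lemma bsa_sqr_le T c x : bsa T -> (forall z, 0 <= '[T z, z]) -> 0 <= c ->
  (forall z, '[T z, z] <= c * '[z]) -> '[T x] <= c * '[T x, x].
Proof.
move=> bT T0 c0 Tc; have := bsa_CS x (T x) bT T0; have := Tc (T x).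
have := T0 x; have := rdot_ge0 dot (T x).
set p := '[T x]; set q := '[T x, x]; set s := '[T (T x), T x] => p0 q0 sp.
have [->|p1] := eqVneq p 0; first by rewrite mulr_ge0.
have pp : 0 < p by rewrite lt_neqAle eq_sym p1.
rewrite expr2 => ps; rewrite -(ler_pM2r pp) (le_trans ps)//.
by rewrite mulrAC mulrC ler_wpM2r.
Qed.

Lemma bsa_contr T x : bsa T -> (forall z, 0 <= '[T z, z]) ->
  (forall z, '[T z, z] <= '[z]) -> '[T x] <= '[T x, x].
Proof.
move=> bT T0 T1; rewrite -['[T x, x]]mul1r; apply: bsa_sqr_le => // z.
by rewrite mul1r.
Qed.

Lemma bsa_compl T : bsa T -> bsa (fun x => x - T x).
Proof.
move=> [Tl Ts]; split=> [a x y|x y]; last by rewrite !rdotE Ts.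
by rewrite Tl scalerBr opprD addrACA.
Qed.

Definition nrm x := Num.sqrt '[x].

Lemma nrmD x y : nrm (x + y) <= nrm x + nrm y.
Proof. by rewrite -lecR rmorphD/= -!(norm_rdot dot_norm) ler_normD. Qed.

Lemma nrm_sqr x : nrm x ^+ 2 = '[x].
Proof. by rewrite sqr_sqrtr// rdot_ge0. Qed.

Lemma nrmZ (r : R) x : 0 <= r -> nrm (r%:C *: x) = r * nrm x.
Proof.
move=> r0; rewrite /nrm rdotZl rdotZr mulrA -expr2 sqrtrM ?sqr_ge0//.
by rewrite sqrtr_sqr ger0_norm.
Qed.

Lemma contr_nrm T x : contr T -> nrm (T x) <= nrm x.
Proof. by move=> Tc; rewrite ler_sqrt// rdot_ge0. Qed.

Section SquareRootIteration.
Context (T : H -> H) (bT : bsa T) (cT : contr T).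

(** Iteration for the equation [Y = (T + Y ^+ 2) / 2], whose solution makes [I - Y] a square root of
    [I - T]. *)
Fixpoint sqrt_iter n x :=
  if n is m.+1 then (2^-1)%:C *: (T x + sqrt_iter m (sqrt_iter m x)) else 0.

(* The norms of [sqrt_iter] are dominated by the same iteration started from [T = 1]. *)
Fixpoint sqrt_iter1 n : R :=
  if n is m.+1 then 2^-1 * (1 + sqrt_iter1 m ^+ 2) else 0.

Lemma sqrt_iter1_bnd n : 0 <= sqrt_iter1 n <= 1.
Proof. by elim: n => [|n /andP[? ?]] /=; [rewrite lexx ler01|apply/andP; split; nra]. Qed.

Lemma sqrt_iter_lin n : clin (sqrt_iter n).
Proof.
elim: n => [|n IH] a x y /=; first by rewrite scaler0 addr0.
rewrite (bsa_lin bT) !(clinE IH).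
by rewrite !(scalerDr, scalerA) [_ * a]mulrC addrACA.
Qed.

Lemma sqrt_iter_sym n x y : '[sqrt_iter n x, y] = '[x, sqrt_iter n y].
Proof.
elim: n x y => [|n IH] x y /=; first by rewrite rdot0l rdot0r.
by rewrite !rdotE (bsa_sym bT) !IH.
Qed.

Lemma sqrt_iter_comm B : clin B -> commutes B T -> forall n, commutes B (sqrt_iter n).
Proof.
move=> Bl BT; elim=> [|n IH] x /=; first by rewrite clin0.
by rewrite clinZ// clinD// BT !IH.
Qed.

Lemma sqrt_iter_comm2 m n : commutes (sqrt_iter m) (sqrt_iter n).
Proof.
apply: sqrt_iter_comm; first exact: sqrt_iter_lin.
by move=> x; rewrite -(sqrt_iter_comm (bsa_lin bT)).
Qed.

Lemma sqrt_iter_nrm n x : nrm (sqrt_iter n x) <= sqrt_iter1 n * nrm x.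
Proof.
elim: n x => [|n IH] x /=; first by rewrite mul0r /nrm rdot0l sqrtr0.
have h0 : 0 <= 2^-1 :> R by lra.
rewrite nrmZ// -mulrA ler_wpM2l// (le_trans (nrmD _ _))// mulrDl mul1r.
rewrite lerD ?contr_nrm// (le_trans (IH _))// expr2 -mulrA ler_wpM2l//.
by have /andP[] := sqrt_iter1_bnd n.
Qed.

(** Consecutive iterates commute, so the difference of their squares factors as [(Y - Z) (Y + Z)];
    each step is then dominated by the corresponding scalar step. *)
Lemma sqrt_iter_step n x :
  nrm (sqrt_iter n.+1 x - sqrt_iter n x) <= (sqrt_iter1 n.+1 - sqrt_iter1 n) * nrm x.
Proof.
elim: n x => [|n IH] x.
  have := sqrt_iter_nrm 1 x; rewrite /= subr0 subr0; exact.
set Y := sqrt_iter n.+1 in IH *; set Z := sqrt_iter n in IH *.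
have Yl : clin Y := sqrt_iter_lin _; have Zl : clin Z := sqrt_iter_lin _.
have -> : sqrt_iter n.+2 x - Y x = (2^-1)%:C *: (Y (Y x + Z x) - Z (Y x + Z x)).
  transitivity ((2^-1)%:C *: ((T x + Y (Y x)) - (T x + Z (Z x)))).
    by rewrite scalerBr.
  have comm : Y (Z x) = Z (Y x) := sqrt_iter_comm2 n.+1 n x.
  by rewrite (clinD _ _ Yl) (clinD _ _ Zl) comm; congr (_ *: _); vring dot.
have h0 : 0 <= 2^-1 :> R by lra.
rewrite nrmZ//; have := IH (Y x + Z x); have := nrmD (Y x) (Z x).
have := sqrt_iter_nrm n.+1 x; have := sqrt_iter_nrm n x.
have /andP[a0 a1] := sqrt_iter1_bnd n; have /andP[b0 b1] := sqrt_iter1_bnd n.+1.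
have -> : sqrt_iter1 n.+2 = 2^-1 * (1 + sqrt_iter1 n.+1 ^+ 2) by [].
have e : sqrt_iter1 n.+1 = 2^-1 * (1 + sqrt_iter1 n ^+ 2) by [].
have /(_ x) : forall x, 0 <= nrm x by move=> z; exact: sqrtr_ge0.
rewrite -/Y -/Z; move: (nrm (Y (Y x + Z x) - _)) (nrm (Y x + Z x)) => q r.
move: (nrm (Y x)) (nrm (Z x)) (nrm x) => y z w w0 zw yw ryz qr.
have d0 : 0 <= sqrt_iter1 n.+1 - sqrt_iter1 n by rewrite e; have := sqr_ge0 (1 - sqrt_iter1 n); lra.
have : q <= (sqrt_iter1 n.+1 - sqrt_iter1 n) * ((sqrt_iter1 n.+1 + sqrt_iter1 n) * w).
  rewrite (le_trans qr)// ler_wpM2l//; lra.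
move: e; set s := sqrt_iter1 n.+1; set t := sqrt_iter1 n => e h.
have -> : 2^-1 * (1 + s ^+ 2) - s = 2^-1 * ((s - t) * (s + t)) by rewrite [X in _ - X]e; ring.
lra.
Qed.

Lemma sqrt_iter1_cauchy : vanishes2 (fun m n => `|sqrt_iter1 m - sqrt_iter1 n|).
Proof.
pose s := sup (range sqrt_iter1).
have hs : has_sup (range sqrt_iter1).
  split; first by exists (sqrt_iter1 0), 0%N.
  by exists 1 => _ [n _ <-]; have /andP[] := sqrt_iter1_bnd n.
have mono n k : (n <= k)%N -> sqrt_iter1 n <= sqrt_iter1 k.
  move=> /subnKC <-; elim: (k - n)%N => [|d IH]; first by rewrite addn0.
  rewrite addnS (le_trans IH)//=; have := sqr_ge0 (1 - sqrt_iter1 (n + d)); lra.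
move=> e e0; have [_ [N _ <-] HN] := sup_adherent e0 hs.
have bnd n : (N <= n)%N -> s - e < sqrt_iter1 n <= s.
  move=> Nn; rewrite (lt_le_trans HN (mono _ _ Nn))/=.
  by apply: sup_upper_bound => //; exists n.
exists N => m n /bnd/andP[m1 m2] /bnd/andP[n1 n2].
by rewrite ltr_norml; apply/andP; split; lra.
Qed.

Lemma sqrt_iter_cauchy m n x :
  nrm (sqrt_iter m x - sqrt_iter n x) <= `|sqrt_iter1 m - sqrt_iter1 n| * nrm x.
Proof.
have tri k d : nrm (sqrt_iter (k + d) x - sqrt_iter k x) <=
    (sqrt_iter1 (k + d) - sqrt_iter1 k) * nrm x.
  elim: d => [|d IH]; first by rewrite addn0 !subrr mul0r /nrm rdot0l sqrtr0.
  rewrite addnS -(subrK (sqrt_iter (k + d) x) (sqrt_iter _.+1 x)) -addrA.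
  rewrite (le_trans (nrmD _ _))// -(subrK (sqrt_iter1 (k + d)) (sqrt_iter1 _.+1)).
  by rewrite -[X in X * _]addrA mulrDl lerD// sqrt_iter_step.
have [nm|/ltnW mn] := leqP n m.
  by rewrite -(subnKC nm) (le_trans (tri _ _))// ler_wpM2r ?sqrtr_ge0// ler_norm.
rewrite -(subnKC mn) distrC /nrm rdot_subC (le_trans (tri _ _))//.
by rewrite ler_wpM2r ?sqrtr_ge0// ler_norm.
Qed.

Lemma sqrt_iter_lim : exists Y, [/\ bsa Y, contr Y,
  forall x, Y x + Y x = T x + Y (Y x) &
  forall B, clin B -> contr B -> commutes B T -> commutes B Y].
Proof.
have /choice[Y HY] : forall x, exists y, cvgto dot (sqrt_iter ^~ x) y.
  move=> x; apply: cauchyseq_cvg => //.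
  have c0 : 0 <= nrm x by exact: sqrtr_ge0.
  have vv := vanishes2Z c0 sqrt_iter1_cauchy.
  (* If the norm [d] satisfies both [d < 1] and [d < e], then [d ^+ 2 < e]. *)
  move=> e e0; have [|N HN] := vv (Num.min 1 e); first by rewrite lt_min ltr01.
  exists N => m n Nm Nn; have := HN m n Nm Nn; rewrite lt_min => /andP[h1 h2].
  have := sqrt_iter_cauchy m n x; rewrite -nrm_sqr [X in _ <= X -> _]mulrC.
  have : 0 <= nrm (sqrt_iter m x - sqrt_iter n x) by exact: sqrtr_ge0.
  move: (nrm (_ - _)) h1 h2 => d h1 h2 d0 d1.
  have d2 : d < 1 by exact: le_lt_trans d1 h1.
  have d3 : d < e by exact: le_lt_trans d1 h2.
  by nra.
have Yl : clin Y.
  move=> a x y; apply: (cvgto_unique (HY _)).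
  apply: eq_cvgto (cvgtoD (cvgtoZ a (HY x)) (HY y)) => n.
  by rewrite sqrt_iter_lin.
have itc n : contr (sqrt_iter n).
  move=> x; have := sqrt_iter_nrm n x; have /andP[a0 a1] := sqrt_iter1_bnd n.
  rewrite -!nrm_sqr; have : 0 <= nrm (sqrt_iter n x) by exact: sqrtr_ge0.
  have : 0 <= nrm x by exact: sqrtr_ge0.
  by move=> *; rewrite ler_sqr ?nnegrE//; nra.
have Yc : contr Y.
  move=> x; apply: (rcvg_le _ (rdot_cvg (HY x) (HY x)) (cvg_cst '[x])) => n.
  exact: itc.
exists Y; split=> //.
- split=> // x y; apply: (rcvg_eq _ (rdot_cvgl (HY x)) (rdot_cvgr (HY y))) => n.
  exact: sqrt_iter_sym.
- move=> x.
  (* The operators vary with [n], but all of them are contractions, so the strong limits can be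
     composed. *)
  have YY : cvgto dot (fun n => sqrt_iter n (sqrt_iter n x)) (Y (Y x)).
    have c1 : cvgto dot (fun n => sqrt_iter n (sqrt_iter n x - Y x)) 0.
      by apply: vanishes_le (HY x) => n; rewrite subr0; exact: itc.
    rewrite -[Y (Y x)]add0r; apply: eq_cvgto (cvgtoD c1 (HY (Y x))) => n.
    by rewrite (clinB _ _ (sqrt_iter_lin n)) subrK.
  have YS : cvgto dot (fun n => sqrt_iter n.+1 x) (Y x).
    by move=> e e0; have [N HN] := HY x e e0; exists N => n /leqW; exact: HN.
  apply: cvgto_unique (cvgtoD YS YS) _.
  apply: eq_cvgto (cvgtoD (cvgto_cst dot (T x)) YY) => n /=.
  by vring dot.
- move=> B Bl Bc BT x; apply: (cvgto_unique (contr_cvgto Bl Bc (HY x))).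
  by apply: eq_cvgto (HY (B x)) => n; rewrite (sqrt_iter_comm Bl BT).
Qed.

End SquareRootIteration.
(** [C = I - Y], with [Y] the limit of the iteration for [T = I - X]. The commutation clause stands
    in for functional calculus; it is stated for contractions, which preserve limits by
    [contr_cvgto]. *)
Lemma bsa_root X : bsa X -> contr (fun x => x - X x) ->
  exists C, [/\ bsa C, contr (fun x => x - C x), forall x, C (C x) = X x &
  forall B, clin B -> contr B -> commutes B X -> commutes B C].
Proof.
move=> bX cX; have [Y [bY cY YE Yc]] := sqrt_iter_lim (bsa_compl bX) cX.
have Yl := bsa_lin bY.
exists (fun x => x - Y x); split.
- exact: bsa_compl.
- move=> x; have -> : x - (x - Y x) = Y x by vring dot.
  exact: cY.
- move=> x; rewrite (clinB _ _ Yl).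
  have -> : x - Y x - (Y x - Y (Y x)) = x + Y (Y x) - (Y x + Y x) by vring dot.
  by rewrite YE; vring dot.
- move=> B Bl Bc BX x; rewrite (clinB _ _ Bl) (Yc B)// => z.
  by rewrite (clinB _ _ Bl) BX.
Qed.

Lemma compl_contr_ge0 X x : contr (fun x => x - X x) -> 0 <= '[X x, x].
Proof.
move=> /(_ x); have := rdot_ge0 dot (X x).
by rewrite !rdotE (rdotC _ x (X x)); lra.
Qed.

(** Commuting nonnegative operators have a nonnegative product: with [r ^+ 2 = C / 2], one has
    [(S x, C x) = 2 (S (r x), r x)]. *)
Lemma mul_root_ge0 S C x : bsa S -> contr S -> contr (fun x => x - S x) ->
  bsa C -> contr (fun x => x - C x) -> commutes S C -> 0 <= '[S x, C x].
Proof.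
move=> bS cS S0 bC C0 SC; have [Cl Cs] := bC; have [Sl Ss] := bS.
pose D x := (2^-1)%:C *: C x.
have bD : bsa D.
  split=> [a y z|y z]; last by rewrite !rdotE Cs.
  by rewrite /D Cl scalerDr !scalerA mulrC.
have [|r [br _ rr rc]] := bsa_root bD.
  move=> y; have -> : y - D y = (2^-1)%:C *: (y + (y - C y)) by rewrite /D; vring dot.
  rewrite rdotZl rdotZr; have := rdot_triangle dot y (y - C y); have := C0 y.
  by lra.
have -> : C x = r (r x) + r (r x) by rewrite !rr /D; vring dot.
have Sr : commutes S r.
  by apply: rc => // y; rewrite /D (clinZ _ _ Sl) SC.
rewrite rdotDr -(bsa_sym br) -Sr.
by rewrite addr_ge0// compl_contr_ge0.
Qed.

(** The hypothesis says [0 <= X <= I], in the form in which resolvents satisfy it. *)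
Lemma unit_interval_contr X : bsa X -> (forall x, '[X x] <= '[X x, x]) ->
  contr X /\ contr (fun x => x - X x).
Proof.
move=> bX X1; split=> x; have := X1 x; have := rdot_ge0 dot (x - X x).
  by rewrite !rdotE (rdotC _ x (X x)); lra.
by have := rdot_ge0 dot (X x); rewrite !rdotE (rdotC _ x (X x)); lra.
Qed.

Lemma ominusP K (M : set H) x : csub M ->
  ominus dot K M x <-> K x /\ forall y, M y -> '[x, y] = 0.
Proof.
move=> Ms; split=> -[Kx xM]; split=> // y My; first by rewrite /rdot xM.
by rewrite dotE xM// xM//; exact: csubZ.
Qed.

Lemma cspace_ominus K (M : set H) : csub M -> cspace K -> cspace (ominus dot K M).
Proof.
move=> Ms [Ks Kc]; split.
  split=> [|a x y [Kx xM] [Ky yM]].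
    by apply/ominusP => //; split=> [|y _]; [exact: Ks.1|exact: rdot0l].
  split=> [|z Mz]; first exact: Ks.2.
  by rewrite linearPl/= xM// yM// mulr0 addr0.
apply/(closed_seqP dot_norm) => u x uM ux; apply/ominusP => //; split.
  by apply: (closed_seqP dot_norm _).1 Kc _ _ _ ux => n; have [] := uM n.
move=> y My; apply: (rcvg_eq _ (rdot_cvgl ux) (cvg_cst 0)) => n.
by have /ominusP-/(_ Ms)[_ ->] := uM n.
Qed.

Definition kernel X : set H := [set x | X x = 0].

Lemma csub_kernel X : clin X -> csub (kernel X).
Proof.
move=> Xl; split; first exact: clin0.
by move=> a x y; rewrite /kernel/= => x0 y0; rewrite Xl x0 y0 scaler0 addr0.
Qed.

(* With [C ^+ 2 = X] and [S ^+ 2 = 1 - X], the square root of [X^-1 - 1] is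
   the relation of the pairs [(C u, S u)]. *)
Lemma root_relation X : bsa X -> (forall x, '[X x] <= '[X x, x]) ->
  let L := ominus dot setT (kernel X) in
  exists B : set (H * H), [/\ nonneg_selfadjoint_in dot L B, mulpart B = [set 0]
    & (B \; B)%relation = [set (X w, w - X w) | w in L]].
Proof.
move=> bX X1 L; have [Xl Xs] := bX; have ks := csub_kernel Xl.
have Lc : cspace L by apply: cspace_ominus => //; exact: cspaceT.
have LP x : L x <-> forall y, X y = 0 -> '[x, y] = 0.
  by split=> [/ominusP-/(_ ks)[]//|xk]; apply/ominusP.
have [cX c1X] := unit_interval_contr bX X1.
have [C [bC c1C CC Cc]] := bsa_root bX c1X.
have [|S [bS c1S SS Sc]] := bsa_root (bsa_compl bX).
  by move=> x; rewrite subKr; exact: cX.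
have [[Cl Cs] [Sl Ss]] := (bC, bS).
have XS x : X (S x) = S (X x).
  by apply: Sc => // y; rewrite (clinB _ _ Xl).
have cS : contr S.
  by move=> x; rewrite -Ss SS; have := X1 x; have := rdot_ge0 dot (X x); rewrite !rdotE; lra.
have SC : commutes S C by apply: Cc => // x; rewrite XS.
have LC u : L u -> L (C u).
  move=> /LP Lu; apply/LP => k Xk; rewrite Cs (_ : C k = 0) ?rdot0r//.
  by apply: (rdot_eq0 (dot := dot)); rewrite -Cs CC Xk rdot0l.
have LS u : L u -> L (S u).
  by move=> /LP Lu; apply/LP => k Xk; rewrite Ss Lu// XS Xk clin0.
exists [set (C u, S u) | u in L].
have Bs : csub [set (C u, S u) | u in L].
  split; first by exists 0; [exact: Lc.1.1|rewrite !clin0].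
  move=> a _ _ [u Lu <-] [v Lv <-]; exists (a *: u + v); first exact: Lc.1.2.
  by rewrite Cl Sl.
have sB f g : [set (C u, S u) | u in L] f -> [set (C u, S u) | u in L] g ->
    '[f.2, g.1] = '[f.1, g.2].
  by move=> [u _ <-] [v _ <-] /=; rewrite -Cs -SC Ss.
split.
- split; last first.
    apply/(nonneg_rdot Bs sB) => _ [u _ <-] /=.
    exact: mul_root_ge0.
  apply: selfadjoint_inI => //; apply/seteqP; split=> g.
    move=> Bg; apply/adjointP => //; split=> [||f Bf]; last exact: sB.
      by have [u Lu <-] := Bg; exact: LC.
    by have [u Lu <-] := Bg; exact: LS.
  move=> /adjointP-/(_ Bs)[L1 L2 Bg].
  (* The adjoint condition is tested with the pair generated by [S g.1 - C g.2] itself, which gives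
     [S g.1 = C g.2]. *)
  have L3 : L (S g.1 - C g.2) by apply: csubB Lc.1 _ _; [exact: LS|exact: LC].
  have /eqP : S g.1 - C g.2 = 0.
    apply: (rdot_eq0 (dot := dot)); rewrite rdotDl rdotNl Ss Cs.
    have /= := Bg _ (ex_intro2 _ _ _ L3 erefl).
    by rewrite (rdotC _ g.1) (rdotC _ g.2) => ->; rewrite subrr.
  rewrite subr_eq0 => /eqP SgC.
  (* Since [C ^+ 2 + S ^+ 2 = I], this vector generates [g]. *)
  exists (C g.1 + S g.2); first by apply: csubD Lc.1 _ _; [exact: LC|exact: LS].
  rewrite [RHS]surjective_pairing (clinD _ _ Cl) (clinD _ _ Sl).
  rewrite -[C (S _)]SC [S (C g.1)]SC SgC -{1}SgC !CC !SS.
  by congr pair; vring dot.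
- apply/seteqP; split=> [f' [u Lu [Cu0 <-]]|_ ->] /=.
    have Xu : X u = 0 by rewrite -CC Cu0 clin0.
    have -> : u = 0 by apply: (rdot_eq0 (dot := dot)); move/LP: Lu; exact.
    exact: clin0.
  by exists 0; [exact: Lc.1.1|rewrite !clin0].
- apply/seteqP; split=> [[x y] /= [z [u Lu [<- <-]] [v Lv [Cv <-]]]|_ [w Lw <-]] /=.
    (* From [S u = C v] and [C ^+ 2 + S ^+ 2 = I] one gets [X (C u + S v) = C u]. *)
    exists (C u + S v); first by apply: csubD Lc.1 _ _; [exact: LC|exact: LS].
    have XE : X (C u + S v) = C u.
      rewrite -CC (clinD _ _ Cl) -[C (S v)]SC Cv SS CC.
      have -> : X u + (u - X u) = u by vring dot.
      by [].
    have SE : C u + S v - X (C u + S v) = S v.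
      by rewrite XE; vring dot.
    by rewrite SE XE.
  exists (S (C w)); first by exists (C w); rewrite ?CC//; exact: LC.
  by exists (S w); rewrite ?SC ?SS//; exact: LS.
Qed.

End BoundedSelfadjoint.

(** * The form of a relation and the relation of a form *)

Section FormOfRelation.
Context {R : realType} {H : completeNormedModType R[i]}.
Context (dot : {dot H for (@Num.conj R[i])}).
Context (dot_norm : forall x : H, dot x x = `|x| ^+ 2).
Notation "''[' x , y ]" := (rdot dot x y).
Notation "''[' x ]" := (rdot dot x x).
Implicit Types (K : set H) (A B : set (H * H)) (a b : cform dot).

Lemma csub_mulpart A : csub A -> csub (mulpart A).
Proof.
move=> As; split; first exact: As.1.
move=> c x y Ax Ay; rewrite /mulpart/=.
have := As.2 c _ _ Ax Ay; congr A.
by congr pair; rewrite /= scaler0 addr0.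
Qed.

Lemma proj_unique K h k l : csub K -> K k -> K l ->
  (forall w, K w -> '[h - k, w] = 0) -> (forall w, K w -> '[h - l, w] = 0) -> k = l.
Proof.
move=> Ks Kk Kl hk hl; apply/eqP; rewrite -subr_eq0; apply/eqP/(rdot_eq0 (dot := dot)).
have Kkl := csubB Ks Kk Kl; have := hk _ Kkl; have := hl _ Kkl.
by rewrite !rdotE; lra.
Qed.

(** [X] is [(I + A)^-1] after the projection on [K], so that it acts on all of [H]; its kernel is
    [mul A] plus the complement of [K]. *)
Lemma resolvent_compl K A : cspace K -> nsa dot K A ->
  exists X, [/\ bsa dot X, forall x, '[X x] <= '[X x, x],
    forall x, X x = 0 <-> exists2 m, mulpart A m & forall w, K w -> '[x - m, w] = 0
    & forall w, K w -> A (X w, w - X w)].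
Proof.
move=> Kc nA; have [Ks _] := Kc.
have /choice[X HX] : forall h, exists x, exists k,
    [/\ K k, forall w, K w -> '[h - k, w] = 0 & A (x, k - x)].
  move=> h; have [k Kk hk] := projection dot_norm h Kc.
  by have [x Ax] := nsa_onto nA Kk; exists x, k.
have XE h k x : K k -> (forall w, K w -> '[h - k, w] = 0) -> A (x, k - x) -> X h = x.
  move=> Kk hk Ax; have [l [Kl hl Al]] := HX h.
  by move: Al; rewrite -(proj_unique Ks Kk Kl hk hl) => Al; exact: nsa_resolvent_inj Ks nA Al Ax.
have XK w : K w -> A (X w, w - X w).
  move=> Kw; have [x Ax] := nsa_onto nA Kw.
  by rewrite (XE w w x)// => z _; rewrite subrr rdot0l.
exists X; split=> //.
- split=> [c x y|x y].
    have [k [Kk hk Ak]] := HX x; have [l [Kl hl Al]] := HX y.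
    apply: (XE _ (c *: k + l)); first exact: Ks.2.
      move=> w Kw; have -> : c *: x + y - (c *: k + l) = c *: (x - k) + (y - l).
        by rewrite scalerBr opprD addrACA.
      rewrite rdotDl hl// addr0 /rdot linearZl_LR/=.
      by rewrite dotE hk// hk ?mulr0//; exact: csubZ.
    have := (nsa_sub nA).2 c _ _ Ak Al; congr A; congr pair => /=.
    by rewrite scalerBr opprD addrACA.
  have [k [Kk hk Ak]] := HX x; have [l [Kl hl Al]] := HX y.
  have [[Kx _] [Ky _]] := (nsa_K nA Ak, nsa_K nA Al).
  have := nsa_sym nA Ak Al; have := hk _ Ky; have := hl _ Kx => /=.
  rewrite !rdotE (rdotC _ y (X x)) (rdotC _ l (X x)).
  by lra.
- move=> x; have [k [Kk hk Ak]] := HX x; have [Kx _] := nsa_K nA Ak.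
  have := nsa_ge0 nA Ak; have := hk _ Kx => /=.
  by rewrite !rdotE (rdotC _ x (X x)); lra.
- move=> x; split=> [X0|[m Am xm]].
    have [k [Kk hk Ak]] := HX x; exists k => //.
    by move: Ak; rewrite X0 subr0.
  by apply: (XE _ m) => //; [have [] := nsa_K nA Am|rewrite subr0].
Qed.

(** The form [phi |-> |B phi| ^+ 2] is presented on the graph of [B]: completeness is closedness of
    [B], and [cf_fun] is the triviality of its multivalued part. *)
Definition graph_cform (B : set (H * H)) L (Lc : cspace L)
  (nB : nonneg_selfadjoint_in dot L B) (B0 : mulpart B = [set 0]) : cform dot.
Proof.
refine (@CForm R H dot (H * H)%type fst (fun p q => '[p.2, q.2]) B _ _ _ _ _ _).
- by have /(nsaP dot_norm _ Lc)[] := nB.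
- by [].
- split=> [z|z|x y _ _|x _]; [split=> *; rewrite /= ?rdotE//..| |].
    exact: rdotC.
  exact: rdot_ge0.
- by move=> x y /=; rewrite rdot_i.
- move=> u Bu u2 u1.
  have [x ux] := cauchyseq_cvg dot_norm u1.
  have [y uy] := cauchyseq_cvg dot_norm (u := fun n => (u n).2) u2.
  exists (x, y); split=> //.
  have [[[_ _ Bc] _] _] := nB.
  apply: (closed_pair_seqP dot_norm _).1 Bc _ _ _ _ _ ux uy => n /=.
  by rewrite -surjective_pairing.
- move=> [x y] /= Bxy x0; move: Bxy; rewrite x0 => By.
  have : mulpart B y by [].
  by rewrite B0 => ->; rewrite rdot0l.
Defined.

Definition cfrepresents K A a :=
  [/\ cfdom_in K a, A = cfrel K a & form_of dot K A = cfgraph a].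

(** The complement [L] of [ker X] is [K (-) mul A], and the operator part of [A] consists of the
    pairs [(X w, w - X w)] with [w] in [L], which have a square root by [root_relation]. The rest of
    [A] is recovered by splitting [f.2] into its projection on [L] and an element of [mul A]. *)
Lemma cfrepresents_exists K A : cspace K -> nsa dot K A ->
  exists a, cfrepresents K A a.
Proof.
move=> Kc nA; have [Ks _] := Kc.
have [X [bX X1 X0 XK]] := resolvent_compl Kc nA; have [Xl Xs] := bX.
have ks := csub_kernel Xl; have ms := csub_mulpart (nsa_sub nA).
have LE : ominus dot setT (kernel X) = ominus dot K (mulpart A).
  apply/seteqP; split=> x.
    move=> /ominusP-/(_ ks)[_ xk]; apply/ominusP => //; split; last first.
      by move=> m Am; apply/xk/X0; exists m => // w _; rewrite subrr rdot0l.
    have [k Kk hk] := projection dot_norm x Kc.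
    suff -> : x = k by [].
    apply/eqP; rewrite -subr_eq0; apply/eqP/(rdot_eq0 (dot := dot)).
    rewrite rdotDr rdotNr (hk _ Kk) oppr0 addr0 rdotC; apply/xk/X0.
    by exists 0; [exact: ms.1|move=> w Kw; rewrite subr0 hk].
  move=> /ominusP-/(_ ms)[Kx xm]; apply/ominusP => //; split=> // y /X0[m Am ym].
  by rewrite -(subrK m y) rdotDr (xm _ Am) addr0 rdotC ym.
have [B0 HB0] := root_relation dot_norm bX X1.
move: HB0; set L := ominus dot setT (kernel X) => HB0.
have Lc : cspace L by apply: cspace_ominus => //; exact: cspaceT.
have LP x : L x <-> forall y, X y = 0 -> '[x, y] = 0.
  by split=> [/ominusP-/(_ ks)[]//|xk]; apply/ominusP.
have LK : L `<=` K by rewrite /L LE => x [].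
have LX x : L (X x) by apply/LP => y Xy; rewrite Xs Xy rdot0r.
have opE : op_part dot K A = [set (X w, w - X w) | w in L].
  rewrite /op_part -LE -/L; apply/seteqP; split=> [[x y] [Axy [/= Lx Ly]]|_ [w Lw <-]].
    have Lw : L (x + y) by exact: csubD Lc.1 Lx Ly.
    exists (x + y) => //; have -> : X (x + y) = x.
      apply: (nsa_resolvent_inj Ks nA (XK _ (LK _ Lw))).
      by rewrite addrC addKr.
    by rewrite addrC addKr.
  split=> /=; first exact/XK/LK.
  by split=> //=; apply: csubB Lc.1 _ _.
pose B := sqrt_in dot L (op_part dot K A).
have [nB mB BB] : [/\ nonneg_selfadjoint_in dot L B, mulpart B = [set 0]
    & (B \; B)%relation = op_part dot K A].
  rewrite /B /sqrt_in; apply: (getPex (P := [set B : set (H * H) | [/\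
    nonneg_selfadjoint_in dot L B, mulpart B = [set 0] & _ = _]])).
  by exists B0; rewrite /= opE.
have /(nsaP dot_norm _ Lc) nB' := nB.
exists (graph_cform Lc nB mB).
have aK : cfdom_in K (graph_cform Lc nB mB) by move=> u /(nsa_K nB')[/LK].
split=> //; last first.
  rewrite /form_of -LE -/L -/B /cfgraph/=; apply/seteqP; split=> _ [f Bf <-];
    by exists f => //; rewrite -dot_norm dot_self.
apply: (nsa_max Ks nA (nsa_cfrel Ks aK)) => f Af.
have [Kf1 Kf2] := nsa_K nA Af.
have f1X : f.1 = X (f.1 + f.2).
  apply: (nsa_resolvent_inj Ks nA _ (XK _ (csubD Ks Kf1 Kf2))).
  by rewrite addrC addKr -surjective_pairing.
have L1 : L f.1 by rewrite f1X.
have [g Lg fg] := projection dot_norm f.2 Lc.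
have Kd : K (f.2 - g) by apply: csubB => //; exact: LK.
have /X0[m Am dm] : X (f.2 - g) = 0.
  by apply: (rdot_eq0 (dot := dot)); rewrite Xs fg.
have mE : m = f.2 - g.
  apply/esym/eqP; rewrite -subr_eq0; apply/eqP/(rdot_eq0 (dot := dot))/dm.
  by apply: csubB => //; have [] := nsa_K nA Am.
have Afg : A (f.1, g).
  have := csubB (nsa_sub nA) Af Am; congr A; congr pair => /=; first by rewrite subr0.
  by rewrite mE opprB addrC subrK.
have : op_part dot K A (f.1, g) by split=> //; rewrite -LE.
rewrite -BB => -[z /= B1 B2].
exists (f.1, z) => //; split=> // w Bw /=.
rewrite -(nsa_sym nB' B2 Bw)/=.
by have := fg w.1 (nsa_K nB' Bw).1; rewrite rdotDl rdotNl; lra.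
Qed.

(** The relation of [a] also has the presentation given by [cfrepresents_exists]; [cfgraph_mono] in
    both directions identifies the two forms. *)
Lemma cfrepresents_cfrel K a : cspace K -> cfdom_in K a -> cfrepresents K (cfrel K a) a.
Proof.
move=> Kc aK; split=> //; have [Ks _] := Kc.
have [b [bK abE ->]] := cfrepresents_exists Kc (nsa_cfrel Ks aK).
by apply/seteqP; split; apply: (cfgraph_mono Ks) => //; rewrite -abE.
Qed.

Lemma cfrel_inj K a b : cfgraph a = cfgraph b -> cfrel K a = cfrel K b.
Proof.
move=> ab; apply/seteqP; split=> f /cfrelE fQ; apply/cfrelE; first by rewrite -ab.
by rewrite ab.
Qed.

(** Eliminates the choice: whatever relation is selected has the graph of [a] as its form, and
    [cfrel_inj] recovers the relation. *)
Lemma rel_of_formE K a : cspace K -> cfdom_in K a ->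
  rel_of_form dot K (cfgraph a) = cfrel K a.
Proof.
move=> Kc aK; have [Ks _] := Kc; have [_ _ faE] := cfrepresents_cfrel Kc aK.
have [nA AE] : [set A | nonneg_selfadjoint_in dot K A /\ form_of dot K A = cfgraph a]
    (rel_of_form dot K (cfgraph a)).
  apply: getPex; exists (cfrel K a); split=> //.
  by apply/nsaP => //; exact: nsa_cfrel.
have [b [bK bE fbE]] := cfrepresents_exists Kc ((nsaP dot_norm _ Kc).1 nA).
by rewrite bE; apply: cfrel_inj; rewrite -fbE.
Qed.

End FormOfRelation.

(** * Form sums and arithmetic means *)

Section Means.
Context {R : realType} {H : completeNormedModType R[i]}.
Context (dot : {dot H for (@Num.conj R[i])}).
Context (dot_norm : forall x : H, dot x x = `|x| ^+ 2).
Notation "''[' x , y ]" := (rdot dot x y).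
Notation "''[' x ]" := (rdot dot x x).
Implicit Types (K : set H) (A B : set (H * H)) (a b : cform dot).

Lemma half_complexE : 2^-1 = (2^-1 : R)%:C.
Proof. by rewrite -[in LHS](rmorph_nat (real_complex R)) fmorphV. Qed.

Lemma cftau_ge0 a (u : cfU a) : cfE u -> 0 <= cftau u u.
Proof. exact: (psd_ge0 (cf_psd a)). Qed.

(** The space consists of pairs with a common image. The coefficient serves both the form sum, with
    [c = 1], and the mean, with [c = 2^-1]. *)
Definition sum_cform (c : R) (c0 : 0 < c) a b : cform dot.
Proof.
refine (@CForm R H dot (cfU a * cfU b)%type (fun p => cfpi p.1)
  (fun p q => c * (cftau p.1 q.1 + cftau p.2 q.2))
  [set p | [/\ cfE p.1, cfE p.2 & cfpi p.1 = cfpi p.2]] _ _ _ _ _ _).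
- split; first by split; [exact: (cf_sub a).1|exact: (cf_sub b).1|rewrite !cfpi0].
  move=> r x y [x1 x2 xE] [y1 y2 yE]; split.
  + exact: (cf_sub a).2.
  + exact: (cf_sub b).2.
  + by rewrite !cf_pi xE yE.
- by move=> r x y; exact: cf_pi.
- have [pa pb] := (cf_psd a, cf_psd b).
  split=> [z|z|x y [x1 x2 xE] [y1 y2 yE]|x [x1 x2 _]]; [split=> [x y|r x]..| |] => /=.
  + by rewrite (psdDl _ _ _ pa) (psdDl _ _ _ pb); ring.
  + by rewrite (psdZl _ _ _ pa) (psdZl _ _ _ pb); ring.
  + by rewrite (psdDr _ _ _ pa) (psdDr _ _ _ pb); ring.
  + by rewrite (psdZr _ _ _ pa) (psdZr _ _ _ pb); ring.
  + by rewrite (psdC pa)// (psdC pb).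
  + apply: mulr_ge0; first exact: ltW.
    by apply: addr_ge0; [exact: (psd_ge0 pa)|exact: (psd_ge0 pb)].
- by move=> x y /=; rewrite !cf_i.
- move=> u Eu tauC piC.
  have Eu1 n : cfE (u n).1 by have [] := Eu n.
  have Eu2 n : cfE (u n).2 by have [] := Eu n.
  have c1 : 0 <= c^-1 by rewrite invr_ge0 ltW.
  have tauC' := vanishes2Z c1 tauC.
  have [||x1 [Ex1 px1 tx1]] := cf_complete (u := fun n => (u n).1) Eu1; [|exact: piC|].
    apply: vanishes2_le tauC' => m n /=; rewrite mulKf ?gt_eqF//.
    by rewrite lerDl cftau_ge0//; exact: (csubB (cf_sub b)).
  have [||x2 [Ex2 px2 tx2]] := cf_complete (u := fun n => (u n).2) Eu2.
  + apply: vanishes2_le tauC' => m n /=; rewrite mulKf ?gt_eqF//.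
    by rewrite lerDr cftau_ge0//; exact: (csubB (cf_sub a)).
  + by apply: vanishes2_le piC => m n /=; have [_ _ <-] := Eu m; have [_ _ <-] := Eu n.
  exists (x1, x2); split=> //=.
    split=> //=; apply: cvgto_unique px1 _.
    by apply: eq_cvgto px2 => n /=; have [_ _ <-] := Eu n.
  exact: vanishesZ (ltW c0) (vanishesD tx1 tx2).
- move=> u [E1 E2 E12] u0 /=.
  by rewrite (cf_fun E1 u0) (cf_fun E2) ?addr0 ?mulr0// -E12.
Defined.

Lemma half_gt0 : 0 < 2^-1 :> R. Proof. by rewrite invr_gt0. Qed.

Definition mean_cform a b := sum_cform half_gt0 a b.

Lemma cfdom_in_sum c (c0 : 0 < c) K a b : cfdom_in K a -> cfdom_in K (sum_cform c0 a b).
Proof. by move=> aK u [/aK]. Qed.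

Lemma addform_cfgraph a b :
  addform (cfgraph a) (cfgraph b) = cfgraph (sum_cform ltr01 a b).
Proof.
apply/seteqP; split=> [[x y] [c [d [[u Eu [/= uE <-]] [v Ev [/= vE <-]] /= ->]]]|].
  by exists (u, v); [split=> //=; rewrite uE vE|rewrite /= uE mul1r rmorphD].
move=> _ [[u v] [/= Eu Ev uv] <-] /=.
exists (cftau u u)%:C, (cftau v v)%:C; split; [by exists u|by exists v; rewrite ?uv|].
by rewrite mul1r rmorphD.
Qed.

Lemma scale_cfrel_sum K a b : csub K ->
  scalerel 2^-1 (cfrel K (sum_cform ltr01 a b)) = cfrel K (mean_cform a b).
Proof.
move=> Ks; rewrite half_complexE.
apply/seteqP; split=> [_ [f [u [Eu Kf uf] <-] <-]|f [u [Eu Kf uf] uE]] /=.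
  exists u => //; split=> //=; first exact: csubZ.
  by move=> w Ew; rewrite rdotZl -uf//= mul1r.
exists (f.1, 2%:C *: f.2); last first.
  rewrite /= scalerA -rmorphM/= mulVf ?pnatr_eq0// scale1r.
  by rewrite -surjective_pairing.
exists u => //; split=> //=; first exact: csubZ.
by move=> w Ew; rewrite rdotZl -uf//= mulrA mulfV ?pnatr_eq0// mul1r.
Qed.

Lemma arith_mean_relE K A B a b : cspace K ->
  cfrepresents K A a -> cfrepresents K B b ->
  arith_mean_rel dot K A B = cfrel K (mean_cform a b).
Proof.
move=> Kc [aK _ Aa] [bK _ Bb]; rewrite /arith_mean_rel /form_sum Aa Bb addform_cfgraph.
rewrite (rel_of_formE dot_norm Kc); last exact: cfdom_in_sum.
by apply: scale_cfrel_sum; exact: Kc.1.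
Qed.

Lemma nsa_arith_mean K A B : cspace K -> nsa dot K A -> nsa dot K B ->
  nsa dot K (arith_mean_rel dot K A B).
Proof.
move=> Kc nA nB; have [a aA] := cfrepresents_exists dot_norm Kc nA.
have [b bB] := cfrepresents_exists dot_norm Kc nB.
rewrite (arith_mean_relE Kc aA bB); apply: nsa_cfrel; first exact: Kc.1.
by apply: cfdom_in_sum; have [] := aA.
Qed.

(** A limit in the sense of forms: the second components need not converge, but their pairings with
    the form domain do. *)
Lemma cfrel_cvg K A a (p : nat -> H * H) x : csub K -> cfrepresents K A a ->
  (forall n, A (p n)) ->
  vanishes2 (fun m n => '[(p m).2 - (p n).2, (p m).1 - (p n).1]) ->
  cvgto dot (fun n => (p n).1) x ->
  exists u : cfU a, [/\ cfE u, cfpi u = x,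
    forall w, cfE w -> '[(p n).2, cfpi w] @[n --> \oo] --> cftau u w
  & '[(p n).2, (p n).1] @[n --> \oo] --> cftau u u].
Proof.
move=> Ks [aK AE _] Ap pC px.
have /choice[v Hv] : forall n, exists v, cfrep K v (p n).2 /\ @cfpi _ _ _ a v = (p n).1.
  by move=> n; have := Ap n; rewrite AE => -[v ? ?]; exists v.
have Ev n : cfE (v n) by have [[]] := Hv n.
have piE : cfpi \o v = fun n => (p n).1 by apply/funext => n /=; rewrite (Hv n).2.
have tauE n w : cfE w -> cftau (v n) w = '[(p n).2, cfpi w].
  by move=> Ew; have [[_ _ ->]] := Hv n.
have [||u [Eu vu tu]] := cf_complete Ev.
- apply: vanishes2_le pC => m n.
  have [Emn _ ->//] := cfrepB Ks (Hv m).1 (Hv n).1.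
  by rewrite cfpiB (Hv m).2 (Hv n).2.
- by rewrite piE; exact: cvgto_cauchy px.
exists u; split=> //.
- by apply: (cvgto_unique vu); rewrite piE.
- by move=> w Ew; apply: rcvg_ext (cftau_cvg Ev Eu Ew tu) => n; rewrite tauE.
- apply: rcvg_ext (cftau_cvg2 Ev Eu tu) => n; rewrite tauE//.
  by rewrite (Hv n).2.
Qed.

(** Only the averaged second components are given a limit, tested on vectors common to both form
    domains; in each relation separately they may diverge. *)
Lemma arith_mean_lim K A B a b (p q : nat -> H * H) x y : cspace K ->
  cfrepresents K A a -> cfrepresents K B b ->
  (forall n, A (p n)) -> (forall n, B (q n)) ->
  vanishes2 (fun m n => '[(p m).2 - (p n).2, (p m).1 - (p n).1]) ->
  vanishes2 (fun m n => '[(q m).2 - (q n).2, (q m).1 - (q n).1]) ->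
  cvgto dot (fun n => (p n).1) x -> cvgto dot (fun n => (q n).1) x -> K y ->
  (forall (w : cfU a) (z : cfU b), cfE w -> cfE z -> cfpi w = cfpi z ->
     2^-1 * ('[(p n).2, cfpi w] + '[(q n).2, cfpi w]) @[n --> \oo] --> '[y, cfpi w]) ->
  arith_mean_rel dot K A B (x, y).
Proof.
move=> Kc aA bB Ap Bq pC qC px qx Ky pq; have [Ks _] := Kc.
rewrite (arith_mean_relE Kc aA bB).
have [u [Eu ux uw _]] := cfrel_cvg Ks aA Ap pC px.
have [v [Ev vx vw _]] := cfrel_cvg Ks bB Bq qC qx.
exists (u, v) => //; split=> //=; first by split=> //=; rewrite ux vx.
move=> [w z] [/= Ew Ez wz].
change (2^-1 * (cftau u w + cftau v z) = '[y, cfpi w]).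
apply: rcvg_unique (pq w z Ew Ez wz).
apply: cvgM; first exact: cvg_cst.
by apply: cvgD; [exact: uw|rewrite wz; exact: vw].
Qed.

Lemma arith_mean_cap K A B : cspace K -> nsa dot K A -> nsa dot K B ->
  A `&` B `<=` arith_mean_rel dot K A B.
Proof.
move=> Kc nA nB [x y] [Axy Bxy].
have [a aA] := cfrepresents_exists dot_norm Kc nA.
have [b bB] := cfrepresents_exists dot_norm Kc nB.
have vz : vanishes2 (fun m n : nat => '[y - y, x - x]).
  by move=> e e0; exists 0%N => *; rewrite subrr rdot0l.
apply: (@arith_mean_lim K A B a b (fun=> (x, y)) (fun=> (x, y)) x y Kc aA bB
  (fun=> Axy) (fun=> Bxy) vz vz (cvgto_cst dot x) (cvgto_cst dot x)).
  by have [] := nsa_K nA Axy.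
move=> w z _ _ _ /=; have -> : 2^-1 * ('[y, cfpi w] + '[y, cfpi w]) = '[y, cfpi w] by lra.
exact: cvg_cst.
Qed.

End Means.

(** * Existence of the Friedrichs extension *)

Section Friedrichs.
Context {R : realType} {H : completeNormedModType R[i]}.
Context (dot : {dot H for (@Num.conj R[i])}).
Context (dot_norm : forall x : H, dot x x = `|x| ^+ 2).
Notation "''[' x , y ]" := (rdot dot x y).
Notation "''[' x ]" := (rdot dot x x).
Implicit Types (S A B : set (H * H)).

Record nsym S : Prop := Nsym {
  nsym_sub : csub S;
  nsym_sym : forall f g, S f -> S g -> '[f.2, g.1] = '[f.1, g.2];
  nsym_ge0 : forall f, S f -> 0 <= '[f.2, f.1] }.

Lemma nsymP S : linear_relation_in setT S -> symmetric_relation dot S ->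
  nonnegative dot S -> nsym S.
Proof.
move=> [_ /csubP Ss _] sS S0.
have sS' f g : S f -> S g -> '[f.2, g.1] = '[f.1, g.2].
  by move=> Sf /sS[_ _ Hg]; rewrite /rdot Hg.
by split=> //; apply/nonneg_rdot.
Qed.

Lemma nsym_inv S : nsym S -> nsym (S^-1)%relation.
Proof.
move=> [[S0 Sl] sS S1]; split=> /=; first by split=> // a f g; exact: Sl.
  by move=> f g Sf Sg; exact: esym (sS _ _ Sf Sg).
by move=> f Sf; rewrite rdotC; exact: (S1 _ Sf).
Qed.

(** The form of [I + S]: its diagonal is the squared form norm, and it is symmetric only for
    arguments in a symmetric relation. *)
Definition relform (f g : H * H) := '[f.1 + f.2, g.1].

Lemma relform_psd S : nsym S -> psd_on S relform.
Proof.
move=> [Ss sS S0]; rewrite /relform.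
split=> [z|z|x y Sx Sy|x Sx]; [split=> [x y|r x]..| |] => /=.
- by rewrite !rdotE; ring.
- by rewrite !rdotE; ring.
- by rewrite !rdotE; ring.
- by rewrite !rdotE; ring.
- by rewrite !rdotE sS// (rdotC _ x.1) (rdotC _ x.1).
- by rewrite rdotDl addr_ge0 ?rdot_ge0// S0.
Qed.

Lemma relform_ge f : 0 <= '[f.2, f.1] -> '[f.1] <= relform f f.
Proof. by rewrite /relform rdotDl lerDl. Qed.

Lemma form_le_relform f : '[f.2, f.1] <= relform f f.
Proof. by rewrite /relform rdotDl lerDr rdot_ge0. Qed.

Definition form_core S A := forall f, A f -> exists g : nat -> H * H,
  (forall n, S (g n)) /\ vanishes (fun n => relform (f - g n) (f - g n)).

(** A description of [S_F] without closures or choice; [form_closure_core] shows that it pins down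
    the form. *)
Definition is_friedrichs S A := [/\ nsa dot setT A, S `<=` A & form_core S A].

Lemma nsa_nsym K A : nsa dot K A -> nsym A.
Proof. by case. Qed.

Lemma vanishes_mulr_sqr (e b q : nat -> R) c : 0 <= c -> vanishes e ->
  (forall n, 0 <= e n) -> (forall n, q n <= c) ->
  (forall n, b n ^+ 2 <= e n * q n) -> vanishes (fun n => `|b n|).
Proof.
move=> c0 ve e0 qc be; apply: (vanishes_sqr c0 _ ve) => n.
rewrite real_normK ?num_real// (le_trans (be n))// mulrC.
by rewrite ler_wpM2r.
Qed.

Lemma friedrichs_exists S : nsym S -> exists A, is_friedrichs S A.
Proof.
move=> nS; have [Ss sS S0] := nS; have pS := relform_psd nS.
(* [apx h u]: the sequence [u] in [S] minimizes [relform w w - 2 (h, w.1)]. *)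
pose apx h (u : nat -> H * H) := [/\ forall n, S (u n),
  exists2 c, 0 <= c & forall n, relform (u n) (u n) <= c &
  exists e : nat -> R, [/\ vanishes e, forall n, 0 <= e n &
    forall n w, S w -> ('[h, w.1] - relform (u n) w) ^+ 2 <= e n * relform w w]].
have apxD h k u v : apx h u -> apx k v -> apx (h + k) (fun n => u n + v n).
  move=> [Su [c c0 uc] [e [ve e0 eu]]] [Sv [d d0 vd] [e' [ve' e'0 ev]]].
  split=> [n||]; first exact: csubD.
    exists (2 * c + 2 * d) => [|n]; first by rewrite addr_ge0// mulr_ge0.
    apply: le_trans (psd_triangle Ss pS (Su n) (Sv n)) _.
    by rewrite lerD// ler_wpM2l.
  exists (fun n => 2 * e n + 2 * e' n); split=> [|n|n w Sw].
  - by apply: vanishesD; exact: vanishesZ.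
  - by rewrite addr_ge0// mulr_ge0.
  - rewrite rdotDl (psdDl _ _ _ pS).
    have := eu n w Sw; have := ev n w Sw; have := sqr_ge0
      ('[h, w.1] - relform (u n) w - ('[k, w.1] - relform (v n) w)).
    by lra.
have apxZ h (r : R) u : apx h u -> apx (r%:C *: h) (fun n => r%:C *: u n).
  move=> [Su [c c0 uc] [e [ve e0 eu]]]; split=> [n||]; first exact: csubZ.
    exists (r ^+ 2 * c) => [|n]; first by rewrite mulr_ge0// sqr_ge0.
    rewrite (psdZl _ _ _ pS) (psdZr _ _ _ pS) mulrA -expr2.
    by rewrite ler_wpM2l ?sqr_ge0.
  exists (fun n => r ^+ 2 * e n); split=> [|n|n w Sw].
  - by apply: vanishesZ => //; exact: sqr_ge0.
  - by rewrite mulr_ge0// sqr_ge0.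
  - rewrite rdotZl (psdZl _ _ _ pS) -mulrBr exprMn -mulrA.
    by rewrite ler_wpM2l ?sqr_ge0//; exact: eu.
have rel_i u w : relform ('i *: u) ('i *: w) = relform u w.
  by rewrite /relform/= -scalerDr rdot_i.
have rel_iC u w : relform ('i *: u) w = - relform u ('i *: w).
  by rewrite /relform/= -scalerDr rdot_iC.
have apxi h u : apx h u -> apx ('i *: h) (fun n => 'i *: u n).
  move=> [Su [c c0 uc] [e [ve e0 eu]]]; split=> [n||]; first exact: csubZ.
    by exists c => // n; rewrite rel_i.
  exists e; split=> // n w Sw; rewrite rdot_iC rel_iC -(rel_i w).
  by rewrite -opprD sqrrN; exact: (eu n _ (csubZ 'i Ss Sw)).
(* [A] is defined through its resolvent: [f.1] is the value at [f.1 + f.2], as a limit of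
   approximate Riesz representatives taken in [S]. No completion of [S] is built. *)
pose A := [set f : H * H | exists u, apx (f.1 + f.2) u /\ cvgto dot (fun n => (u n).1) f.1].
have As : csub A.
  apply: csub_ri.
  - exists (fun=> 0); split; last exact: cvgto_cst.
    split=> [n||]; first exact: Ss.1.
      by exists 0 => // n; rewrite /relform rdot0r.
    exists (fun=> 0); split=> // [e e0|n w Sw]; first by exists 0%N.
    by rewrite /relform addr0 !rdot0l subrr expr0n mul0r.
  - move=> f g [u [uf ux]] [v [vg vx]]; exists (fun n => u n + v n).
    by split; [rewrite /= addrACA; exact: apxD|exact: cvgtoD].
  - move=> r f [u [uf ux]]; exists (fun n => r%:C *: u n).
    by split; [rewrite /= -scalerDr; exact: apxZ|exact: cvgtoZ].
  - move=> f [u [uf ux]]; exists (fun n => 'i *: u n).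
    by split; [rewrite /= -scalerDr; exact: apxi|exact: cvgtoZ].
(* The inequality for [u] is tested with [v n], whose form norms are bounded. Symmetry and
   nonnegativity of [A] are read from this limit. *)
have limq h k u v y : apx h u -> apx k v -> cvgto dot (fun n => (v n).1) y ->
    relform (u n) (v n) @[n --> \oo] --> '[h, y].
  move=> [Su _ [e [ve e0 eu]]] [Sv [c c0 vc] _] vy.
  have c1 : vanishes (fun n => `|'[h, (v n).1] - relform (u n) (v n)|).
    exact: (vanishes_mulr_sqr c0 ve e0 vc (fun n => eu n _ (Sv n))).
  have c2 := (cvgrP _ _).1 (rdot_cvgr (y := h) vy).
  apply/cvgrP; apply: vanishes_le (vanishesD c1 c2) => n.
  have -> : relform (u n) (v n) - '[h, y] =
    - ('[h, (v n).1] - relform (u n) (v n)) + ('[h, (v n).1] - '[h, y]) by ring.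
  by rewrite (le_trans (ler_normD _ _))// normrN.
have onto h : exists x, A (x, h - x).
  have ll : rlinear (fun w : H * H => '[h, w.1]).
    by split=> [x y|r x] /=; rewrite !rdotE.
  have [|m [Sm mC EL]] := almost_riesz (c := '[h]) Ss pS ll.
    move=> m Sm; have := rdot_ge0 dot (h - m.1); have := S0 _ Sm.
    by rewrite /relform !rdotE (rdotC _ m.1 h); lra.
  have [|x mx] := cauchyseq_cvg dot_norm (u := fun n => (m n).1).
    have := vanishes2Z (ler0n _ 2) (vanishes_vanishes2 (vanishes_harmonic (R := R))).
    apply: vanishes2_le => n k; apply: le_trans (mC n k).
    exact: (relform_ge (S0 _ (csubB Ss (Sm n) (Sm k)))).
  exists x, m; split=> //=; rewrite addrC subrK; split=> //.
    (* The form norms are bounded by comparison with [m 0], as [harmonic n <= harmonic 0]. *)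
    exists (2 * (2 * (harmonic 0 + harmonic 0)) + 2 * relform (m 0%N) (m 0%N)).
      by rewrite addr_ge0 ?mulr_ge0 ?(psd_ge0 pS)// addr_ge0 ?harmonic_ge0.
    move=> n; have := psd_triangle Ss pS (csubB Ss (Sm n) (Sm 0%N)) (Sm 0%N).
    rewrite subrK => /le_trans; apply; rewrite lerD2r ler_wpM2l//.
    apply: le_trans (mC n 0%N) _; rewrite ler_wpM2l// lerD2r.
    by rewrite /harmonic lef_pV2 ?posrE// ler_nat.
  exists (@harmonic R); split=> //; first exact: vanishes_harmonic.
  by move=> n; exact: harmonic_ge0.
have sA f g : A f -> A g -> '[f.2, g.1] = '[f.1, g.2].
  move=> [u [uf ux]] [v [vg vy]].
  have c1 := limq _ _ _ _ _ uf vg vy; have c2 := limq _ _ _ _ _ vg uf ux.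
  have : '[f.1 + f.2, g.1] = '[g.1 + g.2, f.1].
    apply: (rcvg_eq _ c1 c2) => n; apply: (psdC pS).
      by have [] := uf.
    by have [] := vg.
  by rewrite !rdotE (rdotC _ g.1) (rdotC _ g.2); lra.
have A0 f : A f -> 0 <= '[f.2, f.1].
  move=> [u [uf ux]]; have := limq _ _ _ _ _ uf uf ux.
  move=> /(rcvg_le _ (rdot_cvg ux ux)); rewrite rdotDl lerDl; apply=> n.
  by apply/relform_ge/S0; have [] := uf.
exists A; split.
- split=> // h _; exact: onto.
- move=> f Sf; exists (fun=> f); split; last exact: cvgto_cst.
  split=> //; first by exists (relform f f) => //; exact: (psd_ge0 pS).
  exists (fun=> 0); split=> // [e e0|n w Sw]; first by exists 0%N.
  by rewrite /relform subrr expr0n mul0r.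
- move=> f Af; have [u [uf ux]] := Af; have [Su _ _] := uf.
  exists u; split=> //.
  have symf w : S w -> '[w.1 + w.2, f.1] = '[f.1 + f.2, w.1].
    move=> Sw; rewrite rdotC.
    have [_ _ [e [ve e0 eu]]] := uf.
    have c1 : relform (u n) w @[n --> \oo] --> '[f.1 + f.2, w.1].
      apply/cvgrP; apply: (vanishes_sqr (c := relform w w) _ _ ve) => [|n].
        exact: (psd_ge0 pS).
      by rewrite real_normK ?num_real// -sqrrN opprB mulrC; exact: eu.
    apply: (rcvg_eq _ (rdot_cvgl ux) c1) => n.
    by rewrite (psdC pS (Su n) Sw) /relform rdotC.
  have c1 := limq _ _ _ _ _ uf uf ux.
  have c2 := rdot_cvgr (y := f.1 + f.2) ux.
  apply/(cvg0P _).1 => [n|].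
    have Afu : A (f - u n).
      apply: csubB => //; exists (fun=> u n); split; last exact: cvgto_cst.
      split=> //; first by exists (relform (u n) (u n)) => //; exact: (psd_ge0 pS).
      exists (fun=> 0); split=> // [e e0|k w Sw]; first by exists 0%N.
      by rewrite /relform subrr expr0n mul0r.
    by rewrite /relform rdotDl addr_ge0 ?rdot_ge0// A0.
  (* The limit [0] is split along the expansion of [relform (f - u n) (f - u n)], with [symf] for
     the mixed terms. *)
  have -> : 0 = '[f.1 + f.2, f.1] - 2 * '[f.1 + f.2, f.1] + '[f.1 + f.2, f.1] by ring.
  have c3 : '[f.1 + f.2, f.1] - 2 * '[f.1 + f.2, (u n).1] + relform (u n) (u n)
      @[n --> \oo] --> '[f.1 + f.2, f.1] - 2 * '[f.1 + f.2, f.1] + '[f.1 + f.2, f.1].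
    apply: cvgD => //; apply: cvgB; first exact: cvg_cst.
    by apply: cvgM => //; exact: cvg_cst.
  apply: rcvg_ext c3 => n.
  by have := symf _ (Su n); rewrite /relform/= !rdotE; lra.
Qed.

End Friedrichs.

(** * The closure of the form of a symmetric relation *)

Section FriedrichsForm.
Context {R : realType} {H : completeNormedModType R[i]}.
Context (dot : {dot H for (@Num.conj R[i])}).
Context (dot_norm : forall x : H, dot x x = `|x| ^+ 2).
Notation "''[' x , y ]" := (rdot dot x y).
Notation "''[' x ]" := (rdot dot x x).
Implicit Types (S A B : set (H * H)) (a : cform dot).

Lemma normc_real (r : R) : `|r%:C| = `|r|%:C.
Proof. by rewrite normc_def/= expr0n addr0 sqrtr_sqr. Qed.

Lemma cvg_complexP (r : nat -> R) (z : R[i]) :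
  ((r n)%:C : R[i]^o) @[n --> \oo] --> (z : R[i]^o) <->
  exists2 c, z = c%:C & r n @[n --> \oo] --> c.
Proof.
split=> [/cvgrPdist_lt rz|[c -> /cvgrPdist_lt rc]].
  have zE : z = (complex.Re z)%:C.
    apply/eqP; rewrite eq_complex/= eqxx -sqrf_eq0 -normr_eq0 /=.
    apply/eqP/le_anti; rewrite normr_ge0 andbT; apply: vanishes_cst => e e0.
    have [|N _ HN] := rz (Num.sqrt e)%:C; first by rewrite ltcR sqrtr_gt0.
    exists N => n _; have := HN N (leqnn N); rewrite /= normc_def ltcR ltr_sqrt//.
    rewrite normrX real_normK ?num_real//.
    by case: (z) => a b /=; rewrite oppr0 addr0 => /(le_lt_trans _); apply; rewrite lerDr sqr_ge0.
  exists (complex.Re z) => //; apply/cvgrPdist_lt => e e0.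
  have [|N _ HN] := rz e%:C; first by rewrite ltcR.
  by exists N => // n /HN; rewrite /= zE -rmorphB/= normc_real ltcR.
apply/cvgrPdist_lt => e /gt0_complexE[-> e0]; have [N _ HN] := rc _ e0.
by exists N => // n /HN; rewrite /= -rmorphB/= normc_real ltcR.
Qed.

(** Since [S] is a core of [A], the limits of form-Cauchy sequences from [S] are exactly the vectors
    of the form domain of [A]. *)
Lemma form_closure_core S A a : nsym dot S -> is_friedrichs dot S A ->
  cfrepresents setT A a -> form_closure (form_of_symmetric dot S) = cfgraph a.
Proof.
move=> nS [nA SA cA] aA; have [aT AE _] := aA; have [Ss sS S0] := nS.
have realS f : S f -> dot f.2 f.1 = '[f.2, f.1]%:C.
  move=> Sf; have := nsa_ge0 nA (SA _ Sf).
  have /(nonneg_rdot Ss sS) := S0 => /(_ f Sf); rewrite dotE lecE/=.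
  by move=> /andP[/eqP->].
apply/seteqP; split=> [[x c] [u [r [tur ux rc tC]]]|].
  have /choice[f Hf] : forall n, exists f, [/\ S f, f.1 = u n & '[f.2, f.1]%:C = r n].
    by move=> n; have [f Sf [<- <-]] := tur n; exists f; rewrite realS.
  have Sf n : S (f n) by have [] := Hf n.
  have fu n : (f n).1 = u n by have [] := Hf n.
  have fx : cvgto dot (fun n => (f n).1) x.
    by move/(cvgtoP dot_norm): ux; apply: eq_cvgto => n; rewrite fu.
  have fC : vanishes2 (fun m n => '[(f m).2 - (f n).2, (f m).1 - (f n).1]).
    move=> e e0; have [|N HN] := tC e%:C; first by rewrite ltcR.
    (* [g] shares its first component with [f m - f n] but may differ from it; by symmetry of [S]
       the form depends on the first component only. *)
    exists N => m n Nm Nn; have [_ [g Sg [gE <-]]] := HN m n Nm Nn.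
    rewrite realS// ltcR; apply: le_lt_trans; rewrite !fu -gE.
    have Sfmn := csubB Ss (Sf m) (Sf n).
    have := sS _ _ (csubB Ss Sfmn Sg) Sg; rewrite /= !fu -gE subrr rdot0l.
    by move: ((f m).2 - (f n).2) => d; rewrite rdotDl rdotNl; lra.
  have [v [Ev vx _ tv]] := cfrel_cvg csubT aA (fun n => SA _ (Sf n)) fC fx.
  exists v => //; rewrite vx; congr pair.
  have [c' -> rc'] : exists2 c', c = c'%:C & '[(f n).2, (f n).1] @[n --> \oo] --> c'.
    apply/cvg_complexP; have -> : (fun n => ('[(f n).2, (f n).1]%:C : R[i]^o)) = r.
      by apply/funext => n; have [] := Hf n.
    exact: rc.
  by congr (_%:C); exact: rcvg_unique tv rc'.
move=> _ [v Ev <-].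
have [w [f [wf wv tw]]] := cf_core csubT aT Ev.
have Af n : A (cfpi (w n), f n) by rewrite AE; exists (w n).
have Ew n : cfE (w n) by have [] := wf n.
(* Two approximations in a row: pairs of [A] approximate [v], and pairs of [S] approximate these in
   form norm. *)
have /choice[g Hg] : forall n, exists g, S g /\
    relform dot ((cfpi (w n), f n) - g) ((cfpi (w n), f n) - g) < harmonic n.
  move=> n; have [g [Sg gv]] := cA _ (Af n).
  have [N HN] := gv _ (harmonic_gt0 n); exists (g N); split => //; exact: HN.
have Sg n : S (g n) by have [] := Hg n.
have /choice[z Hz] : forall n, exists z, cfrep setT z (g n).2 /\ @cfpi _ _ _ a z = (g n).1.
  by move=> n; have := SA _ (Sg n); rewrite AE => -[z ? ?]; exists z.
have Ez n : cfE (z n) by have [[]] := Hz n.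
have pa := cf_psd a; have Es := cf_sub a.
have relE n : relform dot ((cfpi (w n), f n) - g n) ((cfpi (w n), f n) - g n) =
    cftau (w n - z n) (w n - z n) + '[cfpi (w n - z n)].
  have [Ewz _ ->//] := cfrepB csubT (wf n) (Hz n).1.
  by rewrite /relform/= cfpiB (Hz n).2 -rdotDl addrC.
have vz : vanishes (fun n => cftau (w n - z n) (w n - z n) + '[cfpi (w n - z n)]).
  apply: vanishes_le (vanishes_harmonic (R := R)) => n.
  by have [_ /ltW] := Hg n; rewrite relE.
have tz : vanishes (fun n => cftau (z n - v) (z n - v)).
  have v1 : vanishes (fun n => cftau (w n - z n) (w n - z n)).
    by apply: vanishes_le vz => n; rewrite lerDl rdot_ge0.
  have := vanishesD (vanishesZ (ler0n _ 2) tw) (vanishesZ (ler0n _ 2) v1).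
  apply: vanishes_le => n; have -> : z n - v = (w n - v) + - (w n - z n).
    by rewrite opprB [RHS]addrC addrA subrK.
  have := psd_triangle Es pa (csubB Es (Ew n) Ev) (csubN Es (csubB Es (Ew n) (Ez n))).
  by rewrite (psdNl _ (- _) pa) (psdNr _ (w n - z n) pa) opprK.
have zx : cvgto dot (cfpi \o z) (cfpi v).
  have v1 : cvgto dot (fun n => cfpi (w n) - cfpi (z n)) 0.
    apply: vanishes_le vz => n; rewrite subr0 -cfpiB lerDr.
    exact: cftau_ge0 (csubB Es (Ew n) (Ez n)).
  rewrite -[cfpi v]subr0; apply: eq_cvgto (cvgtoB wv v1) => n /=.
  by rewrite subKr.
have zE n : cftau (z n) (z n) = '[(g n).2, (g n).1].
  by have [[_ _ ->//] ->] := Hz n.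
exists (fun n => (g n).1), (fun n => (cftau (z n) (z n))%:C); split.
- by move=> n; exists (g n) => //; rewrite zE realS.
- apply/(cvgtoP dot_norm); apply: eq_cvgto zx => n /=.
  by rewrite (Hz n).2.
- by apply/cvg_complexP; exists (cftau v v) => //; exact: cftau_cvg2 Ez Ev tz.
- move=> e /gt0_complexE[-> e0].
  have [N HN] := vanishes_vanishes2 (vanishesZ (ler0n _ 2) tz) e0.
  exists N => m n Nm Nn; have Sgmn := csubB Ss (Sg m) (Sg n).
  exists (dot (g m - g n).2 (g m - g n).1); first by exists (g m - g n).
  rewrite realS// ltcR; apply: le_lt_trans (HN m n Nm Nn).
  have [_ _ e1] := cfrepB csubT (Hz m).1 (Hz n).1.
  have := e1 _ (csubB Es (Ez m) (Ez n)); rewrite cfpiB (Hz m).2 (Hz n).2 => <-.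
  have -> : z m - z n = (z m - v) + - (z n - v) by rewrite opprB addrA subrK.
  have := psd_triangle Es pa (csubB Es (Ez m) Ev) (csubN Es (csubB Es (Ez n) Ev)).
  by rewrite (psdNl _ (- _) pa) (psdNr _ (z n - v) pa) opprK.
Qed.

Lemma friedrichsP S : nsym dot S -> is_friedrichs dot S (friedrichs dot S).
Proof.
move=> nS; have [A fA] := friedrichs_exists dot_norm nS; have [nA _ _] := fA.
have [a aA] := cfrepresents_exists dot_norm cspaceT nA.
have [aT AE _] := aA.
rewrite /friedrichs (form_closure_core nS fA aA).
by rewrite (rel_of_formE dot_norm cspaceT aT) -AE.
Qed.

Lemma inv_relK A : ((A^-1)^-1)%relation = A.
Proof. by apply/seteqP; split=> -[]. Qed.

Definition is_krein S A := is_friedrichs dot (S^-1)%relation (A^-1)%relation.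

Lemma kreinP S : nsym dot S -> is_krein S (krein dot S).
Proof.
move=> nS; rewrite /is_krein /krein inv_relK.
exact/friedrichsP/nsym_inv.
Qed.

End FriedrichsForm.

(** * Extremal extensions and their forms *)

Section ExtremalExtensions.
Context {R : realType} {H : completeNormedModType R[i]}.
Context (dot : {dot H for (@Num.conj R[i])}).
Context (dot_norm : forall x : H, dot x x = `|x| ^+ 2).
Notation "''[' x , y ]" := (rdot dot x y).
Notation "''[' x ]" := (rdot dot x x).
Implicit Types (S A B F K : set (H * H)) (a b k : cform dot).
Let represents A a := cfrepresents setT A a.
Let AM A B := arith_mean_rel dot setT A B.

Definition nsa_ext S A := nsa dot setT A /\ S `<=` A.

Definition almost_in S A := forall f, A f -> forall e : R, 0 < e ->
  exists2 g, S g & '[f.2 - g.2, f.1 - g.1] < e.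

Lemma nonneg_sa_extensionP S A : nonneg_sa_extension dot S A <-> nsa_ext S A.
Proof. by split=> -[nA SA]; split=> //; apply/(nsaP dot_norm _ cspaceT). Qed.

Lemma extremal_extensionP S A : csub S -> extremal_extension dot S A <->
  nsa_ext S A /\ almost_in S A.
Proof.
move=> Ss; rewrite /extremal_extension.
suff E f : nsa_ext S A -> A f ->
    inf [set complex.Re (dot (f.2 - g.2) (f.1 - g.1)) | g in S] = 0 <->
    forall e : R, 0 < e -> exists2 g, S g & '[f.2 - g.2, f.1 - g.1] < e.
  split=> [[/nonneg_sa_extensionP eA H1]|[eA H1]]; split=> //.
  - by move=> f Af; apply/(E f eA Af)/H1.
  - exact/nonneg_sa_extensionP.
  - by move=> f Af; apply/(E f eA Af)/H1.
move=> [nA SA] Af; set V := [set _ | g in S].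
have V0 : lbound V 0.
  by move=> _ [g Sg <-]; exact: (nsa_ge0 nA (csubB (nsa_sub nA) Af (SA _ Sg))).
have hV : has_inf V.
  by split; [exists (complex.Re (dot (f.2 - 0) (f.1 - 0))), 0; [exact: Ss.1|]|exists 0].
split=> [i0 e e0|He].
  by have [_ [g Sg <-]] := inf_adherent e0 hV; rewrite i0 add0r; exists g.
apply/le_anti/andP; split; last exact: lb_le_inf hV.1 V0.
apply/ler_addgt0Pl => e e0; rewrite addr0.
have [g Sg /ltW] := He e e0; apply: le_trans.
by apply: ge_inf; [exists 0|exists g].
Qed.

Lemma nsa_ext_inv S A : nsa_ext S A -> nsa_ext (S^-1)%relation (A^-1)%relation.
Proof. by move=> [nA SA]; split=> [|f /SA//]; exact: nsa_inv csubT nA. Qed.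

Lemma almost_in_inv S A : almost_in S A -> almost_in (S^-1)%relation (A^-1)%relation.
Proof.
move=> SA f Af e e0; have [[g1 g2] Sg ge] := SA _ Af e e0.
by exists (g2, g1) => //=; rewrite rdotC.
Qed.

Lemma nsa_ext_mean S A B : nsa_ext S A -> nsa_ext S B -> nsa_ext S (AM A B).
Proof.
move=> [nA SA] [nB SB]; split; first exact: (nsa_arith_mean dot_norm cspaceT nA nB).
move=> f Sf; apply: (arith_mean_cap dot_norm cspaceT nA nB).
by split; [exact: SA|exact: SB].
Qed.

(** Vectors with the same image differ by a null vector of the form, by [cf_fun], which
    Cauchy-Schwarz removes. *)
Lemma cftau_pi_eq a (u v w : cfU a) : cfE u -> cfE v -> cfE w ->
  cfpi u = cfpi v -> cftau u w = cftau v w.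
Proof.
move=> Eu Ev Ew uv; have pa := cf_psd a; have Es := cf_sub a.
have Euv := csubB Es Eu Ev.
have := psd_CS Es pa Euv Ew; rewrite (cf_fun Euv) ?cfpiB ?uv ?subrr// mul0r.
rewrite (psdDl _ _ _ pa) (psdNl _ _ pa) => h.
apply/eqP; rewrite -subr_eq0 -sqrf_eq0; apply/eqP/le_anti.
by rewrite h sqr_ge0.
Qed.

Lemma cftau_pi_eq2 a (u v : cfU a) : cfE u -> cfE v ->
  cfpi u = cfpi v -> cftau u u = cftau v v.
Proof.
move=> Eu Ev uv; rewrite (cftau_pi_eq Eu Ev Eu uv) (psdC (cf_psd a))//.
exact: cftau_pi_eq.
Qed.

Lemma friedrichs_core_seq S F x : is_friedrichs dot S F -> F x ->
  exists g : nat -> H * H, [/\ forall n, S (g n),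
    cvgto dot (fun n => (g n).1) x.1,
    vanishes2 (fun m n => '[(g m).2 - (g n).2, (g m).1 - (g n).1])
  & '[(g n).2, (g n).1] @[n --> \oo] --> '[x.2, x.1]].
Proof.
move=> [nF SF cF] Fx; have [g [Sg gx]] := cF _ Fx.
have Fs := nsa_sub nF; have pF := relform_psd (nsa_nsym nF).
have Fg n := SF _ (Sg n).
have Fxg n := csubB Fs Fx (Fg n).
have g1 : cvgto dot (fun n => (g n).1) x.1.
  apply: vanishes_le gx => n; rewrite rdot_subC.
  exact: (relform_ge (nsa_ge0 nF (Fxg n))).
exists g; split=> //.
  apply: vanishes2_le (vanishes_vanishes2 (vanishesZ (ler0n _ 2) gx)) => m n.
  have := psd_triangle Fs pF (csubN Fs (Fxg m)) (Fxg n).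
  rewrite (psdNl _ _ pF) (psdNr _ _ pF) opprK.
  have -> : - (x - g m) + (x - g n) = g m - g n by rewrite opprB addrA subrK.
  by apply: le_trans; exact: (form_le_relform dot (g m - g n)).
have c0 : '[x.2 - (g n).2, x.1 - (g n).1] @[n --> \oo] --> (0 : R).
  apply: (cvg0P _).2 => [n|]; first exact: (nsa_ge0 nF (Fxg n)).
  by apply: vanishes_le gx => n; exact: (form_le_relform dot (x - g n)).
have c1 := rdot_cvgr (y := x.2) g1.
have -> : '[x.2, x.1] = 0 + 2 * '[x.2, x.1] - '[x.2, x.1] by ring.
have c2 : '[x.2 - (g n).2, x.1 - (g n).1] + 2 * '[x.2, (g n).1] - '[x.2, x.1]
    @[n --> \oo] --> 0 + 2 * '[x.2, x.1] - '[x.2, x.1].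
  apply: cvgB; last exact: cvg_cst.
  by apply: cvgD => //; apply: cvgM => //; exact: cvg_cst.
apply: rcvg_ext c2 => n.
by have := nsa_sym nF Fx (Fg n); rewrite !rdotE (rdotC _ (g n).2 x.1); lra.
Qed.

Lemma friedrichs_mean S F A : is_friedrichs dot S F -> nsa_ext S A -> AM F A = F.
Proof.
move=> fF [nA SA]; have [nF SF _] := fF.
apply/esym/(nsa_max csubT nF (nsa_arith_mean dot_norm cspaceT nF nA)) => -[x y] Fx.
have [f fP] := cfrepresents_exists dot_norm cspaceT nF.
have [a aP] := cfrepresents_exists dot_norm cspaceT nA.
have [g [Sg g1 gC _]] := friedrichs_core_seq fF Fx.
have Fg n := SF _ (Sg n); have Ag n := SA _ (Sg n).
apply: (arith_mean_lim dot_norm cspaceT fP aP Fg Ag gC gC g1 g1) => // w z Ew _ _.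
(* One sequence serves both relations, so both halves of the average have the limit computed in the
   form of [F]. *)
have [u [Eu ux uw _]] := cfrel_cvg csubT fP Fg gC g1.
have [_ FE _] := fP; move: Fx; rewrite FE => -[v [Ev _ vw] vx].
have -> : '[y, cfpi w] = 2^-1 * (cftau u w + cftau u w).
  by rewrite -vw// (cftau_pi_eq Ev Eu Ew) ?ux//; lra.
apply: cvgM; first exact: cvg_cst.
by apply: cvgD; exact: uw.
Qed.

Lemma cfrel_sup_le A a (u : cfU a) g : represents A a -> cfE u -> A g ->
  2 * '[g.2, cfpi u] - '[g.2, g.1] <= cftau u u.
Proof.
move=> [_ -> _] Eu [v [Ev _ vg] <-]; have pa := cf_psd a.
rewrite -!vg//; have := psd_ge0 pa (csubB (cf_sub a) Eu Ev).
rewrite !(psdDl _ _ _ pa, psdDr _ _ _ pa, psdNl _ _ pa, psdNr _ _ pa).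
by rewrite (psdC pa Eu Ev); lra.
Qed.

(** A finite supremum puts [phi] in the form domain. The functional
    [2 (phi, m.1 + m.2) - relform m m] is the given quantity plus [2 (phi, m.1) - '[m.1]], hence at
    most [c + '[phi]]. As [ran (I + A)] is the whole space, the first components of a maximizing
    sequence tend to [phi]. *)
Lemma cfrel_sup_dom A a phi c : represents A a -> nsa dot setT A ->
  (forall g, A g -> 2 * '[g.2, phi] - '[g.2, g.1] <= c) ->
  exists u : cfU a, [/\ cfE u, cfpi u = phi & cftau u u <= c].
Proof.
move=> aP nA Hc; have pA := relform_psd (nsa_nsym nA); have As := nsa_sub nA.
have ll : rlinear (fun b : H * H => '[phi, b.1 + b.2]).
  by split=> [x y|r x] /=; rewrite !rdotE; ring.
have [|m [Am mC EL]] := almost_riesz (c := c + '[phi]) As pA ll.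
  move=> m Am; have := Hc _ Am; have := rdot_ge0 dot (phi - m.1).
  by rewrite /relform !rdotE (rdotC _ m.1 phi) (rdotC _ m.2 phi); lra.
have mC2 : vanishes2 (fun n l => relform dot (m n - m l) (m n - m l)).
  apply: vanishes2_le mC _.
  exact: vanishes2Z (ler0n _ 2) (vanishes_vanishes2 (vanishes_harmonic (R := R))).
have [|x mx] := cauchyseq_cvg dot_norm (u := fun n => (m n).1).
  apply: vanishes2_le mC2 => n l.
  exact: (relform_ge (nsa_ge0 nA (csubB As (Am n) (Am l)))).
have mC3 : vanishes2 (fun n l => '[(m n).2 - (m l).2, (m n).1 - (m l).1]).
  apply: vanishes2_le mC2 => n l; exact: (form_le_relform dot (m n - m l)).
have xE : phi = x.
  apply/eqP; rewrite -subr_eq0; apply/eqP/(rdot_eq0 (dot := dot)).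
  have [z Az] := nsa_onto nA (h := phi - x) I.
  suff : '[phi, phi - x] = '[x, phi - x] by rewrite rdotDl rdotNl => ->; rewrite subrr.
  apply: (rcvg_unique _ (rdot_cvgl mx)).
  apply: (rcvg_sqr0 (psd_ge0 pA Az)) => n; have := EL n _ Az.
  rewrite (psdC pA (Am n) Az) /relform/=.
  have -> : z + (phi - x - z) = phi - x by vring dot.
  by rewrite (rdotC _ (phi - x) (m n).1).
have [u [Eu ux uw uu]] := cfrel_cvg csubT aP Am mC3 mx.
exists u; split=> //; first by rewrite ux.
have c1 : 2 * '[(m n).2, phi] - '[(m n).2, (m n).1] @[n --> \oo] -->
    2 * cftau u u - cftau u u.
  apply: cvgB => //; apply: cvgM; first exact: cvg_cst.
  by rewrite xE -ux; exact: uw.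
have -> : cftau u u = 2 * cftau u u - cftau u u by ring.
apply: (rcvg_le _ c1 (cvg_cst c)) => n; exact: Hc.
Qed.

(** [S^-1] is a core of [S_K^-1]; along an approximating sequence the second components and the
    values [(g', g)] converge, so the bound passes to the limit. *)
Lemma krein_sup_le S K phi c : is_krein dot S K ->
  (forall g, S g -> 2 * '[g.2, phi] - '[g.2, g.1] <= c) ->
  forall x, K x -> 2 * '[x.2, phi] - '[x.2, x.1] <= c.
Proof.
move=> kK Hc [x y] Kxy.
have [g [Sg g1 _ gq]] := friedrichs_core_seq (x := (y, x)) kK Kxy.
have c1 : 2 * '[(g n).1, phi] - '[(g n).2, (g n).1] @[n --> \oo] -->
    2 * '[y, phi] - '[x, y].
  apply: cvgB => //; apply: cvgM; first exact: cvg_cst.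
  exact: rdot_cvgl.
rewrite /= [X in _ - X <= _]rdotC; apply: (rcvg_le _ c1 (cvg_cst c)) => n.
by have /= := Hc _ (Sg n); rewrite (rdotC _ (g n).1 (g n).2).
Qed.

Lemma krein_ext S K : is_krein dot S K -> nsa_ext S K /\ almost_in S K.
Proof.
move=> [nK SK cK]; split.
  split; last by move=> [x y] Sxy; exact: (SK (y, x)).
  by have := nsa_inv csubT nK; rewrite inv_relK.
move=> [x y] Kxy e e0; have [g [Sg gx]] := cK (y, x) Kxy.
have [N /(_ N (leqnn N)) HN] := gx e e0.
exists ((g N).2, (g N).1); first exact: Sg.
apply: le_lt_trans HN; rewrite rdotC; exact: (form_le_relform dot ((y, x) - g N)).
Qed.

Definition cfincl a k := forall u : cfU a, cfE u -> exists v : cfU k,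
  [/\ cfE v, cfpi v = cfpi u & cftau v v = cftau u u].

(** Approximation is in the seminorm [cftau] only, which is all that extremality controls; the
    images need not be close in [H]. *)
Lemma almost_in_form S A a (u : cfU a) e : nsa_ext S A -> almost_in S A -> represents A a ->
  cfE u -> 0 < e ->
  exists g (y : cfU a), [/\ S g, cfrep setT y g.2, cfpi y = g.1 & cftau (u - y) (u - y) < e].
Proof.
move=> [nA SA] aS aP Eu e0; have [aT AE _] := aP.
have pa := cf_psd a; have Es := cf_sub a.
have [z [f [zf zu tz]]] := cf_core csubT aT Eu.
(* Two approximations, each entering the triangle inequality with a factor [2]. *)
have e4 : 0 < e / 4 by lra.
have [N /(_ N (leqnn N)) HN] := tz _ e4.
have Af : A (cfpi (z N), f N) by rewrite AE; exists (z N).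
have [g Sg ge] := aS _ Af _ e4.
have := SA _ Sg; rewrite AE => -[y yg yE].
have [Ey _ _] := yg; have [Ez _ _] := zf N.
exists g, y; split=> //.
have [Ezy _ e1] := cfrepB csubT (zf N) yg.
have := psd_triangle Es pa (csubN Es (csubB Es Ez Eu)) Ezy.
have -> : - (z N - u) + (z N - y) = u - y by rewrite opprB addrA subrK.
rewrite (psdNl _ _ pa) (psdNr _ _ pa) opprK (e1 _ Ezy) cfpiB yE.
by move: ge HN => /=; lra.
Qed.

(** The supremum over [S] bounds the form of [S_K] by that of any extension. Conversely, extremality
    gives [g] in [S] for which [2 (g', phi) - (g', g)] comes within [e] of the form of [A]. *)
Lemma extremal_cfincl S K A a k : is_krein dot S K -> represents K k ->
  nsa_ext S A -> almost_in S A -> represents A a -> cfincl a k.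
Proof.
move=> kK kP eA aS aP u Eu; have [[nK SK] _] := krein_ext kK; have [nA SA] := eA.
have [v [Ev vu vle]] := cfrel_sup_dom kP nK (krein_sup_le kK
  (fun g Sg => cfrel_sup_le aP Eu (SA _ Sg))).
exists v; split=> //; apply/le_anti; rewrite vle/=.
apply/ler_addgt0Pl => e e0.
have [g [y [Sg [Ey _ yg] yE ye]]] := almost_in_form eA aS aP Eu e0.
have := cfrel_sup_le kP Ev (SK _ Sg); move: ye; have pa := cf_psd a.
rewrite !(psdDl _ _ _ pa, psdDr _ _ _ pa, psdNl _ _ pa, psdNr _ _ pa).
by rewrite (psdC pa Eu Ey) !yg// yE vu; lra.
Qed.

(** Extremality of [S_K] is carried back: after subtracting an element of [S], the form of [A] and
    the form of [S_K] take the same value. *)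
Lemma cfincl_extremal S K A a k : is_krein dot S K -> represents K k ->
  nsa_ext S A -> represents A a -> cfincl a k -> almost_in S A.
Proof.
move=> kK kP [nA SA] aP ak f Af e e0; have [eK aK] := krein_ext kK.
have [_ AE _] := aP; move: Af; rewrite AE => -[u uf uE]; have [Eu _ _] := uf.
have [v [Ev vu _]] := ak _ Eu.
have [g [y [Sg [Ey _ _] yE ye]]] := almost_in_form eK aK kP Ev e0.
exists g => //; have := SA _ Sg; rewrite AE => -[y' yg yE'].
have [Euy _ e1] := cfrepB csubT uf yg.
have [v' [Ev' vu' tv']] := ak _ Euy.
have Evy := csubB (cf_sub k) Ev Ey.
have : cftau v' v' = cftau (v - y) (v - y).
  by apply: cftau_pi_eq2 => //; rewrite vu' !cfpiB vu yE yE'.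
by rewrite tv' (e1 _ Euy) cfpiB uE yE' => ->.
Qed.

Lemma cfincl_polar a k (u w : cfU a) (u' w' : cfU k) : cfincl a k ->
  cfE u -> cfE w -> cfE u' -> cfE w' -> cfpi u' = cfpi u -> cfpi w' = cfpi w ->
  cftau u' w' = cftau u w.
Proof.
move=> ak Eu Ew Eu' Ew' uE wE; have [pa pk] := (cf_psd a, cf_psd k).
have [Es Ks] := (cf_sub a, cf_sub k).
have [v [Ev vE tv]] := ak _ (csubD Es Eu Ew).
have [z [Ez zE tz]] := ak _ (csubB Es Eu Ew).
have := cftau_pi_eq2 Ev (csubD Ks Eu' Ew'); rewrite vE !cfpiD uE wE tv => /(_ erefl).
have := cftau_pi_eq2 Ez (csubB Ks Eu' Ew'); rewrite zE !cfpiB uE wE tz => /(_ erefl).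
rewrite !(psdDl _ _ _ pa, psdDr _ _ _ pa, psdNl _ _ pa, psdNr _ _ pa).
rewrite !(psdDl _ _ _ pk, psdDr _ _ _ pk, psdNl _ _ pk, psdNr _ _ pk).
by rewrite (psdC pa Ew Eu) (psdC pk Ew' Eu'); lra.
Qed.

Lemma extremal_mean S K A B : is_krein dot S K ->
  nsa_ext S A -> almost_in S A -> nsa_ext S B -> almost_in S B ->
  almost_in S (AM A B).
Proof.
move=> kK eA aA eB aB; have [[nK SK] _] := krein_ext kK.
have [k kP] := cfrepresents_exists dot_norm cspaceT nK.
have [a aP] := cfrepresents_exists dot_norm cspaceT eA.1.
have [b bP] := cfrepresents_exists dot_norm cspaceT eB.1.
have ak := extremal_cfincl kK kP eA aA aP; have bk := extremal_cfincl kK kP eB aB bP.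
have mP : represents (AM A B) (mean_cform a b).
  rewrite /AM (arith_mean_relE dot_norm cspaceT aP bP).
  by apply: cfrepresents_cfrel.
apply: cfincl_extremal kK kP (nsa_ext_mean eA eB) mP _ => -[u w] [/= Eu Ew uw].
have [v [Ev vu tv]] := ak _ Eu; have [z [Ez zw tz]] := bk _ Ew.
exists v; split=> //.
change (cftau v v = 2^-1 * (cftau u u + cftau w w)).
by rewrite -tv -tz [cftau z z](cftau_pi_eq2 Ez Ev) ?zw ?vu//; lra.
Qed.

Lemma krein_mean S K A : is_krein dot S K -> nsa_ext S A -> almost_in S A ->
  AM K A = A.
Proof.
move=> kK eA aA; have [[nK SK] _] := krein_ext kK; have [nA _] := eA.
have [k kP] := cfrepresents_exists dot_norm cspaceT nK.
have [a aP] := cfrepresents_exists dot_norm cspaceT nA.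
have ak := extremal_cfincl kK kP eA aA aP.
apply/esym/(nsa_max csubT nA (nsa_arith_mean dot_norm cspaceT nK nA)) => f.
have [_ AE _] := aP; rewrite {1}AE => -[u [Eu Ku uf] uE].
rewrite (arith_mean_relE dot_norm cspaceT kP aP).
have [v [Ev vu _]] := ak _ Eu.
exists (v, u); last by rewrite /= vu.
split=> // -[w z] [/= Ew Ez wz].
change (2^-1 * (cftau v w + cftau u z) = '[f.2, cfpi w]).
by rewrite (cfincl_polar ak Eu Ez Ev Ew vu wz) uf// wz; lra.
Qed.

End ExtremalExtensions.

(** * Graphs of bounded operators and their harmonic means *)

Section BoundedGraphs.
Context {R : realType} {H : completeNormedModType R[i]}.
Context (dot : {dot H for (@Num.conj R[i])}).
Context (dot_norm : forall x : H, dot x x = `|x| ^+ 2).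
Notation "''[' x , y ]" := (rdot dot x y).
Notation "''[' x ]" := (rdot dot x x).
Implicit Types (K : set H) (A B Z : set (H * H)) (T z : H -> H).

Definition gr K T : set (H * H) := [set (x, T x) | x in K].

Lemma grP K T x y : gr K T (x, y) <-> K x /\ y = T x.
Proof. by split=> [[u Ku [<- <-]]|[Kx ->]]; [|exists x]. Qed.

Lemma eq_gr K S T : (forall x, K x -> S x = T x) -> gr K S = gr K T.
Proof.
by move=> ST; apply/seteqP; split=> -[x y] /grP[Kx ->]; apply/grP; rewrite ST.
Qed.

Lemma gr_inj K S T : gr K S = gr K T -> forall x, K x -> S x = T x.
Proof.
move=> ST x Kx; have /grP[//] : gr K T (x, S x) by rewrite -ST; exists x.
Qed.

Lemma addrel_gr K S T : addrel (gr K S) (gr K T) = gr K (fun x => S x + T x).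
Proof.
apply/seteqP; split=> [[x y] [g [h [/= /grP[Kx ->] /grP[_ ->] ->]]]|[x y] /grP[Kx ->]].
  exact/grP.
by exists (S x), (T x); split=> //; apply/grP.
Qed.

Lemma scalerel_gr K c T : scalerel c (gr K T) = gr K (fun x => c *: T x).
Proof.
apply/seteqP; split=> [_ [[x y] /grP[Kx ->] <-]|[x y] /grP[Kx ->]]; first exact/grP.
by exists (x, T x) => //; apply/grP.
Qed.

Lemma diffrel_gr K S T : diffrel (gr K S) (gr K T) = gr K (fun x => S x - T x).
Proof. by rewrite /diffrel scalerel_gr addrel_gr; apply: eq_gr => x _; rewrite scaleN1r. Qed.

Lemma idrel_gr K : idrel K = gr K id. Proof. by []. Qed.

Lemma comp_gr K S T : (forall x, K (S x)) ->
  (gr setT S \; (gr K T \; gr setT S))%relation = gr setT (fun x => S (T (S x))).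
Proof.
move=> KS; apply/seteqP; split=> -[x y].
  move=> [z [w /= /grP[_ ->] /grP[_ ->]] /grP[_ /= ->]]; exact/grP.
move=> /grP[_ ->]; exists (T (S x)); last exact/grP.
by exists (S x); apply/grP.
Qed.

Lemma bsa_gr_selfadjoint K T : cspace K -> bsa dot T ->
  (forall x, K x -> K (T x)) -> selfadjoint_in dot K (gr K T).
Proof.
move=> Kc [Tl Ts] KT; have [Ks _] := Kc.
have As : csub (gr K T).
  split; first by exists 0; [exact: Ks.1|rewrite clin0].
  by move=> a _ _ [x Kx <-] [y Ky <-]; exists (a *: x + y); [exact: Ks.2|rewrite Tl].
apply: (selfadjoint_inI dot_norm) => //; apply/seteqP; split=> g.
  move=> [x Kx <-]; apply/adjointP => //; split=> //=; first exact: KT.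
  by move=> _ [y Ky <-] /=.
move=> /adjointP-/(_ As)[K1 K2 Ag]; exists g.1 => //.
rewrite [RHS]surjective_pairing; congr pair.
have Kd : K (T g.1 - g.2) by apply: csubB => //; exact: KT.
apply/eqP; rewrite -subr_eq0; apply/eqP/(rdot_eq0 (dot := dot)).
have /= := Ag _ (ex_intro2 _ _ _ Kd erefl); rewrite Ts => e.
by rewrite [X in X = _]rdotDr rdotNr -e subrr.
Qed.

Lemma nsa_gr K T : cspace K -> bsa dot T -> (forall x, K x -> K (T x)) ->
  (forall x, K x -> 0 <= '[T x, x]) -> nsa dot K (gr K T).
Proof.
move=> Kc bT KT T0; have sT := bsa_gr_selfadjoint Kc bT KT.
apply/(nsaP dot_norm) => //; split=> //.
apply/nonneg_rdot => [|f g Af Ag|_ [x Kx <-]]; last exact: T0.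
  by have [[_ /csubP]] := sT.
exact: selfadjoint_rdot sT Af Ag.
Qed.

(* The operator is extended by zero to the orthogonal complement of [K]. *)
Lemma everywhere_defined_fun K Z : cspace K -> csub Z ->
  (forall f, Z f -> K f.1 /\ K f.2) ->
  (forall f g, Z f -> Z g -> '[f.2, g.1] = '[f.1, g.2]) ->
  (forall x, K x -> exists y, Z (x, y)) -> (forall y, Z (0, y) -> y = 0) ->
  exists z, [/\ bsa dot z, forall x, K (z x), Z = gr K z &
    forall x, exists k, [/\ K k, '[k] <= '[x] & z x = z k]].
Proof.
move=> Kc Zs ZK sZ totZ Z0; have [Ks _] := Kc.
have uniqZ x y y' : Z (x, y) -> Z (x, y') -> y = y'.
  move=> Zy Zy'; apply/eqP; rewrite -subr_eq0; apply/eqP/Z0.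
  by have := csubB Zs Zy Zy'; congr Z; congr pair; rewrite /= subrr.
have /choice[z Hz] : forall h, exists y, exists k,
    [/\ K k, forall w, K w -> '[h - k, w] = 0 & Z (k, y)].
  move=> h; have [k Kk hk] := projection dot_norm h Kc.
  by have [y Zy] := totZ k Kk; exists y, k.
have zE h k y : K k -> (forall w, K w -> '[h - k, w] = 0) -> Z (k, y) -> z h = y.
  move=> Kk hk Zk; have [l [Kl hl Zl]] := Hz h.
  by move: Zl; rewrite -(proj_unique Ks Kk Kl hk hl) => Zl; exact: uniqZ Zl Zk.
have zK x : K x -> Z (x, z x).
  move=> Kx; have [y Zy] := totZ x Kx.
  by rewrite (zE x x y)// => w _; rewrite subrr rdot0l.
exists z; split.
- split=> [c x y|x y].
    have [k [Kk hk Zk]] := Hz x; have [l [Kl hl Zl]] := Hz y.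
    apply: (zE _ (c *: k + l)); [exact: Ks.2| |exact: Zs.2 Zk Zl].
    move=> w Kw; have -> : c *: x + y - (c *: k + l) = c *: (x - k) + (y - l).
      by rewrite scalerBr opprD addrACA.
    rewrite rdotDl hl// addr0 /rdot linearZl_LR/=.
    by rewrite dotE hk// hk ?mulr0//; exact: csubZ.
  have [k [Kk hk Zk]] := Hz x; have [l [Kl hl Zl]] := Hz y.
  have [[_ Kzx] [_ Kzy]] := (ZK _ Zk, ZK _ Zl).
  have := sZ _ _ Zk Zl; have := hk _ Kzy; have := hl _ Kzx => /=.
  rewrite !rdotE (rdotC _ y (z x)) (rdotC _ l (z x)).
  by lra.
- by move=> x; have [k [_ _ /ZK[]]] := Hz x.
- apply/seteqP; split=> [[x y] Zxy|[x y] /grP[Kx ->]]; last exact: zK.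
  have [Kx _] := ZK _ Zxy; apply/grP; split=> //; exact: uniqZ Zxy (zK _ Kx).
- move=> x; have [k [Kk hk Zk]] := Hz x; exists k; split=> //.
    have := rdot_ge0 dot (x - k); have := hk _ Kk.
    by rewrite !rdotE (rdotC _ k x); lra.
  exact: uniqZ Zk (zK _ Kk).
Qed.

Lemma contraction_fun K Z : cspace K -> selfadjoint_contraction_in dot K Z ->
  exists z, [/\ bsa dot z, contr dot z, forall x, K (z x) & Z = gr K z].
Proof.
move=> Kc [sZ domZ cZ]; have [[ZK /csubP Zs _] _] := sZ.
have [||||z [bz zK Zz zc]] := everywhere_defined_fun Kc Zs.
- by move=> f /ZK.
- by move=> f g; exact: selfadjoint_rdot sZ.
- by move=> x; rewrite -domZ.
- move=> y /cZ /=; rewrite (norm_le dot_norm) rdot0l => y0.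
  by apply: (rdot_eq0 (dot := dot)); apply: le_anti; rewrite y0 rdot_ge0.
exists z; split=> // x; have [k [Kk kx ->]] := zc x.
apply: le_trans kx; rewrite -(norm_le dot_norm).
by apply: (cZ (k, z k)); rewrite Zz; exists k.
Qed.

Lemma gr_contraction K T : cspace K -> bsa dot T -> (forall x, K x -> K (T x)) ->
  (forall x, K x -> '[T x] <= '[x]) -> selfadjoint_contraction_in dot K (gr K T).
Proof.
move=> Kc bT KT cT; split; first exact: bsa_gr_selfadjoint.
  by apply/seteqP; split=> [x [y /grP[]//]|x Kx]; exists (T x); apply/grP.
by move=> _ [x Kx <-] /=; rewrite (norm_le dot_norm); exact: cT.
Qed.

Lemma cf_lower_bound K A (a : cform dot) c u : cspace K -> cfrepresents K A a ->
  (forall f, A f -> c * '[f.1] <= '[f.2, f.1]) -> @cfE _ _ _ a u ->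
  c * '[cfpi u] <= cftau u u.
Proof.
move=> [Ks _] [aK AE _] Ac Eu.
have [v [f [vf vu tu]]] := cf_core Ks aK Eu.
have Ev n : cfE (v n) by have [] := vf n.
have c1 : c * '[cfpi (v n)] @[n --> \oo] --> c * '[cfpi u].
  by apply: cvgM; [exact: cvg_cst|exact: (rdot_cvg vu vu)].
apply: (rcvg_le _ c1 (cftau_cvg2 Ev Eu tu)) => n.
have [_ _ e1] := vf n; rewrite e1//.
by apply: (Ac (cfpi (v n), f n)); rewrite AE; exists (v n).
Qed.

(** Used with [c = 2^-1] for the inverses of operators between [0] and [2], where it bounds their
    harmonic mean. *)
Lemma arith_mean_lower_bound K A B c f : cspace K -> nsa dot K A -> nsa dot K B ->
  (forall f, A f -> c * '[f.1] <= '[f.2, f.1]) ->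
  (forall f, B f -> c * '[f.1] <= '[f.2, f.1]) ->
  arith_mean_rel dot K A B f -> c * '[f.1] <= '[f.2, f.1].
Proof.
move=> Kc nA nB Ac Bc.
have [a aA] := cfrepresents_exists dot_norm Kc nA.
have [b bB] := cfrepresents_exists dot_norm Kc nB.
rewrite (arith_mean_relE dot_norm Kc aA bB) => -[[u v] [[/= Eu Ev uv] Kf uf] <-].
have := uf (u, v) (And3 Eu Ev uv).
change (2^-1 * (cftau u u + cftau v v) = '[f.2, cfpi u] ->
  c * '[cfpi u] <= '[f.2, cfpi u]) => <-.
have := cf_lower_bound Kc aA Ac Eu; have := cf_lower_bound Kc bB Bc Ev.
by rewrite -uv; lra.
Qed.

Lemma bounded_cvgto T c u x : clin T -> 0 <= c -> (forall x, '[T x] <= c * '[x]) ->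
  cvgto dot u x -> cvgto dot (fun n => T (u n)) (T x).
Proof.
move=> Tl c0 Tc ux; apply: vanishes_le (vanishesZ c0 ux) => n.
by rewrite -clinB.
Qed.

Lemma bsa_add1 z : bsa dot z -> contr dot z ->
  [/\ bsa dot (fun x => x + z x), forall x, 0 <= '[x + z x, x]
    & forall x, '[x + z x, x] <= 2 * '[x]].
Proof.
move=> [zl zs] zc; split=> [|x|x].
- by split=> [a x y|x y]; [rewrite zl scalerDr addrACA|rewrite !rdotE zs].
- by have := rdot_ge0 dot (x + z x); have := zc x; rewrite !rdotE (rdotC _ x (z x)); lra.
- by have := rdot_ge0 dot (x - z x); have := zc x; rewrite !rdotE (rdotC _ x (z x)); lra.
Qed.

(** The bounds [0] and [2] are those of [I + Z] for a selfadjoint contraction [Z]. *)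
Definition bounded_ge0 K T := [/\ bsa dot T, forall x, 0 <= '[T x, x],
  forall x, '[T x, x] <= 2 * '[x] & forall x, K x -> K (T x)].

(** At a minimizer [v] of [(P1 v, v) + (P2 (u - v), u - v)] one has [P1 v = P2 (u - v) = phi / 2]
    with [phi = h(P1, P2) u]. As [P1 + P2] need not be onto, only a minimizing sequence is
    available; its images still converge, and it is returned for the later lifting through [d]. *)
Lemma harm_mean_seq K P1 P2 u : cspace K ->
  bounded_ge0 K P1 -> bounded_ge0 K P2 -> K u ->
  exists phi, harm_mean_rel dot K (gr K P1) (gr K P2) (u, phi) /\
    exists v, [/\ forall n, K (v n),
      vanishes2 (fun m n => '[P1 (v m - v n), v m - v n]),
      vanishes2 (fun m n => '[P2 (v m - v n), v m - v n]),
      cvgto dot (fun n => P1 (v n)) ((2^-1)%:C *: phi)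
    & cvgto dot (fun n => P2 (u - v n)) ((2^-1)%:C *: phi)].
Proof.
move=> Kc [bP1 P10 P12 KP1] [bP2 P20 P22 KP2] Ku; have [Ks Kcl] := Kc.
have [P1l P1s] := bP1; have [P2l P2s] := bP2.
pose p v w := '[P1 v, w] + '[P2 v, w].
have pP : psd_on K p.
  have [q1 q2] := (bsa_psd K bP1 P10, bsa_psd K bP2 P20); rewrite /p.
  split=> [w|w|x y Kx Ky|x Kx]; [split=> [x y|r x]..| |].
  - by rewrite (psdDl _ _ _ q1) (psdDl _ _ _ q2); ring.
  - by rewrite (psdZl _ _ _ q1) (psdZl _ _ _ q2); ring.
  - by rewrite (psdDr _ _ _ q1) (psdDr _ _ _ q2); ring.
  - by rewrite (psdZr _ _ _ q1) (psdZr _ _ _ q2); ring.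
  - by rewrite (psdC q1)// (psdC q2).
  - by rewrite addr_ge0// (P10, P20).
(* Expanding [(P2 (u - m), u - m) + (P1 m, m) >= 0] gives the bound [(P2 u, u)]. *)
have [|v [Kv vC EL]] := almost_riesz (c := '[P2 u, u]) Ks pP (psdr (psd_rdot dot K) (P2 u)).
  move=> m Km; have := P20 (u - m); have := P10 m.
  rewrite (clinB _ _ P2l) /p !rdotE (P2s m u) (rdotC _ m (P2 u)).
  lra.
have p_le w : K w -> p w w <= 4 * '[w].
  by move=> _; have := P12 w; have := P22 w; rewrite /p; lra.
have vC2 : vanishes2 (fun m n => p (v m - v n) (v m - v n)).
  apply: vanishes2_le vC _.
  exact: vanishes2Z (ler0n _ 2) (vanishes_vanishes2 (vanishes_harmonic (R := R))).
have C1 : vanishes2 (fun m n => '[P1 (v m - v n), v m - v n]).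
  by apply: vanishes2_le vC2 => m n; rewrite lerDl P20.
have C2 : vanishes2 (fun m n => '[P2 (v m - v n), v m - v n]).
  by apply: vanishes2_le vC2 => m n; rewrite lerDr P10.
have [|psi vpsi] := cauchyseq_cvg dot_norm (u := fun n => P1 (v n)).
  apply: vanishes2_le (vanishes2Z (ler0n _ 2) C1) => m n.
  by rewrite -(clinB _ _ P1l); apply: bsa_sqr_le.
(* The residual of the Euler-Lagrange equation; testing the inequality with the residual itself
   gives ['[d n] <= 4 * harmonic n]. *)
pose d n := P2 (u - v n) - P1 (v n).
have Kd n : K (d n).
  by apply: csubB => //; [apply: KP2; exact: csubB|exact: KP1].
have d0 : cvgto dot d 0.
  apply: vanishes_le (vanishesZ (ler0n _ 4) (vanishes_harmonic (R := R))) => n.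
  rewrite subr0; have := EL n _ (Kd n); have := p_le _ (Kd n).
  have -> : '[P2 u, d n] - p (v n) (d n) = '[d n].
    by rewrite {3}/d (clinB _ _ P2l) /p !rdotE; ring.
  have := harmonic_ge0 (R := R) n; have := rdot_ge0 dot (d n).
  move: (harmonic n) '[d n] (p _ _) => h D q D0 h0 qD hq.
  have [->|D1] := eqVneq D 0; first by rewrite mulr_ge0.
  have D2 : 0 < D by rewrite lt_neqAle eq_sym D1.
  rewrite -(ler_pM2r D2) -expr2 (le_trans hq)//.
  by rewrite [4 * h]mulrC -mulrA ler_wpM2l.
have P2psi : cvgto dot (fun n => P2 (u - v n)) psi.
  rewrite -[psi]addr0; apply: eq_cvgto (cvgtoD vpsi d0) => n.
  by rewrite /d addrC subrK.
have Kpsi : K psi.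
  by apply: (closed_seqP dot_norm _).1 Kcl _ _ _ vpsi => n; exact: KP1.
pose phi := (2 : R)%:C *: psi.
have halfphi : (2^-1)%:C *: phi = psi.
  by rewrite /phi scalerA -rmorphM/= mulVf ?pnatr_eq0// scale1r.
have nP1 : nsa dot K ((gr K P1)^-1)%relation.
  by apply: nsa_inv => //; exact: nsa_gr.
have nP2 : nsa dot K ((gr K P2)^-1)%relation.
  by apply: nsa_inv => //; exact: nsa_gr.
exists phi; split; last by exists v; rewrite halfphi.
have [a aA] := cfrepresents_exists dot_norm Kc nP1.
have [b bB] := cfrepresents_exists dot_norm Kc nP2.
(* With the factor [2] both first components tend to [phi], and the second components average
   exactly to [u]. *)
pose pp n := ((2 : R)%:C *: P1 (v n), (2 : R)%:C *: v n).
pose qq n := ((2 : R)%:C *: P2 (u - v n), (2 : R)%:C *: (u - v n)).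
apply: (@arith_mean_lim _ _ _ dot_norm K _ _ a b pp qq phi u Kc aA bB) => //.
- by move=> n; apply/grP; split; [exact: csubZ|rewrite /= (clinZ _ _ P1l)].
- move=> n; apply/grP; split; [by apply: csubZ => //; exact: csubB|].
  by rewrite /= (clinZ _ _ P2l).
- apply: vanishes2_le (vanishes2Z (ler0n _ 4) C1) => m n /=.
  by rewrite -!scalerBr -(clinB _ _ P1l) rdotZl rdotZr (rdotC _ _ (P1 _)); lra.
- apply: vanishes2_le (vanishes2Z (ler0n _ 4) C2) => m n /=.
  rewrite -!scalerBr -(clinB _ _ P2l).
  have -> : u - v m - (u - v n) = - (v m - v n) by vring dot.
  rewrite (clinN _ P2l) scalerN scalerN rdotNl rdotNr opprK.
  by rewrite rdotZl rdotZr (rdotC _ _ (P2 _)); lra.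
- exact: cvgtoZ.
- exact: cvgtoZ.
- move=> w z _ _ _ /=.
  have e n : 2^-1 * ('[(pp n).2, cfpi w] + '[(qq n).2, cfpi w]) = '[u, cfpi w].
    by rewrite /= !rdotE; lra.
  by apply: rcvg_ext (cvg_cst '[u, cfpi w]) => n; rewrite e.
Qed.

(** The inverses have lower bound [2^-1], which passes to their mean. This makes the harmonic mean
    single-valued and gives ['[w x] <= 2 (w x, x)], that is, contractivity of [w - I]. *)
Lemma harm_mean_fun K P1 P2 : cspace K -> bounded_ge0 K P1 -> bounded_ge0 K P2 ->
  exists w, [/\ bsa dot w, forall x, K (w x),
    harm_mean_rel dot K (gr K P1) (gr K P2) = gr K w
    & forall x, K x -> '[w x - x] <= '[x]].
Proof.
move=> Kc bP1 bP2; have [Ks Kcl] := Kc.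
have nP T : bounded_ge0 K T -> nsa dot K ((gr K T)^-1)%relation /\
    forall f, ((gr K T)^-1)%relation f -> 2^-1 * '[f.1] <= '[f.2, f.1].
  move=> [bT T0 T2 KT]; split; first by apply: nsa_inv => //; exact: nsa_gr.
  move=> [x y] /grP[_ /= ->]; have := bsa_sqr_le y bT T0 (ler0n _ 2) T2.
  by rewrite (rdotC _ y); lra.
have [[nP1 lP1] [nP2 lP2]] := (nP _ bP1, nP _ bP2).
have nW : nsa dot K (harm_mean_rel dot K (gr K P1) (gr K P2)).
  by apply: nsa_inv => //; exact: nsa_arith_mean.
have lW x y : harm_mean_rel dot K (gr K P1) (gr K P2) (x, y) -> 2^-1 * '[y] <= '[x, y].
  exact: (arith_mean_lower_bound Kc nP1 nP2 lP1 lP2).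
have [||||w [bw wK WE _]] := everywhere_defined_fun Kc (nsa_sub nW).
- by move=> f /(nsa_K nW).
- by move=> f g; exact: (nsa_sym nW).
- move=> x Kx; have [y [Wxy _]] := harm_mean_seq Kc bP1 bP2 Kx.
  by exists y.
- move=> y /lW; rewrite rdot0l => y0; apply: (rdot_eq0 (dot := dot)).
  by apply: le_anti; rewrite rdot_ge0 andbT; lra.
exists w; split=> // x Kx.
have /lW : harm_mean_rel dot K (gr K P1) (gr K P2) (x, w x) by rewrite WE; exists x.
by rewrite !rdotE (rdotC _ (w x) x); lra.
Qed.

End BoundedGraphs.

(** * Resolvents, Cayley transforms and parameters *)

Section Parametrization.
Context {R : realType} {H : completeNormedModType R[i]}.
Context (dot : {dot H for (@Num.conj R[i])}).
Context (dot_norm : forall x : H, dot x x = `|x| ^+ 2).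
Notation "''[' x , y ]" := (rdot dot x y).
Notation "''[' x ]" := (rdot dot x x).
Implicit Types (N : set H) (S A B F K Z T : set (H * H)) (X Y d z t : H -> H).

Definition is_resolvent A X := [/\ bsa dot X, forall x, '[X x] <= '[X x, x]
  & forall w, A (X w, w - X w)].

Lemma resolvent_exists A : nsa dot setT A -> exists X, is_resolvent A X.
Proof.
move=> nA; have [X [bX X1 _ XA]] := resolvent_compl dot_norm cspaceT nA.
by exists X; split=> // w; exact: XA.
Qed.

Lemma resolventE A X x y : nsa dot setT A -> is_resolvent A X -> A (x, y) -> X (x + y) = x.
Proof.
move=> nA [_ _ XA] Axy; apply: (nsa_resolvent_inj csubT nA (XA _)).
by rewrite addrC addKr.
Qed.

Lemma resolvent_nsa X : bsa dot X -> (forall x, '[X x] <= '[X x, x]) ->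
  nsa dot setT [set (X w, w - X w) | w in setT].
Proof.
move=> [Xl Xs] X1; split.
- split; first by exists 0; rewrite // !(clinE Xl) subr0.
  move=> a _ _ [x _ <-] [y _ <-]; exists (a *: x + y) => //.
  by rewrite Xl; congr pair; rewrite /= scalerBr opprD addrACA.
- by [].
- by move=> _ _ [x _ <-] [y _ <-] /=; rewrite !rdotE !Xs; lra.
- by move=> _ [x _ <-] /=; have := X1 x; rewrite !rdotE (rdotC _ x (X x)); lra.
- by move=> h _; exists (X h), h.
Qed.

Lemma cayley_gr A X : nsa dot setT A -> is_resolvent A X ->
  cayley A = gr setT (fun x => X x + X x - x).
Proof.
move=> nA rX; rewrite -cayley_contractionE.
apply/seteqP; split=> [_ [[x y] Axy <-]|[x y] /grP[_ ->]] /=.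
  by apply/grP; split=> //; rewrite (resolventE nA rX Axy); vring dot.
have [_ _ XA] := rX; exists (X x, x - X x); first exact: XA.
by rewrite /=; congr pair; vring dot.
Qed.

Lemma resolvent_inv A X : nsa dot setT A -> is_resolvent A X ->
  is_resolvent (A^-1)%relation (fun x => x - X x).
Proof.
move=> nA [bX X1 XA]; split; first exact: bsa_compl.
  by move=> x; have := X1 x; rewrite !rdotE (rdotC _ x (X x)); lra.
by move=> w /=; rewrite subKr; exact: XA.
Qed.

Lemma cayley_mean_resolvent A B X Y : nsa dot setT A -> nsa dot setT B ->
  is_resolvent A X -> is_resolvent B Y ->
  nsa dot setT (cayley_mean_rel A B) /\
  is_resolvent (cayley_mean_rel A B) (fun x => (2^-1)%:C *: (X x + Y x)).
Proof.
move=> nA nB rX rY; have [[[Xl Xs] X1 XA] [[Yl Ys] Y1 YB]] := (rX, rY).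
pose Z x := (2^-1)%:C *: (X x + Y x).
have bZ : bsa dot Z.
  split=> [a x y|x y]; last by rewrite !rdotE Xs Ys.
  rewrite /Z Xl Yl addrACA -scalerDr [LHS]scalerDr; congr (_ + _).
  by rewrite !scalerA [in RHS]mulrC.
have Z1 x : '[Z x] <= '[Z x, x].
  rewrite /Z rdotZl rdotZr rdotZl; have := rdot_triangle dot (X x) (Y x).
  by have := X1 x; have := Y1 x; rewrite (rdotDl _ (X x) (Y x) x); lra.
have -> : cayley_mean_rel A B = [set (Z w, w - Z w) | w in setT].
  rewrite /cayley_mean_rel (cayley_gr nA rX) (cayley_gr nB rY) addrel_gr.
  rewrite half_complexE scalerel_gr /cayley_contraction.
  have Zl := bsa_lin bZ.
  apply/seteqP; split=> [_ [[x y] /grP[_ ->] <-]|_ [w _ <-]] /=.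
    exists ((2 : R)%:C *: x) => //; rewrite (clinZ _ _ Zl) /Z.
    by congr pair; vring dot.
  exists ((2^-1)%:C *: w, (2^-1)%:C *: (X ((2^-1)%:C *: w) + X ((2^-1)%:C *: w)
    - (2^-1)%:C *: w + (Y ((2^-1)%:C *: w) + Y ((2^-1)%:C *: w) - (2^-1)%:C *: w))).
    exact/grP.
  rewrite /= (clinZ _ _ Xl) (clinZ _ _ Yl) /Z.
  by congr pair; vring dot.
split; first exact: resolvent_nsa.
by split=> // w; exists w.
Qed.

(** [k = g1 + g2] for [g] in [S] close to [{XF h, h - XF h}] in form norm; [relform] of the
    difference is exactly [(XF (h - k), h - k)]. *)
Lemma friedrichs_dense S F XF h e : is_friedrichs dot S F -> is_resolvent F XF -> 0 < e ->
  exists k, (forall A X, nsa_ext dot S A -> is_resolvent A X -> X k = XF k) /\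
    '[XF (h - k), h - k] < e.
Proof.
move=> [nF SF cF] rF e0; have [bF F1 FF] := rF.
have [g [Sg gv]] := cF _ (FF h); have [N /(_ N (leqnn N)) HN] := gv _ e0.
have [[g1 g2] gE] : exists p, p = g N by eexists.
move: HN (Sg N); rewrite -gE => HN Sg12.
have XFg := resolventE nF rF (SF _ Sg12).
exists (g1 + g2); split=> [A X [nA SA] rX|].
  by rewrite XFg; exact: resolventE nA rX (SA _ Sg12).
rewrite (clinB _ _ (bsa_lin bF)) XFg rdotC; move: HN; rewrite /relform/=.
suff -> : XF h - g1 + (h - XF h - g2) = h - (g1 + g2) by [].
by vring dot.
Qed.

(** [X - XF] vanishes at [k], so its form at [x] is its form at [x - k], which is at least
    [- (XF (x - k), x - k) > - e]. *)
Lemma resolvent_le S F A XF X x : is_friedrichs dot S F -> nsa_ext dot S A ->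
  is_resolvent F XF -> is_resolvent A X -> '[XF x, x] <= '[X x, x].
Proof.
move=> fF eA rF rX; have [[[Fl Fs] F1 _] [[Xl Xs] X1 _]] := (rF, rX).
apply/ler_addgt0Pl => e e0; have [k [kX kF]] := friedrichs_dense x fF rF e0.
have Xk := kX _ _ eA rX; move: kF; have := X1 (x - k).
have := rdot_ge0 dot (X (x - k)); have := Xs x k; have := Fs x k.
rewrite (clinB _ _ Xl) (clinB _ _ Fl) Xk; move: (X x) (XF x) (XF k) => p q r.
by rewrite !rdotE; lra.
Qed.

(** [d] is the function behind the chosen square root of [Q_M - Q_mu]; [N] is a separate argument so
    that the same [d] and [N] serve [S] and [S^-1]. *)
Record param_setup S XF XK d N : Prop := ParamSetup {
  ps_F : is_resolvent (friedrichs dot S) XF;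
  ps_K : is_resolvent (krein dot S) XK;
  ps_D : sqrt_in dot setT (diffrel (Q_M dot S) (Q_mu dot S)) = gr setT d;
  ps_N0 : N_0 dot S = N;
  ps_d : bsa dot d;
  ps_dd : forall x, d (d x) = (XK x - XF x) + (XK x - XF x);
  ps_N : cspace N;
  ps_dN : forall x, N (d x);
  ps_dense : forall u, N u -> forall e : R, 0 < e -> exists g, '[d g - u] < e }.

Lemma friedrichs_nsa S : nsym dot S -> nsa dot setT (friedrichs dot S).
Proof. by move=> /(friedrichsP dot_norm)[]. Qed.

Lemma krein_nsa S : nsym dot S -> nsa dot setT (krein dot S).
Proof. by move=> nS; have [[]] := krein_ext (kreinP dot_norm nS). Qed.

Lemma Q_muE S XF : nsym dot S -> is_resolvent (friedrichs dot S) XF ->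
  Q_mu dot S = gr setT (fun x => XF x + XF x - x).
Proof. by move=> nS rF; apply: cayley_gr => //; exact: friedrichs_nsa. Qed.

Lemma Q_ME S XK : nsym dot S -> is_resolvent (krein dot S) XK ->
  Q_M dot S = gr setT (fun x => XK x + XK x - x).
Proof. by move=> nS rK; apply: cayley_gr => //; exact: krein_nsa. Qed.

Lemma Q_diffE S XF XK : nsym dot S -> is_resolvent (friedrichs dot S) XF ->
  is_resolvent (krein dot S) XK ->
  diffrel (Q_M dot S) (Q_mu dot S) = gr setT (fun x => (XK x - XF x) + (XK x - XF x)).
Proof.
move=> nS rF rK; rewrite (Q_muE nS rF) (Q_ME nS rK) diffrel_gr.
by apply: eq_gr => x _; vring dot.
Qed.

Lemma param_setup_exists S : nsym dot S ->
  exists XF XK d, param_setup S XF XK d (N_0 dot S).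
Proof.
move=> nS; have fF := friedrichsP dot_norm nS; have kK := kreinP dot_norm nS.
have [eK _] := krein_ext kK; have nF := friedrichs_nsa nS; have nK := krein_nsa nS.
have [XF rF] := resolvent_exists nF; have [XK rK] := resolvent_exists nK.
have [[[Fl Fs] F1 _] [[Kl Ks] K1 _]] := (rF, rK).
have GE := Q_diffE nS rF rK; set G := diffrel _ _ in GE.
pose D x := XK x - XF x.
have bD : bsa dot D.
  split=> [a x y|x y]; last by rewrite /D !rdotE Ks Fs.
  by rewrite /D Kl Fl scalerBr opprD addrACA.
have Dl := bsa_lin bD.
have D0 x : 0 <= '[D x, x].
  by rewrite /D rdotDl rdotNl subr_ge0; exact: (resolvent_le x fF eK rF rK).
have D1 x : '[D x, x] <= '[x].
  have := F1 x; have := K1 x; have := rdot_ge0 dot (XF x).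
  have := rdot_ge0 dot (x - XK x).
  by rewrite /D !rdotE (rdotC _ x (XK x)); lra.
have [_ cD] := unit_interval_contr bD (fun x => bsa_contr x bD D0 D1).
have [C [[Cl Cs] cC CC _]] := bsa_root dot_norm bD cD.
(* [C] is the root of [D = XK - XF], while [Q_M - Q_mu] is [2 D], with root [s C]. *)
pose s : R := Num.sqrt 2; have ss : s * s = 2 by rewrite -expr2 sqr_sqrtr.
pose B := sqrt_in dot setT G.
have [nB B0 BB] : [/\ nonneg_selfadjoint_in dot setT B, mulpart B = [set 0]
    & (B \; B)%relation = G].
  rewrite /B /sqrt_in; apply: (getPex (P := [set B : set (H * H) | [/\
    nonneg_selfadjoint_in dot setT B, mulpart B = [set 0] & _ = _]])).
  exists (gr setT (fun x => s%:C *: C x)); split.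
  - apply/(nsaP dot_norm _ cspaceT)/(nsa_gr dot_norm cspaceT) => //.
      split=> [a x y|x y]; last by rewrite !rdotE Cs.
      by rewrite Cl scalerDr !scalerA mulrC.
    move=> x _; rewrite rdotZl mulr_ge0 ?sqrtr_ge0//.
    exact: (compl_contr_ge0 x cC).
  - apply/seteqP; split=> [y /grP[_ ->]|_ ->]; first by rewrite /= clin0// scaler0.
    by apply/grP; rewrite clin0// scaler0.
  - rewrite GE; apply/seteqP; split=> -[x y].
      move=> [w /= /grP[_ ->] /grP[_ ->]]; apply/grP; split=> //.
      by rewrite (clinZ _ _ Cl) scalerA -rmorphM/= ss CC; rewrite /D; vring dot.
    move=> /grP[_ ->]; exists (s%:C *: C x); first exact/grP.
    apply/grP; split=> //.
    by rewrite (clinZ _ _ Cl) scalerA -rmorphM/= ss CC; rewrite /D; vring dot.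
have nB' := (nsaP dot_norm _ cspaceT).1 nB.
have [||||d [bd _ BE _]] := everywhere_defined_fun dot_norm cspaceT (nsa_sub nB').
- by [].
- by move=> f g; exact: (nsa_sym nB').
- move=> x _; have : G (x, (XK x - XF x) + (XK x - XF x)) by rewrite GE; exact/grP.
  by rewrite -BB => -[w /= ? _]; exists w.
- by move=> y By; have : mulpart B y by []; rewrite B0.
have dd x : d (d x) = (XK x - XF x) + (XK x - XF x).
  have : G (x, d (d x)).
    by rewrite -BB BE; exists (d x); exact/grP.
  by rewrite GE => /grP[].
have dl := bsa_lin bd; have ds := bsa_sym bd.
have N0E : N_0 dot S = closure (range (fun x => d (d x))).
  rewrite /N_0 -/G GE; congr closure; apply/seteqP; split=> [y [x /grP[_ ->]]|_ [x _ <-]].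
    by exists x; rewrite ?dd.
  by exists x; apply/grP; rewrite dd.
have Nc : cspace (N_0 dot S).
  split; last by rewrite N0E; exact: closed_closure.
  rewrite N0E; apply: (csub_closure dot_norm); split.
    by exists 0; rewrite // !clin0.
  by move=> a _ _ [x _ <-] [y _ <-]; exists (a *: x + y); rewrite // !dl.
exists XF, XK, d; split=> //.
(* [N_0] is the closure of [ran (d ^+ 2)], yet it contains [ran d]: the residual [d x - k] is
   orthogonal to [ran (d ^+ 2)], so [d] annihilates it, and it is orthogonal to [d x] as well as to
   [k]. *)
- move=> x; have [k Nk xk] := projection dot_norm (d x) Nc.
  suff -> : d x = k by [].
  apply/eqP; rewrite -subr_eq0; apply/eqP/(rdot_eq0 (dot := dot)).
  have e0 y : '[d (d x - k), d y] = 0.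
    rewrite ds; apply: xk; rewrite N0E; apply: subset_closure; by exists y.
  have e1 : d (d x - k) = 0.
    by apply: (rdot_eq0 (dot := dot)); exact: e0.
  by rewrite rdotDr rdotNr (xk _ Nk) oppr0 addr0 -ds e1 rdot0l.
- move=> u; rewrite N0E => /(closureP dot_norm) Nu e /Nu[_ [y _ <-] yu].
  by exists (d y).
Qed.

(** Inversion replaces each resolvent [X] by [I - X]; the difference of the two extreme resolvents,
    hence [d] and [N], is unchanged. *)
Lemma param_setup_inv S XF XK d N : nsym dot S -> param_setup S XF XK d N ->
  param_setup (S^-1)%relation (fun x => x - XK x) (fun x => x - XF x) d N.
Proof.
move=> nS [rF rK DE NE bd dd Nc dN dense]; have nS' := nsym_inv nS.
have rF' : is_resolvent (friedrichs dot (S^-1)%relation) (fun x => x - XK x).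
  by have := resolvent_inv (krein_nsa nS) rK; rewrite /krein inv_relK.
have rK' : is_resolvent (krein dot (S^-1)%relation) (fun x => x - XF x).
  by rewrite /krein inv_relK; exact: resolvent_inv (friedrichs_nsa nS) rF.
have GE : diffrel (Q_M dot (S^-1)%relation) (Q_mu dot (S^-1)%relation) =
    diffrel (Q_M dot S) (Q_mu dot S).
  rewrite (Q_diffE nS' rF' rK') (Q_diffE nS rF rK); apply: eq_gr => x _.
  by vring dot.
split=> //; first by rewrite GE.
  by rewrite -NE /N_0 GE.
by move=> x; rewrite dd; vring dot.
Qed.

Lemma is_parameter_gr S XF XK d N T z : nsym dot S -> param_setup S XF XK d N ->
  is_parameter dot S T (gr N z) <-> selfadjoint_contraction_in dot N (gr N z) /\
    T = gr setT (fun x => XF x + XK x - x + (2^-1)%:C *: d (z (d x))).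
Proof.
move=> nS [rF rK DE NE bd dd Nc dN dense].
rewrite /is_parameter DE NE (comp_gr _ dN) (Q_muE nS rF) (Q_ME nS rK) half_complexE.
rewrite addrel_gr !scalerel_gr addrel_gr.
have -> : gr setT (fun x => (2^-1)%:C *: (XF x + XF x - x + (XK x + XK x - x)) +
    (2^-1)%:C *: d (z (d x))) =
    gr setT (fun x => XF x + XK x - x + (2^-1)%:C *: d (z (d x))).
  by apply: eq_gr => x _; vring dot.
by [].
Qed.

End Parametrization.

(** * The parameter of the arithmetic mean *)

Section MeanParameter.
Context {R : realType} {H : completeNormedModType R[i]}.
Context (dot : {dot H for (@Num.conj R[i])}).
Context (dot_norm : forall x : H, dot x x = `|x| ^+ 2).
Notation "''[' x , y ]" := (rdot dot x y).
Notation "''[' x ]" := (rdot dot x x).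
Implicit Types (N : set H) (S A B Z T W : set (H * H)) (X d z w P : H -> H).

(** One half of the pair construction, applied to [g n], [v n] with [P1] and to [f - g n],
    [d f - v n] with [P2]. The form of [X] splits into the [XF] part, controlled by [f / 2], and the
    [P] part, controlled by [v]. *)
Lemma mean_param_side N X XF P d c f psi (g v : nat -> H) :
  bsa dot XF -> (forall x, '[XF x] <= '[XF x, x]) -> bounded_ge0 dot N P ->
  bsa dot d -> 0 <= c -> (forall x, '[d x] <= c * '[x]) ->
  (forall x, X x = XF x + (4^-1)%:C *: d (P (d x))) ->
  vanishes (fun n => '[d (g n) - v n]) ->
  vanishes (fun n => '[XF (g n - (2^-1)%:C *: f), g n - (2^-1)%:C *: f]) ->
  vanishes2 (fun m n => '[P (v m - v n), v m - v n]) ->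
  cvgto dot (fun n => P (v n)) psi ->
  vanishes2 (fun m n => '[X (g m - g n), g m - g n]) /\
  cvgto dot (fun n => X (g n)) ((2^-1)%:C *: XF f + (4^-1)%:C *: d psi).
Proof.
move=> bF F1 [bP P0 P2 _] bd c0 dc XE dv Fg vC Pv.
have [[Fl Fs] [Pl Ps] [dl ds]] := And3 bF bP bd.
have F0 x : 0 <= '[XF x, x] by apply: le_trans (F1 x); exact: rdot_ge0.
have pF := bsa_psd setT bF F0; have pP := bsa_psd setT bP P0.
have Pb x : '[P x] <= 4 * '[x].
  by have := bsa_sqr_le x bP P0 (ler0n _ 2) P2; have := P2 x; lra.
split.
  have XX x : '[X x, x] = '[XF x, x] + 4^-1 * '[P (d x), d x].
    by rewrite XE rdotDl rdotZl ds.
  have e1 := vanishes_vanishes2 (vanishesZ (ler0n _ 2) Fg).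
  have e2 := vanishes_vanishes2 (vanishesZ (ler0n _ 4) dv).
  have h0 : 0 <= 2^-1 :> R by lra.
  have := vanishes2D e1 (vanishes2Z h0 (vanishes2D vC e2)).
  apply: vanishes2_le => m n; rewrite XX; apply: lerD.
    set x := g m - (2^-1)%:C *: f; set y := g n - (2^-1)%:C *: f.
    have -> : g m - g n = x + - y by rewrite opprB addrA subrK.
    have := @psd_triangle _ _ _ _ x (- y) csubT pF I I.
    by rewrite (clinN _ Fl) rdotNl rdotNr opprK.
  set x := d (g m) - v m; set y := d (g n) - v n.
  have -> : d (g m - g n) = (v m - v n) + (x - y).
    by rewrite (clinB _ _ dl) /x /y; vring dot.
  have t1 := @psd_triangle _ _ _ _ (v m - v n) (x - y) csubT pP I I.
  have t2 := P2 (x - y); have t3 := rdot_triangle dot x (- y).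
  move: t1 t3; rewrite /= -/x -/y rdotNl rdotNr opprK.
  by lra.
have XFg : cvgto dot (fun n => XF (g n)) ((2^-1)%:C *: XF f).
  apply: vanishes_le Fg => n; rewrite -(clinZ _ _ Fl) -(clinB _ _ Fl).
  exact: F1.
have dPd : cvgto dot (fun n => d (P (d (g n)))) (d psi).
  apply: (bounded_cvgto dl c0 dc).
  have v0 : cvgto dot (fun n => d (g n) - v n) 0.
    by apply: vanishes_le dv => n; rewrite subr0.
  have := cvgtoD (bounded_cvgto Pl (ler0n _ 4) Pb v0) Pv.
  rewrite (clin0 Pl) add0r; apply: eq_cvgto => n.
  by rewrite -(clinD _ _ Pl) subrK.
apply: eq_cvgto (cvgtoD XFg (cvgtoZ ((4^-1)%:C) dPd)) => n.
by rewrite XE.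
Qed.

Lemma mean_resolvent S XF XK d N A1 A2 X1 X2 P1 P2 w f :
  nsym dot S -> param_setup dot S XF XK d N ->
  nsa_ext dot S A1 -> nsa_ext dot S A2 ->
  is_resolvent dot A1 X1 -> is_resolvent dot A2 X2 ->
  bounded_ge0 dot N P1 -> bounded_ge0 dot N P2 ->
  (forall x, X1 x = XF x + (4^-1)%:C *: d (P1 (d x))) ->
  (forall x, X2 x = XF x + (4^-1)%:C *: d (P2 (d x))) ->
  harm_mean_rel dot N (gr N P1) (gr N P2) = gr N w ->
  let y := XF f + (4^-1)%:C *: d (w (d f)) in
  arith_mean_rel dot setT A1 A2 (y, f - y).
Proof.
move=> nS [rF rK _ _ bd dd Nc dN dense] eA1 eA2 r1 r2 bP1 bP2 X1E X2E WE y.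
have [bF F1 FF] := rF; have [bK K1 KK] := rK.
have [bX1 X11 XA1] := r1; have [bX2 X21 XA2] := r2.
have [X1l X2l] := (bsa_lin bX1, bsa_lin bX2).
have [Fl dl] := (bsa_lin bF, bsa_lin bd).
have [eK _] := krein_ext (kreinP dot_norm nS); have fF := friedrichsP dot_norm nS.
have db x : '[d x] <= 2 * '[x].
  rewrite -(bsa_sym bd) dd rdotDl rdotDl rdotNl.
  have := F1 x; have := K1 x; have := rdot_ge0 dot (XF x); have := rdot_ge0 dot (x - XK x).
  by rewrite !rdotE (rdotC _ x (XK x)); lra.
have [phi [Wphi [v [Nv vC1 vC2 v1 v2]]]] := harm_mean_seq dot_norm Nc bP1 bP2 (dN f).
have phiE : phi = w (d f) by move: Wphi; rewrite WE => /grP[].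
(* Both [g n] and [f - g n] are to tend to [f / 2] in the [XF] seminorm, so that [X1 (g n)] and
   [X2 (f - g n)] have the common limit [y / 2]. *)
pose hf := (2^-1)%:C *: f.
have /choice[g Hg] : forall n, exists g, '[d g - v n] < harmonic n /\
    '[XF (g - hf), g - hf] < harmonic n.
  move=> n; have [g' g'v] := dense _ (Nv n) _ (harmonic_gt0 n).
  have [k [kX kF]] := friedrichs_dense (g' - hf) fF rF (harmonic_gt0 n).
  have dk : d k = 0.
    apply: (rdot_eq0 (dot := dot)); rewrite -(bsa_sym bd) dd (kX _ _ eK rK).
    by rewrite subrr addr0 rdot0l.
  exists (g' - k); rewrite (clinB _ _ dl) dk subr0; split=> //.
  by rewrite addrAC.
have dgv : vanishes (fun n => '[d (g n) - v n]).
  by apply: vanishes_le (vanishes_harmonic (R := R)) => n; have [/ltW] := Hg n.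
have Fg : vanishes (fun n => '[XF (g n - hf), g n - hf]).
  by apply: vanishes_le (vanishes_harmonic (R := R)) => n; have [_ /ltW] := Hg n.
pose h n := f - g n; pose v' n := d f - v n.
have [C1 c1] := mean_param_side bF F1 bP1 bd (ler0n _ 2) db X1E dgv Fg vC1 v1.
have [|||C2 c2] := mean_param_side (g := h) (v := v') (f := f) bF F1 bP2 bd (ler0n _ 2) db X2E _ _ _ v2.
- apply: vanishes_le dgv => n; rewrite /h /v' (clinB _ _ dl).
  have -> : d f - d (g n) - (d f - v n) = - (d (g n) - v n) by vring dot.
  by rewrite rdotNl rdotNr opprK.
- apply: vanishes_le Fg => n; rewrite /h.
  have -> : f - g n - (2^-1)%:C *: f = - (g n - hf) by rewrite /hf; vring dot.
  by rewrite (clinN _ Fl) rdotNl rdotNr opprK.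
- apply: vanishes2_le vC2 => m n; rewrite /v'.
  have -> : d f - v m - (d f - v n) = - (v m - v n) by vring dot.
  have [[P2l _] _ _ _] := bP2.
  by rewrite (clinN _ P2l) rdotNl rdotNr opprK.
(* Doubling turns that limit into [y], and the averaged second components become
   [f - (X1 (g n) + X2 (h n))], which tend to [f - y]. *)
pose p n := ((2 : R)%:C *: X1 (g n), (2 : R)%:C *: (g n - X1 (g n))).
pose q n := ((2 : R)%:C *: X2 (h n), (2 : R)%:C *: (h n - X2 (h n))).
have lim_y psi x : x = (2^-1)%:C *: psi -> (2 : R)%:C *: ((2^-1)%:C *: XF f + (4^-1)%:C *: d x) =
    XF f + (4^-1)%:C *: d psi.
  by move=> ->; rewrite (clinZ _ _ dl); vring dot.
have pC X u : clin X -> (forall x, '[X x] <= '[X x, x]) ->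
    vanishes2 (fun m n => '[X (u m - u n), u m - u n]) ->
    vanishes2 (fun m n => '[(2 : R)%:C *: (u m - X (u m)) - (2 : R)%:C *: (u n - X (u n)),
      (2 : R)%:C *: X (u m) - (2 : R)%:C *: X (u n)]).
  move=> Xl X0 C; apply: vanishes2_le (vanishes2Z (ler0n _ 4) C) => m n.
  rewrite -!scalerBr -(clinB _ _ Xl).
  have -> : u m - X (u m) - (u n - X (u n)) = (u m - u n) - X (u m - u n).
    by rewrite (clinB _ _ Xl); vring dot.
  move: (u m - u n) => e; have := rdot_ge0 dot (X e).
  by rewrite rdotZl rdotZr rdotDl rdotNl (rdotC _ e (X e)); lra.
have [a aA] := cfrepresents_exists dot_norm cspaceT eA1.1.
have [b bB] := cfrepresents_exists dot_norm cspaceT eA2.1.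
apply: (@arith_mean_lim _ _ _ dot_norm setT _ _ a b p q y (f - y) cspaceT aA bB) => //.
- by move=> n; exact: (csubZ (2 : R)%:C (nsa_sub eA1.1) (XA1 (g n))).
- by move=> n; exact: (csubZ (2 : R)%:C (nsa_sub eA2.1) (XA2 (h n))).
- exact: pC.
- exact: pC.
- rewrite /y -phiE -(lim_y _ _ erefl); exact: cvgtoZ.
- rewrite /y -phiE -(lim_y _ _ erefl); exact: cvgtoZ.
- move=> u z _ _ _.
  have lim : cvgto dot (fun n => f - (X1 (g n) + X2 (h n))) (f - y).
    have -> : y = ((2^-1)%:C *: XF f + (4^-1)%:C *: d ((2^-1)%:C *: phi)) +
        ((2^-1)%:C *: XF f + (4^-1)%:C *: d ((2^-1)%:C *: phi)).
      by rewrite /y -phiE -(lim_y _ _ erefl) rmorphD/= scalerDl !scale1r.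
    by apply: cvgtoB; [exact: cvgto_cst|exact: cvgtoD].
  apply: rcvg_ext (rdot_cvgl (y := cfpi u) lim) => n.
  by rewrite /p /q /h /= !rdotE; lra.
Qed.

Lemma mean_parameter S A1 A2 Z1 Z2 : nsym dot S ->
  nsa_ext dot S A1 -> nsa_ext dot S A2 ->
  is_parameter dot S (cayley A1) Z1 -> is_parameter dot S (cayley A2) Z2 ->
  let N0 := N_0 dot S in let I0 := idrel N0 in
  is_parameter dot S (cayley (arith_mean_rel dot setT A1 A2))
    (diffrel (harm_mean_rel dot N0 (addrel I0 Z1) (addrel I0 Z2)) I0).
Proof.
move=> nS eA1 eA2 p1 p2 N0 I0.
have [XF [XK [d st]]] := param_setup_exists dot_norm nS.
have Nc : cspace N0 := ps_N st.
have [X1 r1] := resolvent_exists dot_norm eA1.1.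
have [X2 r2] := resolvent_exists dot_norm eA2.1.
have param A X Z : nsa_ext dot S A -> is_resolvent dot A X ->
    is_parameter dot S (cayley A) Z -> exists P, [/\ bounded_ge0 dot N0 P,
      addrel I0 Z = gr N0 P & forall x, X x = XF x + (4^-1)%:C *: d (P (d x))].
  move=> [nA SA] rX pZ; have [z [bz cz Nz Zz]] := contraction_fun dot_norm Nc pZ.1.
  move: pZ; rewrite Zz => /(is_parameter_gr dot_norm _ _ nS st)[_].
  rewrite (cayley_gr nA rX) => /gr_inj-XE.
  have [bP P0 P2] := bsa_add1 bz cz.
  exists (fun x => x + z x); split.
  - by split=> // x Nx; exact: csubD Nc.1 Nx (Nz x).
  - by rewrite /I0 idrel_gr addrel_gr.
  (* With [d ^+ 2 = 2 (XK - XF)], the parametrization of [2 X - I] turns into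
     [X = XF + d (I + z) d / 4]; hence the constant [4^-1]. *)
  - move=> x; have := XE x I; rewrite (clinD _ _ (bsa_lin (ps_d st))) (ps_dd st).
    move=> e; have -> : X x = (2^-1)%:C *: ((X x + X x - x) + x) by vring dot.
    by rewrite e; vring dot.
have [P1 [b1 -> X1E]] := param _ _ _ eA1 r1 p1.
have [P2 [b2 -> X2E]] := param _ _ _ eA2 r2 p2.
have [w [bw Nw WE w1]] := harm_mean_fun dot_norm Nc b1 b2.
rewrite WE /I0 idrel_gr diffrel_gr; apply/(is_parameter_gr dot_norm _ _ nS st).
have nM := (nsa_ext_mean dot_norm eA1 eA2).1.
have [XM rM] := resolvent_exists dot_norm nM.
have bw1 : bsa dot (fun x => w x - x).
  have [wl ws] := bw; split=> [a x y|x y]; last by rewrite !rdotE ws.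
  by rewrite wl scalerBr opprD addrACA.
split.
  apply: gr_contraction => // x Nx; apply: csubB Nc.1 (Nw x) Nx.
rewrite (cayley_gr nM rM); apply: eq_gr => x _.
have := mean_resolvent x nS st eA1 eA2 r1 r2 b1 b2 X1E X2E WE.
move=> /(resolventE nM rM); rewrite addrC subrK => ->.
by rewrite (clinB _ _ (bsa_lin (ps_d st))) (ps_dd st); vring dot.
Qed.

End MeanParameter.

(** * Parameters under inversion, harmonic means and Cayley means *)

Section InverseParameter.
Context {R : realType} {H : completeNormedModType R[i]}.
Context (dot : {dot H for (@Num.conj R[i])}).
Context (dot_norm : forall x : H, dot x x = `|x| ^+ 2).
Implicit Types (S A Z T : set (H * H)) (z : H -> H).

Lemma N_0_inv S : nsym dot S -> N_0 dot (S^-1)%relation = N_0 dot S.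
Proof.
move=> nS; have [XF [XK [d st]]] := param_setup_exists dot_norm nS.
exact: ps_N0 (param_setup_inv dot_norm nS st).
Qed.

Lemma cayley_inv A : nsa dot setT A -> cayley (A^-1)%relation = scalerel (-1) (cayley A).
Proof.
move=> nA; have [X rX] := resolvent_exists dot_norm nA.
rewrite (cayley_gr (nsa_inv csubT nA) (resolvent_inv nA rX)) (cayley_gr nA rX).
rewrite scalerel_gr; apply: eq_gr => x _.
by rewrite scaleN1r; vring dot.
Qed.

Lemma is_parameter_inv S A z : nsym dot S -> nsa dot setT A ->
  is_parameter dot S (cayley A) (gr (N_0 dot S) z) ->
  bsa dot z -> (forall x, N_0 dot S x -> N_0 dot S (z x)) ->
  is_parameter dot (S^-1)%relation (cayley (A^-1)%relation)
    (gr (N_0 dot S) (fun x => - z x)).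
Proof.
move=> nS nA pz bz Nz; have [XF [XK [d st]]] := param_setup_exists dot_norm nS.
have st' := param_setup_inv dot_norm nS st.
move: pz => /(is_parameter_gr dot_norm _ _ nS st)[cz AE].
apply/(is_parameter_gr dot_norm _ _ (nsym_inv nS) st'); split.
  apply: (gr_contraction dot_norm (ps_N st)).
  - by have [zl zs] := bz; split=> [a x y|x y]; [rewrite zl scalerN opprD|rewrite !rdotE zs].
  - by move=> x Nx; apply: csubN (ps_N st).1 (Nz x Nx).
  - move=> x Nx; rewrite rdotNl rdotNr opprK -(norm_le dot_norm).
    by have [_ _ /(_ (x, z x))] := cz; apply; exists x.
rewrite cayley_inv// AE scalerel_gr; apply: eq_gr => x _.
by rewrite scaleN1r (clinN _ (bsa_lin (ps_d st))); vring dot.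
Qed.

Lemma harm_mean_parameter S A1 A2 Z1 Z2 : nsym dot S ->
  nsa_ext dot S A1 -> nsa_ext dot S A2 ->
  is_parameter dot S (cayley A1) Z1 -> is_parameter dot S (cayley A2) Z2 ->
  let N0 := N_0 dot S in let I0 := idrel N0 in
  is_parameter dot S (cayley (harm_mean_rel dot setT A1 A2))
    (diffrel I0 (harm_mean_rel dot N0 (diffrel I0 Z1) (diffrel I0 Z2))).
Proof.
move=> nS eA1 eA2 p1 p2 N0 I0.
have [XF [XK [d st]]] := param_setup_exists dot_norm nS.
have Nc : cspace N0 := ps_N st.
have N0E := N_0_inv nS.
have [z1 [b1 c1 N1 Z1E]] := contraction_fun dot_norm Nc p1.1.
have [z2 [b2 c2 N2 Z2E]] := contraction_fun dot_norm Nc p2.1.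
rewrite Z1E in p1; rewrite Z2E in p2.
have q1 := is_parameter_inv nS eA1.1 p1 b1 (fun x _ => N1 x).
have q2 := is_parameter_inv nS eA2.1 p2 b2 (fun x _ => N2 x).
have eA1' := nsa_ext_inv eA1; have eA2' := nsa_ext_inv eA2.
have /= := mean_parameter dot_norm (nsym_inv nS) eA1' eA2' q1 q2.
rewrite N0E -/N0 -/I0 => pm.
have bN z : bsa dot z -> contr dot z -> (forall x, N0 (z x)) ->
    bounded_ge0 dot N0 (fun x => x + - z x).
  move=> [zl zs] cz Nz.
  have [||bP P0 P2] := @bsa_add1 _ _ dot (fun x => - z x).
  - by split=> [a x y|x y]; [rewrite zl scalerN opprD|rewrite !rdotE zs].
  - by move=> x; rewrite rdotNl rdotNr opprK.
  - by split=> // x Nx; apply: csubB Nc.1 Nx (Nz x).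
have [w [bw Nw WE w1]] := harm_mean_fun dot_norm Nc (bN _ b1 c1 N1) (bN _ b2 c2 N2).
have IE z : diffrel I0 (gr N0 z) = gr N0 (fun x => x + - z x).
  by rewrite /I0 idrel_gr diffrel_gr.
have IE' z : addrel I0 (gr N0 (fun x => - z x)) = gr N0 (fun x => x + - z x).
  by rewrite /I0 idrel_gr addrel_gr.
move: pm; rewrite !IE' Z1E Z2E !IE WE /I0 idrel_gr !diffrel_gr.
rewrite -[N0]N0E => pm.
have bw1 : bsa dot (fun x => w x - x).
  have [wl ws] := bw; split=> [a x y|x y]; last by rewrite !rdotE ws.
  by rewrite wl scalerBr opprD addrACA.
have nM := (nsa_ext_mean dot_norm eA1' eA2').1.
have := is_parameter_inv (nsym_inv nS) nM pm bw1.
rewrite !inv_relK N0E -/N0.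
have -> : gr N0 (fun x => - (w x - x)) = gr N0 (fun x => x - w x).
  by apply: eq_gr => x _; rewrite opprB.
by apply=> x Nx; apply: csubB Nc.1 (Nw x) Nx.
Qed.

Lemma cayley_mean_parameter S A1 A2 Z1 Z2 : nsym dot S ->
  nsa_ext dot S A1 -> nsa_ext dot S A2 ->
  is_parameter dot S (cayley A1) Z1 -> is_parameter dot S (cayley A2) Z2 ->
  is_parameter dot S (cayley (cayley_mean_rel A1 A2)) (scalerel 2^-1 (addrel Z1 Z2)).
Proof.
move=> nS eA1 eA2 p1 p2.
have [XF [XK [d st]]] := param_setup_exists dot_norm nS.
have Nc : cspace (N_0 dot S) := ps_N st.
have [X1 r1] := resolvent_exists dot_norm eA1.1.
have [X2 r2] := resolvent_exists dot_norm eA2.1.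
have [nC rC] := cayley_mean_resolvent eA1.1 eA2.1 r1 r2.
have [z1 [b1 c1 N1 Z1E]] := contraction_fun dot_norm Nc p1.1.
have [z2 [b2 c2 N2 Z2E]] := contraction_fun dot_norm Nc p2.1.
move: p1 p2; rewrite Z1E Z2E half_complexE addrel_gr scalerel_gr.
move=> /(is_parameter_gr dot_norm _ _ nS st)[_ A1E].
move=> /(is_parameter_gr dot_norm _ _ nS st)[_ A2E].
move: A1E A2E; rewrite (cayley_gr eA1.1 r1) (cayley_gr eA2.1 r2) => /gr_inj-A1E /gr_inj-A2E.
apply/(is_parameter_gr dot_norm _ _ nS st); split.
  apply: (gr_contraction dot_norm Nc).
  - have [[l1 s1] [l2 s2]] := (b1, b2).
    split=> [a x y|x y]; last by rewrite !rdotE s1 s2.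
    rewrite l1 l2 addrACA -scalerDr [LHS]scalerDr; congr (_ + _).
    by rewrite !scalerA [in RHS]mulrC.
  - by move=> x _; apply: csubZ Nc.1 (csubD Nc.1 (N1 x) (N2 x)).
  - move=> x _; rewrite rdotZl rdotZr; have := rdot_triangle dot (z1 x) (z2 x).
    by have := c1 x; have := c2 x; lra.
rewrite (cayley_gr nC rC); apply: eq_gr => x _.
have dl := bsa_lin (ps_d st).
rewrite (clinZ _ _ dl) (clinD _ _ dl).
have -> : (2^-1)%:C *: (X1 x + X2 x) + (2^-1)%:C *: (X1 x + X2 x) - x =
    (2^-1)%:C *: ((X1 x + X1 x - x) + (X2 x + X2 x - x)) by vring dot.
by rewrite A1E// A2E//; vring dot.
Qed.

Lemma nsa_ext_cayley_mean S A B : nsa_ext dot S A -> nsa_ext dot S B ->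
  nsa_ext dot S (cayley_mean_rel A B).
Proof.
move=> [nA SA] [nB SB].
have [X rX] := resolvent_exists dot_norm nA; have [Y rY] := resolvent_exists dot_norm nB.
have [nC [_ _ CE]] := cayley_mean_resolvent nA nB rX rY; split=> // -[x y] Sxy.
have := CE (x + y).
rewrite (resolventE nA rX (SA _ Sxy)) (resolventE nB rY (SB _ Sxy)).
have -> : (2^-1)%:C *: (x + x) = x by vring dot.
by rewrite addrC addKr.
Qed.

End InverseParameter.

Theorem theorem7p1 (R : realType) (H : completeNormedModType R[i])
    (dot : {dot H for (@Num.conj R[i])})
    (dot_norm : forall x : H, dot x x = `|x| ^+ 2)
    (S : set (H * H))
    (S_linear : linear_relation_in setT S)
    (S_symmetric : symmetric_relation dot S)
    (S_nonneg : nonnegative dot S) :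
  [/\ (* (1) *)
      forall S1 S2 : set (H * H),
        nonneg_sa_extension dot S S1 -> nonneg_sa_extension dot S S2 ->
        [/\ nonneg_sa_extension dot S (arith_mean_rel dot setT S1 S2),
            nonneg_sa_extension dot S (harm_mean_rel dot setT S1 S2)
          & nonneg_sa_extension dot S (cayley_mean_rel S1 S2)],
      (* (2) *)
      forall S1 S2 Z1 Z2 : set (H * H),
        nonneg_sa_extension dot S S1 -> nonneg_sa_extension dot S S2 ->
        is_parameter dot S (cayley S1) Z1 -> is_parameter dot S (cayley S2) Z2 ->
        let N0 := N_0 dot S in
        let I0 := idrel N0 in
        [/\ is_parameter dot S (cayley (arith_mean_rel dot setT S1 S2))
              (diffrel (harm_mean_rel dot N0 (addrel I0 Z1) (addrel I0 Z2)) I0),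
            is_parameter dot S (cayley (harm_mean_rel dot setT S1 S2))
              (diffrel I0 (harm_mean_rel dot N0 (diffrel I0 Z1) (diffrel I0 Z2)))
          & is_parameter dot S (cayley (cayley_mean_rel S1 S2))
              (scalerel 2^-1 (addrel Z1 Z2))],
      (* (3) *)
      forall S1 : set (H * H), nonneg_sa_extension dot S S1 ->
        arith_mean_rel dot setT (friedrichs dot S) S1 = friedrichs dot S /\
        harm_mean_rel dot setT (krein dot S) S1 = krein dot S
    & (* (4) *)
      (forall S1 S2 : set (H * H),
        extremal_extension dot S S1 -> extremal_extension dot S S2 ->
        extremal_extension dot S (arith_mean_rel dot setT S1 S2) /\
        extremal_extension dot S (harm_mean_rel dot setT S1 S2)) /\
      (forall S1 : set (H * H), extremal_extension dot S S1 ->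
        arith_mean_rel dot setT (krein dot S) S1 = S1 /\
        harm_mean_rel dot setT (friedrichs dot S) S1 = S1)].
Proof.
have nS : nsym dot S by exact: nsymP.
have Ss := nsym_sub nS; have nS' := nsym_inv nS.
have fF := friedrichsP dot_norm nS; have kK := kreinP dot_norm nS.
have extP A := nonneg_sa_extensionP dot_norm S A.
have extrP A := extremal_extensionP dot_norm A Ss.
have harmE A B : harm_mean_rel dot setT A B =
  ((arith_mean_rel dot setT (A^-1)%relation (B^-1)%relation)^-1)%relation by [].
have harm_ext A B : nsa_ext dot S A -> nsa_ext dot S B ->
    nsa_ext dot S (harm_mean_rel dot setT A B).
  move=> eA eB; rewrite harmE -{1}[S]inv_relK.
  by apply: nsa_ext_inv; apply: nsa_ext_mean => //; exact: nsa_ext_inv.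
(* [S_F^-1] is the Kreĭn extension of [S^-1], so the harmonic claims on extremal extensions are the
   arithmetic ones for [S^-1]. *)
have kF : is_krein dot (S^-1)%relation ((friedrichs dot S)^-1)%relation.
  by rewrite /is_krein !inv_relK.
split.
- move=> S1 S2 /extP e1 /extP e2; split; apply/extP.
  + exact: nsa_ext_mean.
  + exact: harm_ext.
  + exact: nsa_ext_cayley_mean.
- move=> S1 S2 Z1 Z2 /extP e1 /extP e2 p1 p2; split.
  + exact: mean_parameter.
  + exact: harm_mean_parameter.
  + exact: cayley_mean_parameter.
- move=> S1 /extP e1; split; first exact: (friedrichs_mean dot_norm fF e1).
  by rewrite harmE (friedrichs_mean dot_norm kK (nsa_ext_inv e1)) inv_relK.
split.
  move=> S1 S2 /extrP[e1 a1] /extrP[e2 a2]; split; apply/extrP; split.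
  + exact: nsa_ext_mean.
  + exact: (extremal_mean dot_norm kK e1 a1 e2 a2).
  + exact: harm_ext.
  + rewrite harmE -{1}[S]inv_relK; apply: almost_in_inv.
    apply: (extremal_mean dot_norm kF).
    * exact: nsa_ext_inv. * exact: almost_in_inv.
    * exact: nsa_ext_inv. * exact: almost_in_inv.
move=> S1 /extrP[e1 a1]; split; first exact: (krein_mean dot_norm kK e1 a1).
rewrite harmE (krein_mean dot_norm kF (nsa_ext_inv e1) (almost_in_inv a1)).
exact: inv_relK.
Qed.
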